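(* Over a field $k$ of characteristic $0$, the operads $\mathcal{A}s$, $\mathcal{C}om$ and $\mathcal{L}ie$ are Koszul.
   Context: $\mathcal{A}s(n)$, $\mathcal{C}om(n)$, $\mathcal{L}ie(n)$ are the subspaces, in the free associative, free commutative associative, and free Lie $k$-algebra on $x_1,\dots,x_n$, spanned by monomials containing each $x_i$ exactly once; $\Sigma_n$ permutes variables and compositions are given by substitution. These are quadratic operads (generated by $\mathcal P(2)$ with relations generated in $\mathcal P(3)$) with $\mathcal P(1)=k$. For an operad $\mathcal P$ with $\mathcal P(1)=k$, extended to finite sets by $\mathcal P(I)=(\bigoplus_{f\in\mathrm{Iso}([n],I)}\mathcal P(n))_{\Sigma_n}$: an $n$-tree $T$ is an isomorphism class of reduced rooted trees (each vertex $v$ has a set $\mathrm{In}(v)$ of at least two inputs and one output) with inputs labelled by $\{1,\dots,n\}$ and one output. $|T|$ is the number of internal edges, and $\mathrm{Det}(T)$ is the top exterior power of the vector space spanned by all edges of $T$ except the output. $\mathcal P(T)=\bigotimes_v\mathcal P(\mathrm{In}(v))$, and $T/e$ is $T$ with the internal edge $e$ contracted. Let $\mathbf D(\mathcal P)(n)$ be the complex $$\bigoplus_{|T|=0}\mathcal P(T)^*\otimes\mathrm{Det}(T)\to\bigoplus_{|T|=1}\mathcal P(T)^*\otimes\mathrm{Det}(T)\to\dots\to\bigoplus_{|T|=n-2}\mathcal P(T)^*\otimes\mathrm{Det}(T)$$ (sums over $n$-trees), whose matrix elements from the summand of $T/e$ to that of $T$ are the transposed composition $\mathcal P(T)\to\mathcal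 P(T/e)$ tensored with exterior multiplication $e\wedge$. A quadratic operad $\mathcal P$ is Koszul if the natural map from $\mathbf D(\mathcal P)$ to the quadratic dual operad $\mathcal P^!$ is a quasi-isomorphism, i.e. if for every $n\ge2$ the complex $\mathbf D(\mathcal P)(n)$ is exact everywhere except at its rightmost term. *)

(* Defs.v *)
From HB Require Import structures.
From mathcomp Require Import all_boot all_order all_algebra all_fingroup.
From mathcomp Require Import zify.
From mathcomp Require Import boolp.

Set Implicit Arguments.
Unset Strict Implicit.
Unset Printing Implicit Defensive.

Import GRing.Theory.
Local Open Scope ring_scope.

(* Renaming of the variables of p in p o_i q, where q has arity n: for a <> i,
   the variable x_a of p becomes x_(ins_var n i a), while the variable x_b of q
   becomes x_(i + b).  Indices start at 0. *)
Definition ins_var (n i a : nat) : nat := if (a < i)%N then a else (a + n).-1.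

(* Operads in the partial composition style: op_comp h i p q is
     p(x_0, .., x_(i-1), q(x_i, .., x_(i+n-1)), x_(i+n), ..).
   The arity of the result is a separate variable, constrained by
   p.+1 = m + n, so that the axioms can be stated without transport.  The
   permutation s acts by the change of variables x_i |-> x_(s i); since
   (s * t) i = t (s i) in the library, op_actM is stated in that order.
   op_unit says that P(1) = k.  The space in arity 0 plays no role below. *)
Record operad (k : fieldType) := Operad {
  op_sp : nat -> lmodType k;
  op_act : forall n, 'S_n -> op_sp n -> op_sp n;
  op_comp : forall m n p, p.+1 = (m + n)%N ->
    'I_m -> op_sp m -> op_sp n -> op_sp p;
  op_one : op_sp 1;
  op_act_linear : forall n (s : 'S_n), linear (op_act s);
  op_act1 : forall n (x : op_sp n), op_act 1%g x = x;
  op_actM : forall n (s t : 'S_n) (x : op_sp n),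
    op_act (s * t)%g x = op_act t (op_act s x);
  op_comp_linearl : forall m n p (h : p.+1 = (m + n)%N) i (y : op_sp n),
    linear (fun x => op_comp h i x y);
  op_comp_linearr : forall m n p (h : p.+1 = (m + n)%N) i (x : op_sp m),
    linear (op_comp h i x);
  op_comp_act : forall m n p (h : p.+1 = (m + n)%N) (i : 'I_m)
      (s : 'S_m) (t : 'S_n) (r : 'S_p) (x : op_sp m) (y : op_sp n),
    (forall (a : 'I_m) (c : 'I_p), a != i -> c = ins_var n i a :> nat ->
       r c = ins_var n (s i) (s a) :> nat) ->
    (forall (b : 'I_n) (c : 'I_p), c = (i + b)%N :> nat ->
       r c = (s i + t b)%N :> nat) ->
    op_comp h (s i) (op_act s x) (op_act t y) = op_act r (op_comp h i x y);
  op_one_comp : forall n (h : n.+1 = (1 + n)%N) (x : op_sp n),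
    op_comp h ord0 op_one x = x;
  op_comp_one : forall n (h : n.+1 = (n + 1)%N) i (x : op_sp n),
    op_comp h i x op_one = x;
  op_comp_seq : forall l m n u v p (hu : u.+1 = (m + n)%N)
      (hv : v.+1 = (l + m)%N) (hp : p.+1 = (l + u)%N) (hp' : p.+1 = (v + n)%N)
      (i : 'I_l) (j : 'I_m) (ij : 'I_v)
      (x : op_sp l) (y : op_sp m) (z : op_sp n), ij = (i + j)%N :> nat ->
    op_comp hp i x (op_comp hu j y z) = op_comp hp' ij (op_comp hv i x y) z;
  op_comp_par : forall l m n u v p (hu : u.+1 = (l + m)%N)
      (hv : v.+1 = (l + n)%N) (hp : p.+1 = (u + n)%N) (hp' : p.+1 = (v + m)%N)
      (i j : 'I_l) (i' : 'I_v) (j' : 'I_u)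
      (x : op_sp l) (y : op_sp m) (z : op_sp n), (i < j)%N ->
      i' = i :> nat -> j'.+1 = (j + m)%N ->
    op_comp hp j' (op_comp hu i x y) z = op_comp hp' i' (op_comp hv j x z) y;
  op_unit : forall x : op_sp 1, exists! a : k, x = a *: op_one }.

Section Trees.

Variable n : nat.
Implicit Types (T : {set {set 'I_n}}) (v e : {set 'I_n}).

(* An n-tree, i.e. an isomorphism class of reduced rooted trees with inputs
   labelled by 'I_n, is encoded by the set of the label sets of its vertices,
   where the label set of a vertex consists of the inputs of the tree lying
   above it.  The sets arising in this way are described by ntree; ntreeP and
   clusters_iso below show that they correspond bijectively to isomorphism
   classes of reduced rooted trees.  In this encoding
   - an edge is the label set of what lies above it: the output edge is setT,
     the input edge i is [set i], and the output of a vertex v is v itself;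
   - the inputs of a vertex v are the maximal edges strictly contained in v
     (inputs_clusters);
   - contracting the internal edge e merges the vertex e into the vertex below
     it, so that T / e is T :\ e. *)
Definition ntree T : bool :=
  [&& setT \in T,
      [forall v in T, (1 < #|v|)%N] &
      [forall u in T, forall v in T,
        [|| u \subset v, v \subset u | [disjoint u & v]]]].

(* All edges except the output. *)
Definition edges T : {set {set 'I_n}} :=
  (T :|: [set [set i] | i : 'I_n]) :\ setT.

(* Internal edges; |T| is #|iedges T|. *)
Definition iedges T : {set {set 'I_n}} := T :\ setT.

Definition inputs T v : {set {set 'I_n}} :=
  [set e in edges T | (e \proper v) &&
     [forall f in edges T, (e \proper f) ==> ~~ (f \proper v)]].

End Trees.

Section RootedTrees.

Variable n : nat.

(* A rooted tree is given by its vertices, the vertex below each vertex (with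
   the convention parent root = root) and the vertex each input is attached to;
   by reducedness every vertex has at least two inputs. *)
Record rtree := RTree {
  vert : finType;
  troot : vert;
  parent : vert -> vert;
  leaf : 'I_n -> vert;
  parent_root : parent troot = troot;
  rooted : forall v, fconnect parent v troot;
  reduced : forall v,
    (1 < #|[set u | (u != troot) && (parent u == v)]|
         + #|[set i | leaf i == v]|)%N }.

Definition cluster (t : rtree) (v : vert t) : {set 'I_n} :=
  [set i | fconnect (@parent t) (leaf t i) v].

Definition clusters (t : rtree) : {set {set 'I_n}} :=
  [set cluster v | v : vert t].

Definition rtree_iso (t t' : rtree) : Prop :=
  exists f : vert t -> vert t',
    [/\ bijective f, f (troot t) = troot t',
        forall v, f (parent v) = parent (f v) &
        forall i, f (leaf t i) = leaf t' i].

Section Clusters.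

Variable t : rtree.
Implicit Types u v : vert t.
Local Notation below u v := (fconnect (@parent t) u v).

Lemma fconnect_root v : below (troot t) v -> v = troot t.
Proof.
move/iter_findex <-; elim: (findex _ _ _) => //= m ->; exact: parent_root.
Qed.

Lemma below_comparable w u v : below w u -> below w v -> below u v || below v u.
Proof.
move=> /iter_findex <- /iter_findex <-.
move: (findex _ w u) (findex _ w v) => a b.
by case: (leqP a b) => [ab|/ltnW ab]; apply/orP; [left|right];
  rewrite -(subnK ab) iterD fconnect_iter.
Qed.

Lemma below_parent u v : below u v -> u != v -> below (parent u) v.
Proof.
move=> uv; rewrite fconnect_eqVf in uv.
by move=> /negbTE nuv; rewrite nuv in uv.
Qed.

Lemma parent_neq v : v != troot t -> parent v != v.
Proof.
apply: contraNneq => e; have := rooted v => /iter_findex <-.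
by elim: (findex _ _ _) => //= m /eqP <-; rewrite e.
Qed.

Lemma below_anti u v : below u v -> below v u -> u = v.
Proof.
move=> uv vu; apply/eqP; apply: contraT => nuv.
have cyc : forall m, below (iter m (@parent t) u) u.
  elim=> [|m IH]; first exact: connect0.
  rewrite iterS; case: (eqVneq (iter m (@parent t) u) u) => [->|ne].
    exact: connect_trans (below_parent uv nuv) vu.
  exact: below_parent.
have := rooted u => /iter_findex e.
have ur : u = troot t by apply: fconnect_root; rewrite -e; apply: cyc.
by rewrite ur (fconnect_root (v := v)) ?eqxx // -ur in nuv.
Qed.

Lemma cluster_sub u v : below u v -> cluster u \subset cluster v.
Proof.
by move=> uv; apply/subsetP => i; rewrite !inE => iu; apply: connect_trans uv.
Qed.

Lemma cluster_leaf v i : leaf t i == v -> i \in cluster v.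
Proof. by move/eqP <-; rewrite inE. Qed.

Lemma cluster_root : cluster (troot t) = setT.
Proof. by apply/setP => i; rewrite !inE rooted. Qed.

Lemma cluster_trivI u v : ~~ below u v -> ~~ below v u ->
  [disjoint cluster u & cluster v].
Proof.
move=> uv vu; rewrite -setI_eq0; apply/eqP/setP => i; rewrite !inE.
apply/negP => /andP[iu iv].
by have := below_comparable iu iv; rewrite (negbTE uv) (negbTE vu).
Qed.

Lemma child_below u v : parent u = v -> below u v.
Proof. by move<-; apply: fconnect1. Qed.

Lemma child_nbelow u v : u != troot t -> parent u = v -> ~~ below v u.
Proof.
move=> ur e; apply/negP => vu.
have := below_anti (child_below e) vu => uv.
by have := parent_neq ur; rewrite e uv eqxx.
Qed.

Lemma siblings_nbelow u u' v : u != troot t -> parent u = v ->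
  u' != troot t -> parent u' = v -> u != u' -> ~~ below u u'.
Proof.
move=> ur e ur' e' uu'; apply/negP => b.
by have := below_parent b uu'; rewrite e; apply/negP; apply: child_nbelow.
Qed.

Definition depth_below v := #|[set u | below u v]|.

Lemma depth_child u v : u != troot t -> parent u = v ->
  (depth_below u < depth_below v)%N.
Proof.
move=> ur e; apply: proper_card; apply/properP; split.
  apply/subsetP => w; rewrite !inE => wu; apply: connect_trans wu _.
  exact: child_below.
by exists v; rewrite inE ?connect0 // child_nbelow.
Qed.

Lemma cluster_neq0 v : cluster v != set0.
Proof.
have [m] := ubnP (depth_below v); elim: m v => // m IH v hv.
case: (set_0Vmem [set i | leaf t i == v]) => [e|[i]].
  have := reduced v; rewrite e cards0 addn0 => /ltnW /card_gt0P [u].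
  rewrite inE => /andP[ur /eqP uv].
  have /set0Pn [i hi] : cluster u != set0.
    by apply: IH; apply: leq_trans (depth_child ur uv) _; rewrite -ltnS.
  apply/set0Pn; exists i; apply: subsetP hi; exact/cluster_sub/child_below.
by rewrite inE => /cluster_leaf hi; apply/set0Pn; exists i.
Qed.

Lemma cluster_child_proper u v : u != troot t -> parent u = v ->
  cluster u \proper cluster v.
Proof.
move=> ur uv; rewrite properE cluster_sub ?child_below //=.
apply/negP => sub.
have no_i i : leaf t i != v.
  apply/negP => iv; have := subsetP sub _ (cluster_leaf iv).
  by rewrite inE (eqP iv); apply/negP; apply: child_nbelow.
have := reduced v.
have -> : [set i | leaf t i == v] = set0.
  by apply/setP => i; rewrite !inE (negbTE (no_i i)).
rewrite cards0 addn0 => /card_gt1P [a [b]]; rewrite !inE.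
case=> /andP[ar /eqP av] /andP[br /eqP bv] ab.
have [c [cr cv cu]] : exists c, [/\ c != troot t, parent c = v & c != u].
  by case: (eqVneq a u) => [au|]; [exists b; split; rewrite // -au eq_sym | exists a; split].
have /set0Pn [i ic] := cluster_neq0 c.
have iu : i \in cluster u.
  by apply: (subsetP sub); apply: subsetP ic; apply/cluster_sub/child_below.
have /disjoint_setI0 /setP /(_ i) : [disjoint cluster c & cluster u].
  by apply: cluster_trivI; apply: siblings_nbelow; eauto; rewrite eq_sym.
by rewrite inE ic iu inE.
Qed.

Lemma cluster_proper u v : below u v -> u != v -> cluster u \proper cluster v.
Proof.
move=> uv nuv; have ur : u != troot t.
  apply: contra_neq nuv => ur; rewrite ur in uv *.
  by rewrite (fconnect_root uv).
apply: proper_sub_trans (cluster_child_proper ur erefl) _.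
exact/cluster_sub/below_parent.
Qed.

Lemma belowE u v : below u v = (cluster u \subset cluster v).
Proof.
apply/idP/idP => [|sub]; first exact: cluster_sub.
have /set0Pn [i iu] := cluster_neq0 u.
have iv := subsetP sub i iu; rewrite !inE in iu iv.
have /orP[//|vu] := below_comparable iu iv.
case: (eqVneq v u) => [->|/(cluster_proper vu)]; first exact: connect0.
by rewrite properE sub andbF.
Qed.

Lemma cluster_inj : injective (@cluster t).
Proof. by move=> u v e; apply: below_anti; rewrite belowE e. Qed.

Lemma cluster_gt1 v : (1 < #|cluster v|)%N.
Proof.
case: (set_0Vmem [set u | (u != troot t) && (parent u == v)]) => [e|[u]].
  have := reduced v; rewrite e cards0 add0n => h; apply: leq_trans h _.
  apply: subset_leq_card; apply/subsetP => i; rewrite inE.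
  exact: cluster_leaf.
rewrite inE => /andP[ur /eqP uv].
apply: leq_trans (proper_card (cluster_child_proper ur uv)).
by rewrite ltnS card_gt0 cluster_neq0.
Qed.

Lemma clusters_ntree : ntree (clusters t).
Proof.
apply/and3P; split.
- by apply/imsetP; exists (troot t); rewrite ?cluster_root.
- by apply/forall_inP => _ /imsetP[v _ ->]; apply: cluster_gt1.
apply/forall_inP => _ /imsetP[u _ ->]; apply/forall_inP => _ /imsetP[v _ ->].
case: (boolP (below u v)) => uv; first by rewrite cluster_sub.
case: (boolP (below v u)) => vu; first by rewrite (cluster_sub vu) orbT.
by rewrite cluster_trivI ?orbT.
Qed.

Lemma cluster_parent v : v != troot t ->
  forall u, (cluster v \proper cluster u) = (cluster (parent v) \subset cluster u).
Proof.
move=> vr u; apply/idP/idP => [vu|]; last first.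
  by apply: proper_sub_trans; apply: cluster_child_proper.
rewrite -belowE; apply: below_parent; first by rewrite belowE proper_sub.
by apply: contraTneq vu => ->; rewrite properxx.
Qed.

Lemma inputs_clusters v :
  inputs (clusters t) (cluster v) =
  [set cluster u | u in [set u | (u != troot t) && (parent u == v)]]
  :|: [set [set i] | i in [set i | leaf t i == v]].
Proof.
apply/setP => e; rewrite !inE; apply/idP/idP.
  case/andP => /andP[eT /orP[/imsetP[u _ eu]|/imsetP[i _ ei]]].
    case/andP => ev /forall_inP max; apply/orP; left; apply/imsetP.
    rewrite eu in eT ev max *.
    exists u => //; rewrite inE.
    have ur : u != troot t by apply: contraNneq eT => ->; rewrite cluster_root.
    rewrite ur /=; rewrite cluster_parent // in ev.
    case: (eqVneq (parent u) v) => // pv.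
    have pe : cluster (parent u) \in edges (clusters t).
      rewrite !inE imset_f ?andbT //=; apply: contraNneq pv => pT.
      have e1 : parent u = troot t by apply: cluster_inj; rewrite cluster_root.
      apply/eqP/cluster_inj/eqP; rewrite eqEsubset ev pT subsetT //.
    have := max _ pe; rewrite cluster_child_proper //=.
    by rewrite cluster_proper // belowE.
  case/andP => ev /forall_inP max; apply/orP; right; apply/imsetP.
  exists i => //; rewrite inE; rewrite ei in eT ev max.
  have iv : below (leaf t i) v.
    by have := subsetP (proper_sub ev) i; rewrite !inE eqxx => ->.
  case: (eqVneq (leaf t i) v) => // lv.
  have li : [set i] \proper cluster (leaf t i).
    rewrite properEcard sub1set cards1 cluster_gt1 andbT.
    exact: cluster_leaf.
  have lT : cluster (leaf t i) != setT.
    apply: contraTneq (cluster_proper iv lv) => ->.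
    by rewrite properE subsetT andbF.
  have := max (cluster (leaf t i)); rewrite !inE lT imset_f //= li.
  by rewrite cluster_proper // => /(_ isT).
case/orP => [/imsetP[u]|/imsetP[i]]; rewrite inE.
  case/andP => ur /eqP uv ->; rewrite cluster_child_proper // imset_f //=.
  rewrite !andbT; apply/andP; split.
    apply: contraNneq ur => e1; apply/eqP/cluster_inj.
    by rewrite cluster_root.
  apply/forall_inP => f; rewrite !inE => /andP[_ /orP[/imsetP[w _ ->]|]].
    apply/implyP; rewrite cluster_parent // uv => vw.
    by rewrite properE vw andbF.
  case/imsetP => i _ ->; apply/implyP => /proper_card.
  by rewrite cards1 ltnNge (leq_trans _ (cluster_gt1 u)).
move=> iv ->; have sv : [set i] \proper cluster v.
  by rewrite properEcard sub1set cards1 cluster_gt1 cluster_leaf.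
rewrite sv (imset_f (fun i => [set i])) // orbT andbT /=; apply/andP; split.
  by apply: contraTneq sv => ->; rewrite properE subsetT andbF.
apply/forall_inP => f; rewrite !inE => /andP[_ /orP[/imsetP[w _ ->]|]].
  apply/implyP => /proper_sub; rewrite sub1set inE (eqP iv) => vw.
  by rewrite properE (cluster_sub vw) andbF.
case/imsetP => j _ ->; apply/implyP => /proper_card.
by rewrite !cards1.
Qed.

End Clusters.

Lemma mem_cluster (t : rtree) (i : 'I_n) (v : vert t) :
  (i \in cluster v) = (cluster (leaf t i) \subset cluster v).
Proof. by rewrite inE belowE. Qed.

Lemma clusters_iso (t t' : rtree) : clusters t = clusters t' <-> rtree_iso t t'.
Proof.
split=> [e|[f [[g fK gK] froot fparent fleaf]]]; last first.
  have fcl v : cluster (f v) = cluster v.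
    apply/setP => i; rewrite !inE -fleaf; apply/idP/idP => /iter_findex.
      move: (findex _ _ _) => m e; rewrite -(fK v) -e -{1}(fK (leaf t i)).
      have -> : g (iter m (@parent t') (f (leaf t i)))
              = iter m (@parent t) (leaf t i).
        by apply: (can_inj fK); rewrite gK; elim: m {e} => //= m ->.
      by rewrite fK fconnect_iter.
    move: (findex _ _ _) => m <-.
    have -> : f (iter m (@parent t) (leaf t i))
            = iter m (@parent t') (f (leaf t i)).
      by elim: m => //= m <-.
    exact: fconnect_iter.
  apply/setP => A; apply/imsetP/imsetP => [[v _ ->]|[v _ ->]].
    by exists (f v).
  by exists (g v) => //; rewrite -fcl gK.
have match_t (t1 t2 : rtree) (v : vert t1) :
    clusters t1 = clusters t2 -> exists v' : vert t2, cluster v' == cluster v.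
  move=> e12; have : cluster v \in clusters t2 by rewrite -e12 imset_f.
  by case/imsetP => v' _ ->; exists v'.
pose f v := xchoose (@match_t t t' v e).
pose g v := xchoose (@match_t t' t v (esym e)).
have fE v : cluster (f v) = cluster v by apply/eqP/(xchooseP (match_t _ _ v e)).
have gE v : cluster (g v) = cluster v.
  by apply/eqP/(xchooseP (match_t _ _ v (esym e))).
have froot : f (troot t) = troot t'.
  by apply: cluster_inj; rewrite fE !cluster_root.
exists f; split=> //.
- by exists g => v; apply: cluster_inj; rewrite ?gE ?fE ?gE.
- move=> v; case: (eqVneq v (troot t)) => [->|vr].
    by rewrite parent_root froot parent_root.
  have fvr : f v != troot t'.
    apply: contra_neq vr => fvr.
    by apply: cluster_inj; rewrite -fE fvr !cluster_root.
  apply: cluster_inj; apply/eqP; rewrite fE eqEsubset; apply/andP; split.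
    rewrite -(gE (parent (f v))) -cluster_parent // gE -(fE v).
    exact: cluster_child_proper.
  rewrite -(fE (parent v)) -cluster_parent // !fE.
  exact: cluster_child_proper.
- move=> i; apply: cluster_inj; apply/eqP; rewrite fE eqEsubset.
  apply/andP; split.
    by rewrite -(gE (leaf t' i)) -mem_cluster gE cluster_leaf.
  by rewrite -(fE (leaf t i)) -mem_cluster fE cluster_leaf.
Qed.

Section TreeOfClusters.

Variables (T : {set {set 'I_n}}) (ntreeT : ntree T).
Implicit Types u v : {set 'I_n}.

Let setT_T : setT \in T. Proof. by case/and3P: ntreeT. Qed.

Let T_gt1 v : v \in T -> (1 < #|v|)%N.
Proof. by case/and3P: ntreeT => _ /forall_inP h _ /h. Qed.

Let T_comparable u v i : u \in T -> v \in T -> i \in u -> i \in v ->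
  (u \subset v) || (v \subset u).
Proof.
case/and3P: ntreeT => _ _ /forall_inP h /h /forall_inP {}h /h.
rewrite orbA => /orP[//|/disjoint_setI0 /setP /(_ i)].
by rewrite !inE => + iu iv; rewrite iu iv.
Qed.

Definition least_in (Q : pred {set 'I_n}) : {set 'I_n} :=
  [arg min_(u < setT | (u \in T) && Q u) #|u|].

Lemma least_inP (Q : pred {set 'I_n}) i : Q setT -> (forall u, Q u -> i \in u) ->
  [/\ least_in Q \in T, Q (least_in Q) &
      forall u, u \in T -> Q u -> least_in Q \subset u].
Proof.
move=> QT Qi; rewrite /least_in; case: arg_minnP; first by rewrite setT_T.
move=> m /andP[mT Qm] min; split=> // u uT Qu.
have /orP[//|um] := T_comparable mT uT (Qi _ Qm) (Qi _ Qu).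
have /eqP -> // : u == m by rewrite eqEcard um min // uT.
Qed.

Let V := {v : {set 'I_n} | v \in T}.

Definition cparent_val v : {set 'I_n} :=
  if v == setT then setT else least_in (fun u => v \proper u).

Lemma cparentP v : v \in T -> v != setT ->
  [/\ cparent_val v \in T, v \proper cparent_val v &
      forall u, u \in T -> v \proper u -> cparent_val v \subset u].
Proof.
move=> vT nvT; rewrite /cparent_val (negbTE nvT).
have /ltnW /card_gt0P [i iv] := T_gt1 vT.
apply: (@least_inP _ i); first by rewrite properT.
by move=> u /proper_sub /subsetP; apply.
Qed.

Lemma cparent_in v : v \in T -> cparent_val v \in T.
Proof.
move=> vT; case: (eqVneq v setT) => [->|nvT]; first by rewrite /cparent_val eqxx.
by case: (cparentP vT nvT).
Qed.

Definition cparent (v : V) : V := exist (fun u => u \in T) _ (cparent_in (valP v)).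
Definition croot : V := exist (fun u => u \in T) _ setT_T.

Lemma cleafP i : [/\ least_in (fun u => i \in u) \in T,
    i \in least_in (fun u => i \in u) &
    forall u, u \in T -> i \in u -> least_in (fun u => i \in u) \subset u].
Proof. by apply: (@least_inP _ i); rewrite ?inE. Qed.

Lemma cleaf_in i : least_in (fun u => i \in u) \in T.
Proof. by case: (cleafP i). Qed.

Definition cleaf i : V := exist (fun u => u \in T) _ (cleaf_in i).

Lemma cparent_root : cparent croot = croot.
Proof. by apply: val_inj; rewrite /= /cparent_val eqxx. Qed.

Lemma cbelowE (u v : V) : fconnect cparent u v = (val u \subset val v).
Proof.
apply/idP/idP => [/iter_findex <-|].
  elim: (findex _ _ _) => //= m IH; apply: subset_trans IH _.
  move: (iter m _ _) => w; rewrite /= /cparent_val.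
  case: (eqVneq (val w) setT) => [->|nw]; first by rewrite subxx.
  by case: (cparentP (valP w) nw); rewrite /cparent_val (negbTE nw) => _ /proper_sub.
have [m] := ubnP #|~: val u|; elim: m u => // m IH u hm uv.
case: (eqVneq u v) => [->|nuv]; first exact: connect0.
have puv : val u \proper val v.
  by rewrite properEneq uv andbT; apply: contra_neq nuv => /val_inj.
have nu : val u != setT.
  by apply: contraTneq puv => ->; rewrite properE subsetT andbF.
have [_ pu min] := cparentP (valP u) nu.
apply: connect_trans (fconnect1 _ _) (IH _ _ _); last exact: min (valP v) puv.
rewrite -ltnS; apply: leq_trans hm; rewrite ltnS; apply: proper_card.
by rewrite properC.
Qed.

Lemma crooted (v : V) : fconnect cparent v croot.
Proof. by rewrite cbelowE subsetT. Qed.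

Lemma cinput v i : v \in T -> i \in v ->
  least_in (fun u => i \in u) = v \/
  exists2 u, [/\ u \in T, u != setT & cparent_val u = v] & i \in u.
Proof.
move=> vT iv; have [lT il min] := cleafP i.
case: (eqVneq (least_in (fun u => i \in u)) v) => [->|nl]; [by left | right].
pose Q u := [&& u \in T, i \in u & u \proper v].
have Ql : Q (least_in (fun u => i \in u)).
  by rewrite /Q lT il properEneq nl min.
case: (arg_maxnP (fun u : {set 'I_n} => #|u|) Ql) => u /and3P[uT iu uv] max.
have nu : u != setT.
  by apply: contraTneq uv => ->; rewrite properE subsetT andbF.
have [pT pu pmin] := cparentP uT nu.
exists u => //; split=> //; apply/eqP; apply: contraT => np.
have := max (cparent_val u); rewrite /Q pT (subsetP (proper_sub pu)) //=.
rewrite properEneq np pmin // => /(_ isT).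
by rewrite leqNgt proper_card.
Qed.

Lemma creduced (v : V) :
  (1 < #|[set u | (u != croot) && (cparent u == v)]|
       + #|[set i | cleaf i == v]|)%N.
Proof.
have inp i : i \in val v -> i \in [set i | cleaf i == v] \/
    exists2 u, u \in [set u | (u != croot) && (cparent u == v)] & i \in val u.
  move=> iv; case: (cinput (valP v) iv) => [e|[u [uT nu pu] iu]].
    by left; rewrite inE -val_eqE /= e.
  right; exists (exist (fun u => u \in T) u uT) => //; rewrite inE -!val_eqE /= nu.
  by rewrite pu eqxx.
have child_proper (u : V) : u \in [set u | (u != croot) && (cparent u == v)] ->
    val u \proper val v.
  rewrite inE -val_eqE /= => /andP[nu /eqP <-].
  by case: (cparentP (valP u) nu).
have /card_gt1P [i [j [iv jv ij]]] := T_gt1 (valP v).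
case: (inp i iv) => [li|[u hu iu]].
  case: (inp j jv) => [lj|[u hu _]].
    apply: leq_trans (leq_addl _ _); apply/card_gt1P; by exists i, j.
  by rewrite -(addn1 1) leq_add //; apply/card_gt0P; [exists u | exists i].
have /properP [_ [l lv lu]] := child_proper u hu.
case: (inp l lv) => [ll|[w hw lw]].
  by rewrite -(addn1 1) leq_add //; apply/card_gt0P; [exists u | exists l].
apply: leq_trans (leq_addr _ _); apply/card_gt1P; exists u, w; split=> //.
by apply: contraNneq lu => ->.
Qed.

Definition rtree_of_clusters : rtree := RTree cparent_root crooted creduced.

Lemma rtree_of_clustersK : clusters rtree_of_clusters = T.
Proof.
have clE (v : vert rtree_of_clusters) : cluster v = val v.
  apply/setP => i; rewrite inE cbelowE /=; have [lT il min] := cleafP i.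
  apply/idP/idP => [/subsetP|iv]; [exact | exact: min (valP v) iv].
apply/setP => A; apply/imsetP/idP => [[v _ ->]|AT].
  by rewrite clE; apply: (valP v).
by exists (exist (fun u => u \in T) A AT); rewrite // clE.
Qed.

End TreeOfClusters.

Lemma ntreeP (T : {set {set 'I_n}}) :
  ntree T <-> exists t : rtree, clusters t = T.
Proof.
split=> [hT|[t <-]]; last exact: clusters_ntree.
by exists (rtree_of_clusters hT); apply: rtree_of_clustersK.
Qed.

End RootedTrees.

Section Cobar.

Variables (k : fieldType) (P : operad k).

(* The extension of P to finite sets is
     P(I) = (\bigoplus_(f : [m] ~ I) P(m))_(S_m).
   LOp f x stands for the class of x in the summand of f, where f is given by
   the tuple of its values, so that the coinvariants identify
   LOp (f \o s) x with LOp f (s x). *)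
Record lop (X : Type) := LOp {
  lop_arity : nat;
  lop_label : lop_arity.-tuple X;
  lop_op : op_sp P lop_arity }.

Lemma comp_arity m n (i : 'I_m) : (m + n).-1.+1 = (m + n)%N.
Proof. by case: m i => [[]|]. Qed.

Lemma comp_label_size X m n (i : 'I_m) (f : m.-tuple X) (g : n.-tuple X) :
  size (take i f ++ g ++ drop i.+1 f) == (m + n).-1.
Proof.
rewrite !size_cat size_takel ?size_drop !size_tuple; last exact: ltnW.
by have := ltn_ord i; lia.
Qed.

(* The composition P(I) x P(J) -> P((I :\ e) U J) along e = f i. *)
Definition lop_comp X (a : lop X) (i : 'I_(lop_arity a)) (b : lop X) : lop X :=
  LOp (Tuple (comp_label_size i (lop_label a) (lop_label b)))
      (op_comp (comp_arity (lop_arity b) i) i (lop_op a) (lop_op b)).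

Variable n : nat.
Local Notation V := {set 'I_n}.
Implicit Types (T : {set V}) (d : V -> lop V) (w : seq V).

(* If d decorates T, then d v represents an element of P(In(v)) for every
   vertex v of T, and d represents the pure tensor of these elements in P(T). *)
Definition decorates T d : Prop :=
  forall v, v \in T -> perm_eq (lop_label (d v)) (enum (inputs T v)).

(* The composition P(T) -> P(T / e) on pure tensors: in the vertex having e
   among its inputs, the operation attached to e is substituted. *)
Definition contract (e : V) d (v : V) : lop V :=
  if [pick i | tnth (lop_label (d v)) i == e] is Some i
  then lop_comp i (d e) else d v.

(* An element of the sum over |T| = j of P(T)^* (x) Det(T) is represented by a
   function c: if w = [:: e_1; ..; e_r] enumerates the edges of T except the
   output, the T-component of c is
     (d |-> c T d w) (x) (e_1 /\ .. /\ e_r).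
   Linear forms on P(T) are multilinear in the decoration of each vertex and
   invariant under the identifications defining P(In(v)); the component does
   not depend on w iff c T d w is alternating in w.  The values of c outside of
   trees T with |T| = j, decorations d of T and enumerations w are irrelevant,
   and equality of cochains ignores them. *)
Definition precochain := {set V} -> (V -> lop V) -> seq V -> k.
Implicit Types c b : precochain.

Definition has_degree j T : bool := ntree T && (#|iedges T| == j).

Definition orders T w : bool := perm_eq w (enum (edges T)).

Record cochain (j : nat) c : Prop := Cochain {
  cochain_local : forall T d d' w,
    has_degree j T -> decorates T d -> orders T w ->
    (forall v, v \in T -> d v = d' v) -> c T d w = c T d' w;
  cochain_linear : forall T d w v m (f : m.-tuple V),
    has_degree j T -> decorates T d -> orders T w ->
    v \in T -> perm_eq f (enum (inputs T v)) ->
    forall (a : k) (x y : op_sp P m),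
    c T [eta d with v |-> LOp f (a *: x + y)] w =
    a * c T [eta d with v |-> LOp f x] w + c T [eta d with v |-> LOp f y] w;
  cochain_equivariant : forall T d w v m (f : m.-tuple V),
    has_degree j T -> decorates T d -> orders T w ->
    v \in T -> perm_eq f (enum (inputs T v)) ->
    forall (s : 'S_m) (x : op_sp P m),
    c T [eta d with v |-> LOp [tuple tnth f (s i) | i < m] x] w =
    c T [eta d with v |-> LOp f (op_act s x)] w;
  cochain_alternating : forall T d w1 e f w2,
    has_degree j T -> decorates T d -> orders T (w1 ++ [:: e, f & w2]) ->
    c T d (w1 ++ [:: f, e & w2]) = - c T d (w1 ++ [:: e, f & w2]) }.

Definition eq_cochain j c b : Prop := forall T d w,
  has_degree j T -> decorates T d -> orders T w -> c T d w = b T d w.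

(* The matrix element from T / e to T is the transpose of contract e tensored
   with the left exterior multiplication by e.  The sign comes from
     e /\ (w_1 /\ .. omitting e .. /\ w_r) = (-1)^(index e w) w_1 /\ .. /\ w_r,
   indices starting at 0. *)
Definition differential c : precochain := fun T d w =>
  \sum_(e in iedges T) (-1) ^+ index e w * c (T :\ e) (contract e d) (rem e w).

Definition zero_cochain : precochain := fun _ _ _ => 0.

(* Exactness at the term |T| = j; the complex starts at j = 0. *)
Definition exact_at (j : nat) : Prop :=
  forall c, cochain j c -> eq_cochain j.+1 (differential c) zero_cochain ->
  match j with
  | 0 => eq_cochain 0 c zero_cochain
  | i.+1 => exists2 b, cochain i b & eq_cochain i.+1 c (differential b)
  end.

End Cobar.

(* The rightmost term of D(P)(n) is the one with |T| = n - 2. *)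
Definition koszul (k : fieldType) (P : operad k) : Prop :=
  forall n j : nat, (1 < n)%N -> (j < n - 2)%N -> exact_at P n j.

Inductive term (k : Type) (X : Type) :=
| Var of X
| Zero
| Add of term k X & term k X
| Scale of k & term k X
| Mul of term k X & term k X.

Arguments Zero {k X}.
Arguments Var {k X} x.

HB.instance Definition _ (k X : Type) := gen_eqMixin (term k X).
HB.instance Definition _ (k X : Type) := gen_choiceMixin (term k X).

Fixpoint tsubst (k X Y : Type) (s : X -> term k Y) (t : term k X) : term k Y :=
  match t with
  | Var x => s x
  | Zero => Zero
  | Add t u => Add (tsubst s t) (tsubst s u)
  | Scale a t => Scale a (tsubst s t)
  | Mul t u => Mul (tsubst s t) (tsubst s u)
  end.

Lemma tsubstA k X Y Z (s : X -> term k Y) (s' : Y -> term k Z) t :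
  tsubst s' (tsubst s t) = tsubst (tsubst s' \o s) t.
Proof. by elim: t => //= [t -> u ->|a t ->|t -> u ->]. Qed.

(* A variety of (nonassociative, nonunital) k-algebras is given by a set of
   identities l = r in variables indexed by nat.  teq is the equational theory
   of these algebras: it is generated by the axioms of k-algebras with a
   bilinear product and by all substitution instances of the identities.  The
   free algebra on X is the quotient of term k X by teq. *)
Inductive teq (k : fieldType) (laws : term k nat -> term k nat -> Prop)
    (X : Type) : term k X -> term k X -> Prop :=
| teq_refl t : teq laws t t
| teq_sym t u : teq laws t u -> teq laws u t
| teq_trans t u v : teq laws t u -> teq laws u v -> teq laws t v
| teq_Add t t' u u' :
    teq laws t t' -> teq laws u u' -> teq laws (Add t u) (Add t' u')
| teq_Scale a t t' : teq laws t t' -> teq laws (Scale a t) (Scale a t')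
| teq_Mul t t' u u' :
    teq laws t t' -> teq laws u u' -> teq laws (Mul t u) (Mul t' u')
| teq_addA t u v : teq laws (Add t (Add u v)) (Add (Add t u) v)
| teq_addC t u : teq laws (Add t u) (Add u t)
| teq_add0 t : teq laws (Add Zero t) t
| teq_addN t : teq laws (Add (Scale (-1) t) t) Zero
| teq_scaleA a b t : teq laws (Scale a (Scale b t)) (Scale (a * b) t)
| teq_scale1 t : teq laws (Scale 1 t) t
| teq_scaleDr a t u :
    teq laws (Scale a (Add t u)) (Add (Scale a t) (Scale a u))
| teq_scaleDl a b t :
    teq laws (Scale (a + b) t) (Add (Scale a t) (Scale b t))
| teq_mulDl t u v : teq laws (Mul (Add t u) v) (Add (Mul t v) (Mul u v))
| teq_mulDr t u v : teq laws (Mul t (Add u v)) (Add (Mul t u) (Mul t v))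
| teq_mulZl a t u : teq laws (Mul (Scale a t) u) (Scale a (Mul t u))
| teq_mulZr a t u : teq laws (Mul t (Scale a u)) (Scale a (Mul t u))
| teq_law l r (s : nat -> term k X) :
    laws l r -> teq laws (tsubst s l) (tsubst s r).

Section FreeAlgebra.

Variables (k : fieldType) (laws : term k nat -> term k nat -> Prop).

Lemma teq_equivP (X : Type) :
  equiv_class_of (fun t u : term k X => `[< teq laws t u >]).
Proof.
split=> [t|t u|u t v]; first exact/asboolP/teq_refl.
  by apply/asboolP/asboolP => /teq_sym.
by move=> /asboolP tu /asboolP uv; apply/asboolP; apply: teq_trans tu uv.
Qed.

Canonical teq_equiv X := EquivRelPack (teq_equivP X).

Definition freealg (X : Type) := {eq_quot (teq_equiv X)}%qT.

HB.instance Definition _ X := EqQuotient.on (freealg X).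
HB.instance Definition _ X := Choice.on (freealg X).

Variable X : Type.
Implicit Types (t u : term k X) (x y z : freealg X).

Definition fpi t : freealg X := \pi_(freealg X)%qT t.
Definition frepr x : term k X := generic_quotient.repr x.

Lemma fpiP t u : fpi t = fpi u <-> teq laws t u.
Proof.
split=> [/eqmodP /= /asboolP //|tu].
by apply/eqmodP; apply/asboolP.
Qed.

Lemma freprK x : fpi (frepr x) = x.
Proof. exact: reprK. Qed.

Lemma frepr_pi t : teq laws (frepr (fpi t)) t.
Proof. by apply/fpiP; rewrite freprK. Qed.

Lemma free_ind (Q : freealg X -> Prop) : (forall t, Q (fpi t)) -> forall x, Q x.
Proof. by move=> h x; rewrite -(freprK x). Qed.

Definition fvar (a : X) : freealg X := fpi (Var a).
Definition fzero : freealg X := fpi Zero.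
Definition fadd x y := fpi (Add (frepr x) (frepr y)).
Definition fscale a x := fpi (Scale a (frepr x)).
Definition fopp x := fscale (-1) x.
Definition fmul x y := fpi (Mul (frepr x) (frepr y)).

Lemma fpi_add t u : fpi (Add t u) = fadd (fpi t) (fpi u).
Proof. by apply/fpiP; apply: teq_Add; apply: teq_sym; apply: frepr_pi. Qed.
Lemma fpi_scale a t : fpi (Scale a t) = fscale a (fpi t).
Proof. by apply/fpiP; apply: teq_Scale; apply: teq_sym; apply: frepr_pi. Qed.
Lemma fpi_mul t u : fpi (Mul t u) = fmul (fpi t) (fpi u).
Proof. by apply/fpiP; apply: teq_Mul; apply: teq_sym; apply: frepr_pi. Qed.

Lemma faddA : associative fadd.
Proof.
elim/free_ind=> t; elim/free_ind=> u; elim/free_ind=> v.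
by rewrite -!fpi_add; apply/fpiP; apply: teq_addA.
Qed.
Lemma faddC : commutative fadd.
Proof.
elim/free_ind=> t; elim/free_ind=> u.
by rewrite -!fpi_add; apply/fpiP; apply: teq_addC.
Qed.
Lemma fadd0 : left_id fzero fadd.
Proof. by elim/free_ind=> t; rewrite -fpi_add; apply/fpiP/teq_add0. Qed.
Lemma faddN : left_inverse fzero fopp fadd.
Proof.
by elim/free_ind=> t; rewrite /fopp -fpi_scale -fpi_add; apply/fpiP/teq_addN.
Qed.

HB.instance Definition _ :=
  GRing.isZmodule.Build (freealg X) faddA faddC fadd0 faddN.

Lemma fscaleA a b x : fscale a (fscale b x) = fscale (a * b) x.
Proof.
by elim/free_ind: x => t; rewrite -!fpi_scale; apply/fpiP/teq_scaleA.
Qed.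
Lemma fscale1 : left_id 1 fscale.
Proof. by elim/free_ind=> t; rewrite -fpi_scale; apply/fpiP/teq_scale1. Qed.
Lemma fscaleDr : right_distributive fscale +%R.
Proof.
move=> a; elim/free_ind=> t; elim/free_ind=> u; rewrite -[_ + _]fpi_add.
by rewrite -!fpi_scale -[RHS]fpi_add; apply/fpiP/teq_scaleDr.
Qed.
Lemma fscaleDl x : {morph fscale^~ x : a b / a + b}.
Proof.
move=> a b; elim/free_ind: x => t.
by rewrite -!fpi_scale -[RHS]fpi_add; apply/fpiP/teq_scaleDl.
Qed.

HB.instance Definition _ := GRing.Zmodule_isLmodule.Build k (freealg X)
  fscaleA fscale1 fscaleDr fscaleDl.

Lemma fpi0 : fpi Zero = 0. Proof. by []. Qed.
Lemma fpiD t u : fpi (Add t u) = fpi t + fpi u. Proof. exact: fpi_add. Qed.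
Lemma fpiZ a t : fpi (Scale a t) = a *: fpi t. Proof. exact: fpi_scale. Qed.

Lemma fmulDl x y z : fmul (x + y) z = fmul x z + fmul y z.
Proof.
elim/free_ind: x => t; elim/free_ind: y => u; elim/free_ind: z => v.
by rewrite -fpiD -!fpi_mul -fpiD; apply/fpiP/teq_mulDl.
Qed.
Lemma fmulDr x y z : fmul x (y + z) = fmul x y + fmul x z.
Proof.
elim/free_ind: x => t; elim/free_ind: y => u; elim/free_ind: z => v.
by rewrite -fpiD -!fpi_mul -fpiD; apply/fpiP/teq_mulDr.
Qed.
Lemma fmulZl a x y : fmul (a *: x) y = a *: fmul x y.
Proof.
elim/free_ind: x => t; elim/free_ind: y => u.
by rewrite -fpiZ -!fpi_mul -fpiZ; apply/fpiP/teq_mulZl.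
Qed.
Lemma fmulZr a x y : fmul x (a *: y) = a *: fmul x y.
Proof.
elim/free_ind: x => t; elim/free_ind: y => u.
by rewrite -fpiZ -!fpi_mul -fpiZ; apply/fpiP/teq_mulZr.
Qed.

End FreeAlgebra.

Arguments fvar {k laws X} a.
Arguments fpi {k laws X} t.

Section Substitution.

Variables (k : fieldType) (laws : term k nat -> term k nat -> Prop).
Local Notation freealg := (freealg laws).
Local Notation fpi := (@fpi k laws _).

Lemma teq_substl X Y (s : X -> term k Y) t u :
  teq laws t u -> teq laws (tsubst s t) (tsubst s u).
Proof.
elim=> {t u} //=; try by [constructor|move=> *; constructor].
- by move=> t u v _ h1 _ h2; apply: teq_trans h1 h2.
- move=> l r s' lr; rewrite !tsubstA; exact: teq_law.
Qed.

Lemma teq_substr X Y (s s' : X -> term k Y) t :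
  (forall a, teq laws (s a) (s' a)) -> teq laws (tsubst s t) (tsubst s' t).
Proof.
by move=> h; elim: t => //= *; [exact: teq_refl | exact: teq_Add
  | exact: teq_Scale | exact: teq_Mul].
Qed.

Definition fsubst X Y (s : X -> freealg Y) (x : freealg X) : freealg Y :=
  fpi (tsubst (fun a => frepr (s a)) (frepr x)).

Lemma fsubst_pi X Y (s : X -> freealg Y) t :
  fsubst s (fpi t) = fpi (tsubst (fun a => frepr (s a)) t).
Proof. by apply/fpiP; apply: teq_substl; apply: frepr_pi. Qed.

Lemma eq_fsubst X Y (s s' : X -> freealg Y) : s =1 s' -> fsubst s =1 fsubst s'.
Proof.
by move=> h x; apply/fpiP/teq_substr => a; rewrite h; apply: teq_refl.
Qed.

Lemma fsubst_var X Y (s : X -> freealg Y) a : fsubst s (fvar a) = s a.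
Proof. by rewrite fsubst_pi /= freprK. Qed.

Lemma fsubst0 X Y (s : X -> freealg Y) : fsubst s 0 = 0.
Proof. by rewrite -fpi0 fsubst_pi. Qed.

Lemma fsubstD X Y (s : X -> freealg Y) x y :
  fsubst s (x + y) = fsubst s x + fsubst s y.
Proof.
elim/free_ind: x => t; elim/free_ind: y => u.
by rewrite -fpiD !fsubst_pi /= fpiD.
Qed.

Lemma fsubstZ X Y (s : X -> freealg Y) a x : fsubst s (a *: x) = a *: fsubst s x.
Proof. by elim/free_ind: x => t; rewrite -fpiZ !fsubst_pi /= fpiZ. Qed.

Lemma fsubstM X Y (s : X -> freealg Y) x y :
  fsubst s (fmul x y) = fmul (fsubst s x) (fsubst s y).
Proof.
elim/free_ind: x => t; elim/free_ind: y => u.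
by rewrite -fpi_mul !fsubst_pi /= fpi_mul.
Qed.

Lemma free_gen_ind X (Q : freealg X -> Prop) :
    (forall a, Q (fvar a)) -> Q 0 -> (forall x y, Q x -> Q y -> Q (x + y)) ->
    (forall a x, Q x -> Q (a *: x)) ->
    (forall x y, Q x -> Q y -> Q (fmul x y)) -> forall x, Q x.
Proof.
move=> hv h0 hD hZ hM; elim/free_ind; elim=> [a||t ht u hu|a t ht|t ht u hu].
- exact: hv.
- exact: h0.
- by rewrite fpiD; apply: hD.
- by rewrite fpiZ; apply: hZ.
- by rewrite fpi_mul; apply: hM.
Qed.

Lemma fsubstA X Y Z (s : X -> freealg Y) (s' : Y -> freealg Z) x :
  fsubst s' (fsubst s x) = fsubst (fun a => fsubst s' (s a)) x.
Proof.
elim/free_gen_ind: x => [a||x y hx hy|a x hx|x y hx hy].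
- by rewrite !fsubst_var.
- by rewrite !fsubst0.
- by rewrite !fsubstD hx hy.
- by rewrite !fsubstZ hx.
- by rewrite !fsubstM hx hy.
Qed.

Lemma fsubst_id X (x : freealg X) : fsubst fvar x = x.
Proof.
elim/free_gen_ind: x => [a||x y hx hy|a x hx|x y hx hy].
- by rewrite !fsubst_var.
- by rewrite !fsubst0.
- by rewrite !fsubstD hx hy.
- by rewrite !fsubstZ hx.
- by rewrite !fsubstM hx hy.
Qed.

End Substitution.

Inductive magma (X : Type) := Gen of X | Prod of magma X & magma X.

Fixpoint leaves X (a : magma X) : seq X :=
  if a is Prod b c then leaves b ++ leaves c else
  if a is Gen x then [:: x] else [::].

Fixpoint mbind X Y (s : X -> magma Y) (a : magma X) : magma Y :=
  match a with Gen x => s x | Prod b c => Prod (mbind s b) (mbind s c) end.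

Definition multilinear n (a : magma 'I_n) : Prop :=
  forall i : 'I_n, count_mem i (leaves a) = 1%N.

Section MultilinearPart.

Variables (k : fieldType) (laws : term k nat -> term k nat -> Prop).
Local Notation freealg := (freealg laws).

Fixpoint monomial X (a : magma X) : freealg X :=
  match a with
  | Gen x => fvar x
  | Prod b c => fmul (monomial b) (monomial c)
  end.

(* The subspace of the free algebra on x_0, .., x_(n-1) spanned by the monomials
   containing each variable exactly once; its type is mlpart n. *)
Inductive mlspan n : freealg 'I_n -> Prop :=
| mlspan_monomial a : multilinear a -> mlspan (monomial a)
| mlspan0 : mlspan 0
| mlspanD x y : mlspan x -> mlspan y -> mlspan (x + y)
| mlspanZ (a : k) x : mlspan x -> mlspan (a *: x).

Definition ml n : {pred freealg 'I_n} := [pred x | `[< mlspan x >]].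
Arguments ml : clear implicits.

Lemma mlP n (x : freealg 'I_n) : reflect (mlspan x) (x \in ml n).
Proof. exact: asboolP. Qed.

Lemma ml_submod n : submod_closed (ml n).
Proof.
split=> [|a x y /mlP hx /mlP hy]; apply/mlP; first exact: mlspan0.
by apply: mlspanD => //; apply: mlspanZ.
Qed.

HB.instance Definition _ n :=
  GRing.isSubmodClosed.Build k (freealg 'I_n) (ml n) (ml_submod n).

Record mlpart n := MlPart { ml_val : freealg 'I_n; ml_valP : ml_val \in ml n }.

HB.instance Definition _ n := [isSub for @ml_val n].
HB.instance Definition _ n := [Choice of mlpart n by <:].
HB.instance Definition _ n := [SubChoice_isSubLmodule of mlpart n by <:].

End MultilinearPart.
Arguments ml {k} laws n.

Section Variety.

Variables (k : fieldType) (laws : term k nat -> term k nat -> Prop).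
Local Notation freealg := (freealg laws).
Local Notation mlpart := (mlpart laws).

(* The variable x_v, or 0 if v is out of range, which does not happen below. *)
Definition xvar p (v : nat) : freealg 'I_p := oapp fvar 0 (insub v).

Lemma xvarE p v (h : (v < p)%N) : xvar p v = fvar (Ordinal h).
Proof. by rewrite /xvar insubT. Qed.

Lemma xvar_ord p (v : 'I_p) : xvar p v = fvar v.
Proof. by rewrite /xvar valK. Qed.

Lemma fsubst_xvar p Y (s : 'I_p -> freealg Y) v (h : (v < p)%N) :
  fsubst s (xvar p v) = s (Ordinal h).
Proof. by rewrite xvarE fsubst_var. Qed.

(* The substitution computing p o_i y, see ins_var. *)
Definition slot m n p (i : 'I_m) (y : freealg 'I_n) (a : 'I_m) : freealg 'I_p :=
  if a == i then fsubst (fun b : 'I_n => xvar p (i + b)) y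
  else xvar p (ins_var n i a).

Lemma slot_eq m n p (i a : 'I_m) (y : freealg 'I_n) : a == i ->
  slot p i y a = fsubst (fun b : 'I_n => xvar p (i + b)) y.
Proof. by rewrite /slot => ->. Qed.

Lemma slot_neq m n p (i a : 'I_m) (y : freealg 'I_n) : a != i ->
  slot p i y a = xvar p (ins_var n i a).
Proof. by rewrite /slot => /negbTE ->. Qed.

Lemma fsubst_slot_eq0 X Y (s s' : X -> freealg Y) (a : magma X) (i : X) :
  (forall j, j <> i -> s j = s' j) -> ~ List.In i (leaves a) ->
  fsubst s (monomial laws a) = fsubst s' (monomial laws a).
Proof.
move=> ss; elim: a => [x|b hb c hc] /=.
  by move=> xi; rewrite !fsubst_var; apply: ss => e; apply: xi; left.
move=> h; rewrite !fsubstM hb ?hc // => hi; apply: h; apply/List.in_or_app.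
  by right.
by left.
Qed.

Lemma In_mem (T : eqType) (x : T) s : List.In x s <-> x \in s.
Proof.
elim: s => //= y s IH; rewrite inE; split.
  by case=> [->|/IH ->]; rewrite ?eqxx ?orbT.
by case/orP => [/eqP ->|/IH]; [left|right].
Qed.

Lemma fsubst_slot_linear (X : eqType) Y (s s' s'' : X -> freealg Y) (c : k)
    (a : magma X) (i : X) :
  (forall j, j <> i -> s j = s' j) -> (forall j, j <> i -> s j = s'' j) ->
  s i = c *: s' i + s'' i -> count_mem i (leaves a) = 1%N ->
  fsubst s (monomial laws a)
    = c *: fsubst s' (monomial laws a) + fsubst s'' (monomial laws a).
Proof.
move=> e' e'' ei; elim: a => [x|b hb d hd] /=.
  by rewrite addn0; case: eqP => // -> _; rewrite !fsubst_var.
rewrite count_cat !fsubstM.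
case eb: (count_mem i (leaves b)) => [|[|?]] //; rewrite ?add0n.
- move=> ed; rewrite hd // fmulDr fmulZr.
  have nb : ~ List.In i (leaves b).
    by move=> /In_mem; rewrite -has_pred1 has_count eb.
  by rewrite (fsubst_slot_eq0 e' nb) -(fsubst_slot_eq0 e'' nb)
    (fsubst_slot_eq0 e' nb).
- rewrite add1n => -[ed]; rewrite hb // fmulDl fmulZl.
  have nd : ~ List.In i (leaves d).
    by move=> /In_mem; rewrite -has_pred1 has_count ed.
  by rewrite (fsubst_slot_eq0 e' nd) -(fsubst_slot_eq0 e'' nd)
    (fsubst_slot_eq0 e' nd).
Qed.

Lemma mlspan_linear n (W : lmodType k) (f g : freealg 'I_n -> W) :
  linear f -> linear g ->
  (forall a, multilinear a -> f (monomial laws a) = g (monomial laws a)) ->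
  forall x, mlspan x -> f x = g x.
Proof.
move=> lf lg fg x.
have f0 : f 0 = 0.
  by have := lf (-1) 0 0; rewrite scaler0 addr0 scaleN1r addNr.
have g0 : g 0 = 0.
  by have := lg (-1) 0 0; rewrite scaler0 addr0 scaleN1r addNr.
elim=> [a /fg //||y z _ hy _ hz|a y _ hy]; first by rewrite f0 g0.
- by have := lf 1 y z; have := lg 1 y z; rewrite !scale1r hy hz => -> ->.
- by have := lf a y 0; have := lg a y 0; rewrite !addr0 f0 g0 !addr0 hy
    => -> ->.
Qed.

Lemma fsubst_linear X Y (s : X -> freealg Y) : linear (fsubst s).
Proof. by move=> a x y; rewrite fsubstD fsubstZ. Qed.

Lemma slot_linear m n p (i : 'I_m) (x : freealg 'I_m) c (y z : freealg 'I_n) :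
  mlspan x -> fsubst (slot p i (c *: y + z)) x =
    c *: fsubst (slot p i y) x + fsubst (slot p i z) x.
Proof.
move: x; apply: mlspan_linear; first exact: fsubst_linear.
  move=> d x x'; rewrite !fsubstD !fsubstZ !scalerDr !scalerA addrACA.
  by rewrite mulrC.
move=> a /(_ i) ha; apply: fsubst_slot_linear ha.
- by move=> j /eqP /negbTE; rewrite /slot => ->.
- by move=> j /eqP /negbTE; rewrite /slot => ->.
- by rewrite /slot eqxx fsubstD fsubstZ.
Qed.

Lemma leaves_mbind X (Y : eqType) (s : X -> magma Y) a c :
  count_mem c (leaves (mbind s a)) =
  (\sum_(x <- leaves a) count_mem c (leaves (s x)))%N.
Proof.
elim: a => [x|b hb d hd] /=; first by rewrite big_seq1.
by rewrite count_cat hb hd big_cat.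
Qed.

Lemma fsubst_mbind X Y (s : X -> freealg Y) (s' : X -> magma Y) a :
  (forall x, s x = monomial laws (s' x)) ->
  fsubst s (monomial laws a) = monomial laws (mbind s' a).
Proof.
move=> h; elim: a => [x|b hb d hd] /=; first by rewrite fsubst_var.
by rewrite fsubstM hb hd.
Qed.

Lemma multilinear_sum n (a : magma 'I_n) (f : 'I_n -> nat) :
  multilinear a -> (\sum_(x <- leaves a) f x = \sum_(x < n) f x)%N.
Proof.
move=> ha; rewrite -big_enum; apply: perm_big; apply/allP => x _ /=.
by rewrite ha count_uniq_mem ?enum_uniq // mem_enum.
Qed.

Lemma multilinear_gt0 n (a : magma 'I_n) : (0 < n)%N.
Proof.
suff [x _] : exists x : 'I_n, x \in leaves a.
  by case: n a x => [|//] _ [].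
elim: a => [x|b [x hx] c _]; exists x; first by rewrite inE.
by rewrite mem_cat hx.
Qed.

Lemma multilinear_act n (s : 'S_n) (a : magma 'I_n) :
  multilinear a -> multilinear (mbind (fun x => Gen (s x)) a).
Proof.
move=> ha c; rewrite leaves_mbind multilinear_sum //=.
rewrite (bigD1 (s^-1 c)%g) //= permKV eqxx big1 // => x xc.
by case: eqP => // e; rewrite -e permK eqxx in xc.
Qed.

Lemma act_subproof n (s : 'S_n) (x : mlpart n) :
  fsubst (fun a => fvar (s a)) (val x) \in ml laws n.
Proof.
apply/mlP; have /mlP := valP x; elim=> [a ha||y z _ hy _ hz|a y _ hy].
- rewrite (@fsubst_mbind _ _ _ (fun x => Gen (s x))) //.
  by apply/mlspan_monomial/multilinear_act.
- by rewrite fsubst0; apply: mlspan0.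
- by rewrite fsubstD; apply: mlspanD.
- by rewrite fsubstZ; apply: mlspanZ.
Qed.

Definition mslot m n p (c0 : 'I_p) (i : 'I_m) (b : magma 'I_n) (a : 'I_m) :=
  if a == i then mbind (fun c : 'I_n => Gen (insubd c0 (i + c)%N)) b
  else Gen (insubd c0 (ins_var n i a)).

Lemma xvar_insubd p (c0 : 'I_p) v : (v < p)%N -> xvar p v = fvar (insubd c0 v).
Proof. by move=> h; rewrite xvarE; congr fvar; apply: val_inj; rewrite val_insubd h. Qed.

Lemma ins_var_lt m n p (i a : 'I_m) : p.+1 = (m + n)%N -> a != i ->
  (ins_var n i a < p)%N.
Proof.
move=> h; rewrite -val_eqE /= /ins_var => ai.
by have := ltn_ord a; have := ltn_ord i; case: (ltnP a i); lia.
Qed.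

Lemma slot_mslot m n p (c0 : 'I_p) (h : p.+1 = (m + n)%N) (i : 'I_m)
  (b : magma 'I_n) a :
  slot p i (monomial laws b) a = monomial laws (mslot c0 i b a).
Proof.
rewrite /slot /mslot; case: ifPn => ai; last first.
  by rewrite (xvar_insubd c0) // ins_var_lt.
apply: fsubst_mbind => c; apply: xvar_insubd.
by have := ltn_ord c; have := ltn_ord i; lia.
Qed.

Lemma multilinear_slot m n p (c0 : 'I_p) (h : p.+1 = (m + n)%N) (i : 'I_m)
  (a : magma 'I_m) (b : magma 'I_n) :
  multilinear a -> multilinear b -> multilinear (mbind (mslot c0 i b) a).
Proof.
move=> ha hb c; rewrite leaves_mbind multilinear_sum //.
have hi := ltn_ord i; have hc := ltn_ord c.
have ci : count_mem c (leaves (mslot c0 i b i)) = ((i <= c) && (c < i + n))%N.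
  rewrite /mslot eqxx leaves_mbind multilinear_sum //=.
  case: (boolP (_ && _)) => [/andP[ic cin]|nic].
    have hd : (c - i < n)%N by lia.
    rewrite (bigD1 (Ordinal hd)) //= big1 => [|x xd].
      rewrite -val_eqE val_insubd /= subnKC // hc eqxx //.
    apply/eqP; rewrite addn0 eqb0 -val_eqE val_insubd /=.
    move: xd; rewrite -val_eqE /= => xd; have := ltn_ord x.
    case: ifP; lia.
  rewrite big1 // => x _; apply/eqP; rewrite addn0 eqb0 -val_eqE val_insubd /=.
  have := ltn_ord x; case: ifP; lia.
have cj j : j != i ->
    count_mem c (leaves (mslot c0 i b j)) = (ins_var n i j == c).
  move=> ji; rewrite /mslot (negbTE ji) /= addn0 -val_eqE val_insubd.
  by rewrite ins_var_lt.
case: (boolP ((i <= c) && (c < i + n))%N) => [hic|nic].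
  rewrite (bigD1 i) //= ci hic big1 // => j ji; rewrite cj //.
  apply/eqP; rewrite eqb0 /ins_var; have := ltn_ord j.
  by move: ji; rewrite -val_eqE /= => ji; case: (ltnP j i); lia.
rewrite (bigD1 i) //= ci (negbTE nic) add0n.
have hd : ((if c < i then c : nat else (c - n).+1) < m)%N.
  by case: (ltnP c i) => ?; lia.
have di : Ordinal hd != i by rewrite -val_eqE /=; case: (ltnP c i) => ?; lia.
rewrite (bigD1 (Ordinal hd)) //= cj // big1 => [|j /andP[ji jd]].
  rewrite addn0 /ins_var /=; apply/eqP; rewrite eqb1.
  case: (ltnP c i) => ci'; first by rewrite ci' eqxx.
  by case: ltnP => ?; lia.
rewrite cj //; apply/eqP; rewrite eqb0 /ins_var.
move: ji jd; rewrite -!val_eqE /= => ji; have := ltn_ord j.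
by case: (ltnP c i) => ?; case: (ltnP j i); lia.
Qed.

Lemma comp_subproof m n p (h : p.+1 = (m + n)%N) (i : 'I_m)
    (x : mlpart m) (y : mlpart n) :
  fsubst (slot p i (val y)) (val x) \in ml laws p.
Proof.
apply/mlP; have /mlP hx := valP x; have /mlP hy := valP y.
elim: hy => [b hb||y1 y2 _ h1 _ h2|c y1 _ h1].
- elim: hx => [a ha||x1 x2 _ h1 _ h2|c x1 _ h1].
  + have p0 : (0 < p)%N.
      by have := multilinear_gt0 a; have := multilinear_gt0 b; lia.
    rewrite (fsubst_mbind _ (slot_mslot (Ordinal p0) h i b)).
    exact/mlspan_monomial/multilinear_slot.
  + by rewrite fsubst0; apply: mlspan0.
  + by rewrite fsubstD; apply: mlspanD.
  + by rewrite fsubstZ; apply: mlspanZ.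
- have := @slot_linear m n p i (val x) (-1) 0 0 hx.
  by rewrite scaler0 addr0 scaleN1r addNr => ->; apply: mlspan0.
- have := @slot_linear m n p i (val x) 1 y1 y2 hx.
  by rewrite !scale1r => ->; apply: mlspanD.
- have := @slot_linear m n p i (val x) c y1 0 hx.
  have := @slot_linear m n p i (val x) (-1) 0 0 hx.
  rewrite scaler0 addr0 scaleN1r addNr => ->; rewrite !addr0 => ->.
  exact: mlspanZ.
Qed.

Lemma one_subproof : fvar (ord0 : 'I_1) \in ml laws 1.
Proof.
apply/mlP/(@mlspan_monomial _ _ _ (Gen ord0)) => i.
by rewrite /= (ord1 i) eqxx.
Qed.

Definition var_act n (s : 'S_n) (x : mlpart n) : mlpart n :=
  MlPart (act_subproof s x).

Definition var_comp m n p (h : p.+1 = (m + n)%N) (i : 'I_m)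
  (x : mlpart m) (y : mlpart n) : mlpart p := MlPart (comp_subproof h i x y).

Definition var_one : mlpart 1 := MlPart one_subproof.

Lemma var_act_linear n (s : 'S_n) : linear (var_act s).
Proof. by move=> a x y; apply: val_inj; rewrite /= fsubstD fsubstZ. Qed.

Lemma var_act1 n (x : mlpart n) : var_act 1%g x = x.
Proof.
apply: val_inj; rewrite /= -[RHS]fsubst_id.
by apply: eq_fsubst => a; rewrite perm1.
Qed.

Lemma var_actM n (s t : 'S_n) (x : mlpart n) :
  var_act (s * t)%g x = var_act t (var_act s x).
Proof.
apply: val_inj; rewrite /= fsubstA.
by apply: eq_fsubst => a; rewrite fsubst_var permM.
Qed.

Lemma var_comp_linearl m n p (h : p.+1 = (m + n)%N) i (y : mlpart n) :
  linear (fun x => var_comp h i x y).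
Proof. by move=> a x x'; apply: val_inj; rewrite /= fsubstD fsubstZ. Qed.

Lemma var_comp_linearr m n p (h : p.+1 = (m + n)%N) i (x : mlpart m) :
  linear (var_comp h i x).
Proof.
move=> a y y'; apply: val_inj => /=; apply: slot_linear.
exact/mlP/valP.
Qed.

Lemma var_comp_act m n p (h : p.+1 = (m + n)%N) (i : 'I_m)
      (s : 'S_m) (t : 'S_n) (r : 'S_p) (x : mlpart m) (y : mlpart n) :
    (forall (a : 'I_m) (c : 'I_p), a != i -> c = ins_var n i a :> nat ->
       r c = ins_var n (s i) (s a) :> nat) ->
    (forall (b : 'I_n) (c : 'I_p), c = (i + b)%N :> nat ->
       r c = (s i + t b)%N :> nat) ->
    var_comp h (s i) (var_act s x) (var_act t y) = var_act r (var_comp h i x y).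
Proof.
move=> ha hb; apply: val_inj; rewrite /= !fsubstA; apply: eq_fsubst => a.
rewrite fsubst_var /slot (inj_eq perm_inj); case: ifPn => ai.
  rewrite !fsubstA; apply: eq_fsubst => b; rewrite fsubst_var.
  have hib : (i + b < p)%N by have := ltn_ord i; have := ltn_ord b; lia.
  by rewrite fsubst_xvar -xvar_ord (hb b).
by rewrite (fsubst_xvar _ (ins_var_lt h ai)) -xvar_ord (ha a).
Qed.

Lemma var_one_comp n (h : n.+1 = (1 + n)%N) (x : mlpart n) :
  var_comp h ord0 var_one x = x.
Proof.
apply: val_inj; rewrite /= fsubst_var /slot eqxx -[RHS]fsubst_id.
by apply: eq_fsubst => a; rewrite add0n xvar_ord.
Qed.

Lemma var_comp_one n (h : n.+1 = (n + 1)%N) i (x : mlpart n) :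
  var_comp h i x var_one = x.
Proof.
apply: val_inj; rewrite /= -[RHS]fsubst_id; apply: eq_fsubst => a.
rewrite /slot; case: eqP => [->|_]; first by rewrite fsubst_var addn0 xvar_ord.
by rewrite /ins_var addn1 /= if_same xvar_ord.
Qed.

Lemma var_comp_seq l m n u v p (hu : u.+1 = (m + n)%N)
      (hv : v.+1 = (l + m)%N) (hp : p.+1 = (l + u)%N) (hp' : p.+1 = (v + n)%N)
      (i : 'I_l) (j : 'I_m) (ij : 'I_v)
      (x : mlpart l) (y : mlpart m) (z : mlpart n) : ij = (i + j)%N :> nat ->
    var_comp hp i x (var_comp hu j y z) = var_comp hp' ij (var_comp hv i x y) z.
Proof.
move=> eij; apply: val_inj; rewrite /= fsubstA; apply: eq_fsubst => a.
have hi := ltn_ord i; have hj := ltn_ord j.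
case: (boolP (a == i)) => ai.
  rewrite !(slot_eq _ _ ai) !fsubstA; apply: eq_fsubst => b.
  have hb := ltn_ord b; have hib : (i + b < v)%N by lia.
  rewrite fsubst_xvar; case: (boolP (b == j)) => bj.
    rewrite (slot_eq _ _ bj) slot_eq; last first.
      by rewrite -val_eqE /= eij (eqP bj).
    rewrite fsubstA; apply: eq_fsubst => c; have hc := ltn_ord c.
    have hjc : (j + c < u)%N by lia.
    by rewrite fsubst_xvar /= eij addnA.
  rewrite (slot_neq _ _ bj) slot_neq; last first.
    by rewrite -val_eqE /= eij eqn_add2l val_eqE.
  rewrite (fsubst_xvar _ (ins_var_lt hu bj)) /=; congr (xvar p _).
  have bj' : (b != j :> nat) by rewrite val_eqE.
  by rewrite /ins_var eij ltn_add2l; case: (ltnP b j) => //; lia.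
rewrite !(slot_neq _ _ ai) (fsubst_xvar _ (ins_var_lt hv ai)).
have ai' : (a != i :> nat) by rewrite val_eqE.
rewrite slot_neq /=; last first.
  by rewrite -val_eqE /= eij /ins_var; case: (ltnP a i); lia.
congr (xvar p _); rewrite /= eij /ins_var; case: (ltnP a i) => ?.
  by rewrite ifT //; lia.
by rewrite ifF; lia.
Qed.

Lemma var_comp_par l m n u v p (hu : u.+1 = (l + m)%N)
      (hv : v.+1 = (l + n)%N) (hp : p.+1 = (u + n)%N) (hp' : p.+1 = (v + m)%N)
      (i j : 'I_l) (i' : 'I_v) (j' : 'I_u)
      (x : mlpart l) (y : mlpart m) (z : mlpart n) : (i < j)%N ->
      i' = i :> nat -> j'.+1 = (j + m)%N ->
    var_comp hp j' (var_comp hu i x y) z = var_comp hp' i' (var_comp hv j x z) y.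
Proof.
move=> lij ei ej; apply: val_inj; rewrite /= !fsubstA; apply: eq_fsubst => a.
have hi := ltn_ord i; have hj := ltn_ord j; have ha := ltn_ord a.
have ij : i != j by rewrite -val_eqE /=; lia.
case: (eqVneq a i) => [->|ai].
  rewrite (slot_eq _ _ (eqxx i)) (slot_neq _ _ ij).
  rewrite (fsubst_xvar _ (ins_var_lt hv ij)) slot_eq; last first.
    by rewrite -val_eqE /= ei /ins_var lij.
  rewrite fsubstA; apply: eq_fsubst => b; have hb := ltn_ord b.
  have hib : (i + b < u)%N by lia.
  rewrite fsubst_xvar slot_neq; last by rewrite -val_eqE /=; lia.
  by congr (xvar p _); rewrite /ins_var /= ei ifT //; lia.
rewrite (slot_neq _ _ ai) (fsubst_xvar _ (ins_var_lt hu ai)).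
have ai' : (a != i :> nat) by rewrite val_eqE.
case: (boolP (a == j)) => [ej'|aj].
  have ajv : (a = j :> nat) by rewrite (eqP ej').
  rewrite (slot_eq _ _ ej') slot_eq; last first.
    by rewrite -val_eqE /= /ins_var; case: (ltnP a i); lia.
  rewrite fsubstA; apply: eq_fsubst => c; have hc := ltn_ord c.
  have hjc : (j + c < v)%N by lia.
  rewrite fsubst_xvar slot_neq; last by rewrite -val_eqE /=; lia.
  by congr (xvar p _); rewrite /ins_var /= ei ifF; lia.
have aj' : (a != j :> nat) by rewrite val_eqE.
rewrite (slot_neq _ _ aj) (fsubst_xvar _ (ins_var_lt hv aj)) !slot_neq.
- congr (xvar p _); rewrite /ins_var /= ei.
  case: (ltnP a i) => hai; case: (ltnP a j) => haj; rewrite ?hai.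
  + by rewrite ifT //; lia.
  + lia.
  + by rewrite ifT ?ifF //; lia.
  + by rewrite ifF ?ifF //; lia.
- by rewrite -val_eqE /= /ins_var; case: (ltnP a j); lia.
- by rewrite -val_eqE /= /ins_var; case: (ltnP a i); lia.
Qed.

Fixpoint linpart X (e : X -> k) (t : term k X) : k :=
  match t with
  | Var x => e x
  | Zero => 0
  | Add t u => linpart e t + linpart e u
  | Scale a t => a * linpart e t
  | Mul _ _ => 0
  end.

(* No identity has a nonzero linear part; this ensures P(1) = k. *)
Hypothesis laws_linpart :
  forall l r (e : nat -> k), laws l r -> linpart e l = linpart e r.

Lemma linpart_subst X Y (s : X -> term k Y) e t :
  linpart e (tsubst s t) = linpart (fun a => linpart e (s a)) t.
Proof. by elim: t => //= [t -> u ->|a t ->]. Qed.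

Lemma teq_linpart X (e : X -> k) t u :
  teq laws t u -> linpart e t = linpart e u.
Proof.
elim=> {t u} //=.
- by move=> t u v _ -> _ ->.
- by move=> t t' u u' _ -> _ ->.
- by move=> a t t' _ ->.
- by move=> *; rewrite addrA.
- by move=> *; rewrite addrC.
- by move=> *; rewrite add0r.
- by move=> *; rewrite mulN1r addNr.
- by move=> *; rewrite mulrA.
- by move=> *; rewrite mul1r.
- by move=> *; rewrite mulrDr.
- by move=> *; rewrite mulrDl.
- by move=> *; rewrite addr0.
- by move=> *; rewrite addr0.
- by move=> *; rewrite mulr0.
- by move=> *; rewrite mulr0.
- by move=> l r s /laws_linpart h; rewrite !linpart_subst.
Qed.

Lemma var_unit (x : mlpart 1) : exists! a : k, x = a *: var_one.
Proof.
have [a ha] : exists a, x = a *: var_one.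
  have /mlP hx := valP x.
  suff [a ha] : exists a, val x = a *: fvar ord0.
    by exists a; apply: val_inj.
  elim: hx => [a ha||y z _ [b ->] _ [c ->]|a y _ [b ->]].
  - exists 1; rewrite scale1r; move: (ha ord0); case: a {ha} => [i|b c] /=.
      by rewrite (ord1 i).
    rewrite count_cat; have gt0 (d : magma 'I_1) :
        (0 < count_mem ord0 (leaves d))%N.
      by elim: d => [i|d hd d' _] /=; rewrite ?(ord1 i) // count_cat addn_gt0 hd.
    by move: (gt0 b) (gt0 c); do 2!case: (count_mem _ _) => // ?; rewrite addnS.
  - by exists 0; rewrite scale0r.
  - by exists (b + c); rewrite scalerDl.
  - by exists (a * b); rewrite scalerA.
exists a; split=> // b; rewrite ha => /(congr1 val) /=.
rewrite -!fpiZ => /fpiP /(teq_linpart (fun=> 1)) /=.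
by rewrite !mulr1.
Qed.

Definition variety_operad : operad k :=
  Operad var_act_linear var_act1 var_actM var_comp_linearl var_comp_linearr
    var_comp_act var_one_comp var_comp_one var_comp_seq var_comp_par var_unit.

End Variety.

Section Varieties.

Variable k : fieldType.
Implicit Types l r : term k nat.
Let x : term k nat := Var 0%N.
Let y : term k nat := Var 1%N.
Let z : term k nat := Var 2%N.

(* The free algebras below are nonunital, which makes no difference for the
   multilinear part in arity n >= 1. *)
Definition As_laws l r : Prop :=
  l = Mul (Mul x y) z /\ r = Mul x (Mul y z).

Definition Com_laws l r : Prop :=
  As_laws l r \/ (l = Mul x y /\ r = Mul y x).

Definition Lie_laws l r : Prop :=
  (l = Mul x x /\ r = Zero) \/
  (l = Add (Mul x (Mul y z)) (Add (Mul y (Mul z x)) (Mul z (Mul x y)))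
   /\ r = Zero).

Lemma As_linpart l r (e : nat -> k) :
  As_laws l r -> linpart e l = linpart e r.
Proof. by case=> -> ->. Qed.

Lemma Com_linpart l r (e : nat -> k) :
  Com_laws l r -> linpart e l = linpart e r.
Proof. by case=> [/As_linpart ->|[-> ->]]. Qed.

Lemma Lie_linpart l r (e : nat -> k) :
  Lie_laws l r -> linpart e l = linpart e r.
Proof. by case=> [[-> ->]|[-> ->]] //=; rewrite !addr0. Qed.

Definition As : operad k := variety_operad As_linpart.
Definition Com : operad k := variety_operad Com_linpart.
Definition Lie : operad k := variety_operad Lie_linpart.

End Varieties.

(* Main.v *)
Require Import Defs.
From mathcomp Require Import all_boot all_order all_algebra all_fingroup.
From mathcomp Require Import zify ring.
From mathcomp Require Import boolp.

Set Implicit Arguments.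
Unset Strict Implicit.
Unset Printing Implicit Defensive.

Import GRing.Theory.
Local Open Scope ring_scope.

(** Each of the three operads has, in every arity, a basis of left-normed
    products (..((x_1 x_2) x_3) ..) x_m, called combs, one for every allowed
    order of the variables: all orders for As, the orders that start with the
    least variable for Lie, the decreasing order for Com.  Substituting a comb
    for the first variable of a comb gives a comb, and the resulting order is
    allowed if and only if the two given ones are.  Substituting it for another
    variable gives a combination of combs of smaller rank.  So the combs form a
    basis of Poincare-Birkhoff-Witt type, and pbw_exact deduces exactness from
    that alone.

    The basis of the complex that results consists of planar trees: a tree
    with an allowed order on the inputs of each vertex.  An internal edge which
    comes first among the inputs of its vertex can be contracted without leaving
    the basis (graft); conversely a vertex with inputs e_1, .., e_m can be cut
    along the union of e_1, .., e_i.  The unions of this kind, cut or not, are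
    the marks of the planar tree, and cutting or contracting one of them changes
    neither the set of marks (marks_graft) nor the rank (rank_graft).  Choose one
    mark by a rule that depends only on the set of marks.  Then cutting the
    chosen mark is a bijection from the cells of degree j in which it is uncut
    to the cells of degree j + 1 in which it is cut.  A planar tree without marks
    is binary (marks_eq0), so every cell outside of the rightmost term is
    paired.

    The block of the differential that goes from uncut cells to cut cells is
    triangular with respect to the rank, with signs on the diagonal
    (differential_mark_cut).  Being injective, it shows that a cocycle which
    vanishes on the cut cells vanishes (vanish_from_cut); being surjective, it
    shows that every cochain agrees on the cut cells with a coboundary
    (solve_on_cut).  Subtracting from a cocycle the coboundary with which it
    agrees on the cut cells therefore leaves zero.

    The translation between cochains and values on cells uses that the elements
    of these operads are multilinear elements of free algebras.  An operation
    attached to a vertex is realized in the free algebra on the set of all edges,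
    where composition along an edge e becomes substitution for the letter e.
    The coefficients with respect to combs are obtained by evaluating in
    matrices, with the product for As and the commutator for Lie, and in the
    ground field for Com. *)

(** * Trees as sets of clusters *)

Section TreeEdges.

Variable n : nat.
Local Notation V := {set 'I_n}.
Implicit Types (S T : {set V}) (e r u v x y z : V) (s t : seq V).

Definition join s : V := \bigcup_(x <- s) x.

Lemma mem_join i s : (i \in join s) = has (fun x : V => i \in x) s.
Proof.
by rewrite /join; elim: s => [|x s IH]; rewrite ?big_nil ?big_cons !inE //= IH.
Qed.

Lemma join_cons x s : join (x :: s) = x :|: join s.
Proof. by rewrite /join big_cons. Qed.

Lemma join_cat s t : join (s ++ t) = join s :|: join t.
Proof. by rewrite /join big_cat. Qed.

Lemma join1 x : join [:: x] = x.
Proof. by rewrite /join big_seq1. Qed.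

Lemma sub_join x s : x \in s -> x \subset join s.
Proof.
by move=> xs; apply/subsetP => i ix; rewrite mem_join; apply/hasP; exists x.
Qed.

Definition blocks s : Prop :=
  [/\ uniq s, set0 \notin s &
      forall x y, x \in s -> y \in s -> x != y -> [disjoint x & y]].

Lemma perm_blocks s t : perm_eq s t -> blocks s -> blocks t.
Proof.
move=> st [us s0 sd]; split; first by rewrite -(perm_uniq st).
  by rewrite -(perm_mem st).
by move=> x y; rewrite -!(perm_mem st); apply: sd.
Qed.

Lemma blocks_sub s t : uniq t -> {subset t <= s} -> blocks s -> blocks t.
Proof.
move=> ut ts [us s0 sd]; split=> //; first by apply: contra s0 => /ts.
by move=> x y /ts xs /ts ys; apply: sd.
Qed.

Lemma blocks_catl s t : blocks (s ++ t) -> blocks s.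
Proof.
move=> h; apply: (blocks_sub _ _ h); last by move=> x; rewrite mem_cat => ->.
by have [] := h; rewrite cat_uniq => /andP[].
Qed.

Lemma blocks_catr s t : blocks (s ++ t) -> blocks t.
Proof.
move=> h; apply: (blocks_sub _ _ h); last by move=> x; rewrite mem_cat orbC => ->.
by have [] := h; rewrite cat_uniq => /and3P[].
Qed.

Lemma blocks_disjoint s t : blocks (s ++ t) -> [disjoint join s & join t].
Proof.
move=> [us s0 sd]; rewrite -setI_eq0; apply/eqP/setP => i; rewrite !inE !mem_join.
apply/negP => /andP[/hasP [x xs ix] /hasP [y yt iy]].
have xy : x != y.
  move: us; rewrite cat_uniq => /and3P[_ /hasPn h _].
  by apply: contraTneq xs => ->; apply: h.
have := sd x y; rewrite !mem_cat xs yt orbT => /(_ isT isT xy).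
by move=> /disjoint_setI0 /setP /(_ i); rewrite !inE ix iy.
Qed.

Lemma join_neq0 s : s != [::] -> blocks s -> join s != set0.
Proof.
case: s => // x s _ [_ + _]; rewrite inE negb_or => /andP[x0 _].
have [i ix] : exists i, i \in x by apply/set0Pn; rewrite eq_sym.
by apply/set0Pn; exists i; rewrite mem_join /= ix.
Qed.

Lemma subset_disjoint0 x y : x != set0 -> x \subset y -> ~~ [disjoint x & y].
Proof.
case/set0Pn => i ix xy; apply/pred0Pn; exists i => /=.
by rewrite ix (subsetP xy).
Qed.

Lemma edgesP T x :
  reflect (x != setT /\ (x \in T \/ exists i, x = [set i])) (x \in edges T).
Proof.
rewrite !inE; apply: (iffP andP) => -[xT h]; split=> //.
  by case/orP: h => [|/imsetP [i _ ->]]; [left | right; exists i].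
by case: h => [->//|[i ->]]; rewrite imset_f ?orbT.
Qed.

Section Tree.

Variables (T : {set V}) (hT : ntree T).

Lemma root_vert : setT \in T. Proof. by case/and3P: hT. Qed.

Lemma vert_gt1 v : v \in T -> (1 < #|v|)%N.
Proof. by case/and3P: hT => _ /forall_inP h _ /h. Qed.

Lemma vert_neq0 v : v \in T -> v != set0.
Proof. by move/vert_gt1 => h; rewrite -card_gt0 ltnW. Qed.

Lemma edge_neq0 x : x \in edges T -> x != set0.
Proof.
case/edgesP => _ [/vert_neq0 //|[i ->]].
by apply/set0Pn; exists i; rewrite inE.
Qed.

Lemma iedge_edge e : e \in iedges T -> e \in edges T.
Proof. by rewrite !inE => /andP[-> ->]. Qed.

Lemma iedge_vert e : e \in iedges T -> e \in T.
Proof. by rewrite !inE => /andP[]. Qed.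

Lemma vert_edge v : v \in T -> v != setT -> v \in edges T.
Proof. by move=> vT v1; apply/edgesP; split=> //; left. Qed.

Lemma set1_edge i : [set i] \in edges T.
Proof.
apply/edgesP; split; last by right; exists i.
by apply: contraTneq (vert_gt1 root_vert) => <-; rewrite cards1.
Qed.

Lemma edge_laminar x y : x \in edges T -> y \in T :|: edges T ->
  [|| x \subset y, y \subset x | [disjoint x & y]].
Proof.
have set1_lam i (z : V) : [|| [set i] \subset z, z \subset [set i] | [disjoint [set i] & z]].
  by rewrite sub1set disjoints1; case: (i \in z); rewrite ?orbT.
case/edgesP => _ [xT|[i ->]] //.
have vert z : z \in T -> [|| x \subset z, z \subset x | [disjoint x & z]].
  by move=> zT; case/and3P: hT => _ _ /forall_inP /(_ x xT) /forall_inP /(_ z zT).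
rewrite inE => /orP[/vert //|/edgesP [_ [/vert //|[i ->]]]].
by rewrite disjoint_sym orbCA.
Qed.

Lemma inputsP v e :
  reflect [/\ e \in edges T, e \proper v &
              forall x, x \in edges T -> e \proper x -> ~~ (x \proper v)]
          (e \in inputs T v).
Proof.
rewrite [e \in inputs T v]in_set; apply: (iffP and3P) => -[eE ev h]; split=> //.
  by move=> x xE ex; have /forall_inP /(_ x xE) /implyP /(_ ex) := h.
by apply/forall_inP => x xE; apply/implyP; apply: h.
Qed.

Lemma inputs_cover v x : x \in edges T -> x \proper v ->
  exists2 e, e \in inputs T v & x \subset e.
Proof.
move=> xE xv; pose Q y := [&& y \in edges T, x \subset y & y \proper v].
have Qx : Q x by rewrite /Q xE subxx.
case: (arg_maxnP (fun y : V => #|y|) Qx) => e /and3P[eE xe ev] max.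
exists e => //; apply/inputsP; split=> // y yE ey; apply/negP => yv.
have := max y; rewrite /Q yE yv (subset_trans xe (proper_sub ey)) => /(_ isT).
  by move=> /= le; have := proper_card ey; rewrite ltnNge le.
Qed.

Lemma inputs_disjoint v e x : e \in inputs T v -> x \in inputs T v ->
  e != x -> [disjoint e & x].
Proof.
move=> /inputsP [eE ev emax] /inputsP [xE xv xmax] ex.
have xE' : x \in T :|: edges T by rewrite inE xE orbT.
case/or3P: (edge_laminar eE xE') => // sub.
  by have := emax x xE; rewrite properEneq ex sub xv => /(_ isT).
by have := xmax e eE; rewrite properEneq eq_sym ex sub ev => /(_ isT).
Qed.

Lemma blocks_inputs v s : perm_eq s (enum (inputs T v)) -> blocks s.
Proof.
move=> hs; split.
- by rewrite (perm_uniq hs) enum_uniq.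
- rewrite (perm_mem hs) mem_enum; apply/negP => /inputsP [h _ _].
  by have := edge_neq0 h; rewrite eqxx.
- move=> x y; rewrite !(perm_mem hs) !mem_enum; exact: inputs_disjoint.
Qed.

Lemma join_inputs v s : v \in T -> perm_eq s (enum (inputs T v)) -> join s = v.
Proof.
move=> vT hs; apply/setP => i; rewrite mem_join; apply/hasP/idP => [[x]|iv].
  by rewrite (perm_mem hs) mem_enum => /inputsP [_ /proper_sub /subsetP h _] /h.
have pv : [set i] \proper v.
  by rewrite properEcard sub1set iv cards1 vert_gt1.
have [e ev ie] := inputs_cover (set1_edge i) pv.
exists e; first by rewrite (perm_mem hs) mem_enum.
by rewrite -sub1set.
Qed.

Lemma inputs_gt1 v s : v \in T -> perm_eq s (enum (inputs T v)) -> (1 < size s)%N.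
Proof.
move=> vT hs; have := join_inputs vT hs.
case: s hs => [|e [|//]] hs.
  by rewrite /join big_nil => v0; have := vert_neq0 vT; rewrite -v0 eqxx.
rewrite join1 => ev; have : e \in inputs T v by rewrite -mem_enum -(perm_mem hs) inE.
by move=> /inputsP [_ + _]; rewrite ev properxx.
Qed.

Lemma parent_exists x : x \in edges T -> exists2 v, v \in T & x \in inputs T v.
Proof.
move=> xE; pose Q v := (v \in T) && (x \proper v).
have QT : Q setT by rewrite /Q root_vert properT; case/edgesP: xE.
case: (arg_minnP (fun y : V => #|y|) QT) => v /andP[vT xv] min.
exists v => //; apply/inputsP; split=> // y yE xy; apply/negP => yv.
case/edgesP: (yE) => _ [yT|[i yi]].
  have := min y; rewrite /Q yT xy => /(_ isT).
  by move=> /= le; have := proper_card yv; rewrite ltnNge le.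
move: (proper_card xy); rewrite yi cards1 ltnS leqn0 cards_eq0 => /eqP x0.
by have := edge_neq0 xE; rewrite x0 eqxx.
Qed.

Lemma parent_uniq x u v : u \in T -> v \in T ->
  x \in inputs T u -> x \in inputs T v -> u = v.
Proof.
move=> uT vT xu xv; apply/eqP; apply: contraT => uv.
wlog suv : u v uT vT xu xv uv / u \subset v.
  move=> hw; have [xE xpu _] := inputsP _ _ xu; have [_ xpv _] := inputsP _ _ xv.
  case/and3P: hT => _ _ /forall_inP /(_ u uT) /forall_inP /(_ v vT) /or3P [] h.
  - exact: hw h.
  - by apply: hw h; rewrite // eq_sym.
  have := subset_disjoint0 (edge_neq0 xE) (subxx x).
  by rewrite (disjointW (proper_sub xpu) (proper_sub xpv) h).
have puv : u \proper v by rewrite properEneq uv.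
have [_ xpu _] := inputsP _ _ xu; have [_ _ /(_ u)] := inputsP _ _ xv.
rewrite xpu puv => h; apply: h => //; apply: vert_edge => //.
by apply: contraTneq puv => ->; rewrite properE subsetT andbF.
Qed.

(** Maximality of the members of S is automatic: an edge between a member x and v
    would be contained in a member, which then meets x. *)
Lemma inputs_criterion S v : v \in T ->
    (forall x, x \in S -> x \in edges T /\ x \proper v) ->
    (forall x, x \in edges T -> x \proper v -> exists2 y, y \in S & x \subset y) ->
    (forall x y, x \in S -> y \in S -> x != y -> [disjoint x & y]) ->
  S = inputs T v.
Proof.
move=> vT Ssub Scov Sdis; apply/setP => x; apply/idP/inputsP => [xS|[xE xv max]].
  have [xE xv] := Ssub x xS; split=> // y yE xy; apply/negP => yv.
  have [z zS yz] := Scov y yE yv; have xz := proper_sub_trans xy yz.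
  have := Sdis x z xS zS; rewrite (proper_neq xz) => /(_ isT).
  by apply/negP/subset_disjoint0; [exact: edge_neq0 | exact: proper_sub].
have [y yS xy] := Scov x xE xv; case: (eqVneq x y) => [->//|nxy].
have [yE yv] := Ssub y yS; have := max y yE.
by rewrite properEneq nxy xy yv => /(_ isT).
Qed.

End Tree.

Section Contraction.

Variables (T : {set V}) (hT : ntree T) (e p : V).
Hypotheses (eI : e \in iedges T) (pT : p \in T) (ep : e \in inputs T p).

Lemma contract_neq : p != e.
Proof. by have [_ /proper_neq + _] := inputsP _ _ _ ep; rewrite eq_sym. Qed.

Lemma edges_contract : edges (T :\ e) = edges T :\ e.
Proof.
apply/setP => x; rewrite [RHS]in_setD1; apply/edgesP/andP => [[xT h]|[xe /edgesP [xT h]]].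
  case: h => [/setD1P [xe xT']|[i xi]]; split=> //; try by apply/edgesP; auto.
    apply: contraTneq (vert_gt1 hT (iedge_vert eI)) => <-.
    by rewrite xi cards1.
  by apply/edgesP; split=> //; right; exists i.
by split=> //; case: h => [xT'|]; [left; rewrite in_setD1 xe | right].
Qed.

Lemma ntree_contract : ntree (T :\ e).
Proof.
case/and3P: hT => rT /forall_inP h1 /forall_inP h2; apply/and3P; split.
- by rewrite in_setD1 rT andbT eq_sym; case/setD1P: eI.
- by apply/forall_inP => v /setD1P [_ /h1].
- apply/forall_inP => u /setD1P [_ /h2 /forall_inP hu].
  by apply/forall_inP => v /setD1P [_ /hu].
Qed.

(** Contracting e replaces the input e of its parent p by the inputs of e, and
    changes the inputs of no other vertex (inputs_contract_other). *)
Lemma inputs_contract_parent :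
  inputs (T :\ e) p = inputs T e :|: (inputs T p :\ e).
Proof.
have /inputsP [eE epr emax] := ep.
symmetry; apply: (inputs_criterion ntree_contract).
- by rewrite in_setD1 contract_neq.
- move=> x /setUP [/inputsP [xE xe _]|/setD1P [xe /inputsP [xE xp _]]].
    by rewrite edges_contract in_setD1 xE (proper_neq xe) (proper_trans xe).
  by rewrite edges_contract in_setD1 xE xe xp.
- move=> x; rewrite edges_contract => /setD1P [xe xE] xp.
  have [y yp xy] := inputs_cover xE xp; case: (eqVneq y e) => [ye|nye].
    have xe' : x \proper e by rewrite properEneq xe -ye.
    have [z ze xz] := inputs_cover xE xe'.
    by exists z => //; rewrite inE ze.
  by exists y => //; rewrite inE in_setD1 nye yp orbT.
move=> x y /setUP [xe|/setD1P [xe xp]] /setUP [ye|/setD1P [ye yp]] xy.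
- exact: inputs_disjoint hT _ _ _ xe ye xy.
- have /inputsP [_ /proper_sub xe' _] := xe.
  by apply: disjointWl xe' _; apply: (inputs_disjoint hT ep yp); rewrite eq_sym.
- have /inputsP [_ /proper_sub ye' _] := ye.
  by apply: disjointWr ye' _; apply: (inputs_disjoint hT xp ep).
- exact: inputs_disjoint hT _ _ _ xp yp xy.
Qed.

Lemma inputs_parent_disjoint x : x \in inputs T e -> x \notin inputs T p.
Proof.
move=> /inputsP [xE xe _]; apply/negP => xp.
have := inputs_disjoint hT xp ep (proper_neq xe).
by apply/negP/subset_disjoint0; [exact: (edge_neq0 hT xE) | exact: proper_sub].
Qed.

Lemma inputs_contract_other v : v \in T -> v != e -> v != p ->
  inputs (T :\ e) v = inputs T v.
Proof.
move=> vT ve vp; symmetry; apply: (inputs_criterion ntree_contract).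
- by rewrite in_setD1 ve.
- move=> x xv; have /inputsP [xE xpv _] := xv.
  rewrite edges_contract in_setD1 xE xpv andbT; split=> //.
  apply: contraNneq vp => xe; rewrite xe in xv.
  by apply/eqP/(parent_uniq hT vT pT xv ep).
- by move=> x; rewrite edges_contract => /setD1P [_ xE] xv; apply: inputs_cover.
by move=> x y; apply: inputs_disjoint.
Qed.

End Contraction.

(** The inverse of a contraction: some of the inputs of v, listed in s1, are
    collected at a new vertex, whose cluster is their union. *)
Section Expansion.

Variables (T : {set V}) (hT : ntree T) (v : V) (vT : v \in T) (s1 s2 : seq V).
Hypotheses (hs : perm_eq (s1 ++ s2) (enum (inputs T v))).
Hypotheses (gt1 : (1 < size s1)%N) (s2n : s2 != [::]).
Local Notation r := (join s1).

Let bl : blocks (s1 ++ s2). Proof. exact: blocks_inputs hs. Qed.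

Let in_s x : (x \in inputs T v) = (x \in s1 ++ s2).
Proof. by rewrite (perm_mem hs) mem_enum. Qed.

Let two : exists x y, [/\ x \in s1, y \in s1 & [disjoint x & y]].
Proof.
case: (s1) gt1 bl => [|x [|y s]] // _ [us _ h]; exists x, y.
rewrite !inE !eqxx orbT; split=> //; apply: h; rewrite ?inE ?eqxx ?orbT //.
by move: us; rewrite /= inE negb_or => /andP[/andP[]].
Qed.

Let in_neq0 x : x \in s1 ++ s2 -> x != set0.
Proof. by have [_ h _] := bl => xs; apply: contraNneq h => <-. Qed.

Lemma expand_proper : r \proper v.
Proof.
rewrite -(join_inputs hT vT hs) join_cat properE subsetUl /=.
have j2 := join_neq0 s2n (blocks_catr bl); apply/negP; rewrite subUset => /andP[_ h].
have := subset_disjoint0 j2 h; rewrite disjoint_sym.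
by rewrite (blocks_disjoint bl).
Qed.

Lemma expand_gt1 : (1 < #|r|)%N.
Proof.
have [x [y [xs ys xy]]] := two.
have := in_neq0 (x := x); have := in_neq0 (x := y); rewrite !mem_cat xs ys.
move=> /(_ isT) /set0Pn [j jy] /(_ isT) /set0Pn [i ix].
apply/card_gt1P; exists i, j.
have /subsetP sx := sub_join xs; have /subsetP sy := sub_join ys.
split; [exact: sx | exact: sy |].
apply: contraTneq xy => ij; apply/pred0Pn; exists i; by rewrite /= ix ij jy.
Qed.

(** An edge strictly below v lies in a single input of v, but the new cluster
    contains two disjoint ones. *)
Lemma expand_notin : r \notin edges T.
Proof.
apply/negP => rE; have [y yv ry] := inputs_cover rE expand_proper.
have eqy x : x \in s1 -> x = y.
  move=> xs; apply/eqP; apply: contraT => xy.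
  have xv : x \in inputs T v by rewrite in_s mem_cat xs.
  have := subset_disjoint0 (in_neq0 _) (subset_trans (sub_join xs) ry).
  by rewrite (inputs_disjoint hT xv yv xy) -in_s => /(_ xv).
have [x [x' [xs xs' d]]] := two.
have := subset_disjoint0 (in_neq0 _) (subxx x); rewrite mem_cat xs => /(_ isT).
by rewrite {2}(eqy _ xs) -(eqy _ xs') d.
Qed.

Lemma expand_notvert : r \notin T.
Proof.
apply: contra expand_notin => rT; apply: vert_edge => //.
by apply: contraTneq expand_proper => ->; rewrite properE subsetT andbF.
Qed.

Lemma sub_expand u : u \in edges T -> u \proper v -> (u \subset r) || [disjoint u & r].
Proof.
move=> uE uv; have [y + uy] := inputs_cover uE uv.
rewrite in_s mem_cat => /orP[ys|ys].
  by rewrite (subset_trans uy) // sub_join.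
apply/orP; right; apply: disjointWl uy _; rewrite disjoint_sym.
by apply: disjointWr (sub_join ys) _; apply: blocks_disjoint.
Qed.

Lemma ntree_expand : ntree (r |: T).
Proof.
case/and3P: (hT) => rT /forall_inP h1 /forall_inP h2.
have lam u : u \in T -> [|| u \subset r, r \subset u | [disjoint u & r]].
  move=> uT; have /forall_inP /(_ v vT) := h2 u uT.
  case: (eqVneq u v) => [->|uv]; first by rewrite (proper_sub expand_proper) orbT.
  case/or3P => [sub|sub|dis].
  - have uv' : u \proper v by rewrite properEneq uv.
    have uE : u \in edges T.
      apply: vert_edge => //; apply: contraTneq uv' => ->.
      by rewrite properE subsetT andbF.
    by case/orP: (sub_expand uE uv') => ->; rewrite ?orbT.
  - by rewrite (subset_trans (proper_sub expand_proper) sub) orbT.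
  - by rewrite (disjointWr (proper_sub expand_proper) dis) !orbT.
apply/and3P; split.
- by rewrite in_setU1 rT orbT.
- by apply/forall_inP => u /setU1P [->|/h1 //]; apply: expand_gt1.
apply/forall_inP => u /setU1P [->|uT]; apply/forall_inP => w /setU1P [->|wT].
- by rewrite subxx.
- by rewrite orbCA disjoint_sym lam.
- exact: lam.
- by have /forall_inP /(_ w wT) := h2 u uT.
Qed.

Let rnT : r != setT.
Proof.
by apply: contraTneq expand_proper => ->; rewrite properE subsetT andbF.
Qed.

Lemma expand_iedge : r \in iedges (r |: T).
Proof. by apply/setD1P; split=> //; rewrite in_setU1 eqxx. Qed.

Lemma expandK : (r |: T) :\ r = T.
Proof.
apply/setP => x; rewrite in_setD1 in_setU1.
by case: eqVneq => // ->; rewrite (negbTE expand_notvert).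
Qed.

Lemma edges_expand x : (x \in edges (r |: T)) = (x == r) || (x \in edges T).
Proof.
have := edges_contract ntree_expand expand_iedge; rewrite expandK => ->.
rewrite [in RHS]in_setD1; case: (eqVneq x r) => [->|] //=.
exact: iedge_edge expand_iedge.
Qed.

Lemma inputs_expand_new : perm_eq s1 (enum (inputs (r |: T) r)).
Proof.
rewrite uniq_perm ?enum_uniq //; first by have [/[!cat_uniq]/andP[]] := bl.
move=> x; rewrite mem_enum.
rewrite -(@inputs_criterion _ ntree_expand [set x in s1] r) ?in_setU1 ?eqxx ?in_set //.
- move=> y; rewrite in_set => ys.
  have /inputsP [yE yv _] : y \in inputs T v by rewrite in_s mem_cat ys.
  rewrite edges_expand yE orbT; split=> //; rewrite properEneq sub_join // andbT.
  by apply: contraNneq expand_notin => <-.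
- move=> y; rewrite edges_expand => /orP[/eqP ->|yE yr]; first by rewrite properxx.
  have [z zv yz] := inputs_cover yE (proper_trans yr expand_proper).
  exists z => //; rewrite inE; move: zv; rewrite in_s mem_cat => /orP[//|zs].
  have := subset_disjoint0 (edge_neq0 hT yE) yz; rewrite disjoint_sym.
  by rewrite (disjointW (sub_join zs) (proper_sub yr)) // disjoint_sym blocks_disjoint.
- move=> y z; rewrite !inE => ys zs yz.
  by apply: (inputs_disjoint hT (v := v)); rewrite // in_s mem_cat ?ys ?zs.
Qed.

Lemma inputs_expand_parent : perm_eq (r :: s2) (enum (inputs (r |: T) v)).
Proof.
have rs : r \notin s2.
  apply: contra expand_notin => rs.
  by have /inputsP [] : r \in inputs T v by rewrite in_s mem_cat rs orbT.
rewrite uniq_perm ?enum_uniq //=.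
  by rewrite rs; have [/[!cat_uniq]/and3P[]] := bl.
move=> x; rewrite mem_enum.
rewrite -(@inputs_criterion _ ntree_expand [set x in r :: s2] v) ?in_setU1 ?vT ?orbT ?in_set //.
- move=> y; rewrite in_set in_cons edges_expand => /orP[/eqP ->|ys].
    by rewrite eqxx expand_proper.
  have /inputsP [yE yv _] : y \in inputs T v by rewrite in_s mem_cat ys orbT.
  by rewrite yE orbT yv.
- move=> y; rewrite edges_expand => /orP[/eqP -> _|yE yv].
    by exists r; rewrite // !inE eqxx.
  have [z + yz] := inputs_cover yE yv; rewrite in_s mem_cat => /orP[zs|zs].
    by exists r; rewrite ?inE ?eqxx // (subset_trans yz) // sub_join.
  by exists z; rewrite // !inE zs orbT.
- move=> y z; rewrite !inE => /orP[/eqP ->|ys] /orP[/eqP ->|zs].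
  + by rewrite eqxx.
  + by move=> _; apply: disjointWr (sub_join zs) _; apply: blocks_disjoint.
  + by move=> _; rewrite disjoint_sym; apply: disjointWr (sub_join ys) _; apply: blocks_disjoint.
  + by move=> yz; apply: (inputs_disjoint hT (v := v)); rewrite // in_s mem_cat ?ys ?zs orbT.
Qed.

Lemma inputs_expand_other u : u \in T -> u != v -> inputs (r |: T) u = inputs T u.
Proof.
move=> uT uv; rewrite -[in RHS]expandK.
rewrite (@inputs_contract_other _ ntree_expand r v) ?expand_iedge ?in_setU1 ?vT ?uT ?orbT //.
- by rewrite -mem_enum -(perm_mem inputs_expand_parent) inE eqxx.
- by apply: contraNneq expand_notvert => <-.
Qed.

End Expansion.

(** Every edge except the output is an input of exactly one vertex. *)
Lemma sum_inputs T : ntree T ->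
  (\sum_(v in T) #|inputs T v| = #|iedges T| + n)%N.
Proof.
move=> hT; under eq_bigr do rewrite -sum1_card big_mkcond.
rewrite exchange_big /=.
have -> : (#|iedges T| + n = #|edges T|)%N.
  rewrite (_ : edges T = iedges T :|: [set [set i] | i : 'I_n]).
    rewrite cardsU (_ : _ :&: _ = set0) ?cards0 ?subn0; last first.
      apply/setP => x; rewrite in_setI in_set0; apply/negP => /andP[xI /imsetP [i _ xi]].
      by have := vert_gt1 hT (iedge_vert xI); rewrite xi cards1.
    by rewrite card_imset ?card_ord //; apply: set1_inj.
  apply/setP => x; apply/idP/setUP => [/edgesP [xT [xT'|[i ->]]]|[/iedge_edge //|]].
  - by left; apply/setD1P.
  - by right; apply/imsetP; exists i.
  - by case/imsetP => i _ ->; apply: set1_edge.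
rewrite -sum1_card (big_mkcond (fun x => x \in edges T)); apply: eq_bigr => x _ /=.
case: ifPn => xE; last first.
  rewrite big1 // => v _; case: ifP => // /inputsP [xE' _ _].
  by rewrite xE' in xE.
have [p pT xp] := parent_exists hT xE; rewrite (bigD1 p) //= xp big1 ?addn0 //.
move=> v /andP[vT vp]; case: ifP => // xv.
by rewrite (parent_uniq hT vT pT xv xp) eqxx in vp.
Qed.

End TreeEdges.

(** * Planar trees, marks and rank *)

Section PlanarTrees.

Variable n : nat.
Local Notation V := {set 'I_n}.

(** A planar tree assigns to every vertex the list of its inputs, and the empty
    list to all other clusters, so that it determines its underlying tree
    (shape).  Bounding the lengths of the lists makes the type finite. *)
Definition plan := {ffun V -> {bseq #|{: V}| of V}}.

Implicit Types (F G : plan) (T : {set V}) (e p r u v x : V) (s t : seq V).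

Definition mkplan (g : V -> seq V) : plan := [ffun v => insub_bseq _ (g v)].

Lemma mkplanE (g : V -> seq V) v : uniq (g v) -> mkplan g v = g v :> seq V.
Proof.
move=> ug; rewrite ffunE; apply: insubdK; rewrite -topredE /=.
by rewrite -(card_uniqP ug) max_card.
Qed.

Lemma plan_eq F G : (forall v, F v = G v :> seq V) -> F = G.
Proof. by move=> h; apply/ffunP => v; apply: val_inj; apply: h. Qed.

Definition shape F : {set V} := [set v | (F v : seq V) != [::]].

Lemma shapePn F v : v \notin shape F -> F v = [::] :> seq V.
Proof. by rewrite inE negbK => /eqP. Qed.

Variable allowed : pred (seq V).
(** Cutting an allowed list after an initial segment s gives two allowed lists,
    and conversely. *)
Hypothesis allowed_cat : forall s t, s != [::] -> blocks (s ++ t) ->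
  allowed (s ++ t) = allowed s && allowed (join s :: t).

Definition planar F : Prop := ntree (shape F) /\ forall v, v \in shape F ->
  perm_eq (F v) (enum (inputs (shape F) v)) /\ allowed (F v).

Section Planar.

Variables (F : plan) (hF : planar F).

Lemma planar_tree : ntree (shape F). Proof. by case: hF. Qed.

Lemma planar_perm v : v \in shape F -> perm_eq (F v) (enum (inputs (shape F) v)).
Proof. by case: hF => _ h /h []. Qed.

Lemma planar_allowed v : v \in shape F -> allowed (F v).
Proof. by case: hF => _ h /h []. Qed.

Lemma planar_mem v x : v \in shape F -> (x \in (F v : seq V)) = (x \in inputs (shape F) v).
Proof. by move=> /planar_perm/perm_mem ->; rewrite mem_enum. Qed.

Lemma planar_join v : v \in shape F -> join (F v) = v.
Proof. by move=> vT; exact: (join_inputs planar_tree vT (planar_perm vT)). Qed.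

Lemma planar_blocks v : blocks (F v).
Proof.
case: (boolP (v \in shape F)) => [vT|/shapePn ->]; last by split.
exact: (blocks_inputs planar_tree (planar_perm vT)).
Qed.

Lemma planar_uniq v : uniq (F v).
Proof. by have [] := planar_blocks v. Qed.

Lemma planar_size v : v \in shape F -> (1 < size (F v))%N.
Proof. by move=> vT; exact: (inputs_gt1 planar_tree vT (planar_perm vT)). Qed.

End Planar.

(** Contraction of an edge e which is the first input of its parent: the inputs
    of e take its place in the list. *)
Definition graft e F : plan := mkplan (fun v =>
  if v == e then [::] else
  if (F v : seq V) is x :: s then if x == e then F e ++ s else F v else [::]).

Section Graft.

Variables (F : plan) (hF : planar F) (e p : V) (s : seq V).
Hypotheses (eI : e \in iedges (shape F)) (pT : p \in shape F).
Hypothesis ep : F p = e :: s :> seq V.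

Let hT := planar_tree hF.
Let eT : e \in shape F. Proof. exact: iedge_vert eI. Qed.
Let ein : e \in inputs (shape F) p.
Proof. by rewrite -(planar_mem hF) // ep inE eqxx. Qed.
Let pe : p != e. Proof. exact: contract_neq ein. Qed.

Lemma graft_blocks : blocks (F e ++ s).
Proof.
have /(_ p)[] := planar_blocks hF => us s0 sd.
have [ue e0 ed] := planar_blocks hF e.
have je := planar_join hF eT.
have dis x y : x \in (F e : seq V) -> y \in s -> [disjoint x & y].
  move=> xe ys; apply: (@disjointWl _ _ (mem e)); first by rewrite -je sub_join.
  apply: sd; rewrite ?ep ?inE ?eqxx ?ys ?orbT //.
  by apply: contraTneq us => ye; rewrite ep /= ye ys.
split.
- rewrite cat_uniq ue; move: us; rewrite ep /= => /andP[_ ->]; rewrite andbT.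
  apply/hasPn => y ys; apply/negP => ye.
  have y0 : y != set0 by apply: contraNneq e0 => <-.
  by have := subset_disjoint0 y0 (subxx y); rewrite dis.
- by rewrite mem_cat negb_or e0; move: s0; rewrite ep inE negb_or => /andP[].
- move=> x y; rewrite !mem_cat => /orP[xe|xs] /orP[ye|ys] xy.
  + exact: ed.
  + exact: dis.
  + by rewrite disjoint_sym dis.
  + by apply: sd; rewrite ?ep ?inE ?xs ?ys ?orbT.
Qed.

Lemma graftE v : graft e F v =
  (if v == e then [::] else if v == p then F e ++ s else F v) :> seq V.
Proof.
have eq_g : (if v == e then [::] else
  if (F v : seq V) is x :: s then if x == e then F e ++ s else F v else [::])
  = (if v == e then [::] else if v == p then F e ++ s else F v).
  case: (eqVneq v p) => [->|vp]; first by rewrite ep eqxx.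
  case: eqP => // _; case Fv : (F v : seq V) => [//|x s'].
  case: (eqVneq x e) => [xe|//]; case/eqP: vp.
  have vT : v \in shape F by rewrite inE Fv.
  apply: (parent_uniq hT vT pT _ ein).
  by rewrite -(planar_mem hF) // Fv xe inE eqxx.
rewrite mkplanE eq_g //; case: eqP => // _; case: eqP => // _.
  by have [] := graft_blocks.
exact: planar_uniq.
Qed.

Lemma graft_parent : graft e F p = F e ++ s :> seq V.
Proof. by rewrite graftE (negbTE pe) eqxx. Qed.

Lemma graft_other v : v != e -> v != p -> graft e F v = F v :> seq V.
Proof. by move=> /negbTE ve /negbTE vp; rewrite graftE ve vp. Qed.

Lemma shape_graft : shape (graft e F) = shape F :\ e.
Proof.
apply/setP => v; rewrite in_setD1 !inE graftE.
case: (eqVneq v e) => //= _; case: (eqVneq v p) => [->|//]; rewrite ep /=.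
by have := eT; rewrite inE; case: (F e : seq V).
Qed.

Lemma planar_graft : planar (graft e F).
Proof.
rewrite /planar shape_graft; split; first exact: ntree_contract.
move=> v /setD1P [ve vT]; case: (eqVneq v p) => [->|vp]; last first.
  rewrite graft_other // (inputs_contract_other hT eI pT) //.
  by split; [apply: planar_perm | apply: planar_allowed].
rewrite graft_parent (inputs_contract_parent hT eI pT) //; split; last first.
  have e0 : (F e : seq V) != [::] by have := eT; rewrite inE.
  rewrite allowed_cat //; last exact: graft_blocks.
  rewrite planar_join // -ep.
  by rewrite !planar_allowed.
apply: uniq_perm; rewrite ?enum_uniq //; first by have [] := graft_blocks.
move=> x; rewrite mem_enum mem_cat in_setU in_setD1 -!planar_mem // ep inE.
by case: eqP => //= ->; have := planar_uniq hF p; rewrite ep /= => /andP[/negbTE ->].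
Qed.

End Graft.

(** In the list of p after contraction, the part coming from e is known from its
    length, which is the number of inputs of e in the common shape. *)
Lemma graft_inj F G e p p' s s' : planar F -> planar G -> shape F = shape G ->
  e \in iedges (shape F) -> p \in shape F -> F p = e :: s :> seq V ->
  p' \in shape F -> G p' = e :: s' :> seq V ->
  graft e F = graft e G -> F = G.
Proof.
move=> hF hG FG eI pT Fp pT' Gp gFG.
have hT := planar_tree hF.
have pp : p' = p.
  apply: (parent_uniq hT pT' pT (x := e)).
    by rewrite FG -(planar_mem hG) -?FG // Gp inE eqxx.
  by rewrite -(planar_mem hF _ pT) Fp in_cons eqxx.
rewrite {}pp {pT'} in Gp; have eI' := eI; rewrite FG in eI'.
have eT := iedge_vert eI; have pT' := pT; rewrite FG in pT'.
have sz : size (F e) = size (G e).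
  by rewrite (perm_size (planar_perm hF eT)) FG -(perm_size (planar_perm hG _)) -?FG.
have /eqP : F e ++ s = G e ++ s'.
  by rewrite -(graft_parent hF eI pT Fp) gFG (graft_parent hG eI' pT' Gp).
rewrite eqseq_cat // => /andP[/eqP ee /eqP ss].
apply: plan_eq => v; case: (eqVneq v e) => [->//|ve].
case: (eqVneq v p) => [->|vp]; first by rewrite Fp Gp ss.
by rewrite -(graft_other hF eI pT Fp) // gFG (graft_other hG eI' pT' Gp).
Qed.

Definition prefixes s : seq V := [seq join (take i s) | i <- iota 1 (size s).-1].

Lemma prefixesP s R : reflect (exists2 i, (0 < i < size s)%N & R = join (take i s))
  (R \in prefixes s).
Proof.
apply: (iffP mapP) => -[i hi ->]; exists i => //; move: hi; rewrite mem_iota; lia.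
Qed.

(** If s lists the inputs of the vertex join s, and this is the first input of a
    vertex whose other inputs are t, the left-hand side refers to the contracted
    tree.  So contracting a first input does not change the set of prefixes. *)
Lemma prefixes_cat s t : s != [::] ->
  prefixes (s ++ t) = prefixes s ++ prefixes (join s :: t).
Proof.
move=> s0; have s1 : (0 < size s)%N by case: (s) s0.
rewrite /prefixes size_cat /=.
have -> : ((size s + size t).-1 = (size s).-1 + size t)%N by lia.
rewrite iotaD map_cat; congr (_ ++ _).
  apply/eq_in_map => i; rewrite mem_iota => hi; rewrite takel_cat //; lia.
have -> : (1 + (size s).-1 = size s + 0)%N by lia.
have -> : (1 = 1 + 0)%N by [].
rewrite !iotaDl -!map_comp; apply/eq_in_map => i _ /=.
rewrite take_cat ltnNge leq_addr /= addKn join_cat.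
by rewrite join_cons.
Qed.

(** The clusters at which the comb of some vertex can be cut.  A prefix of length
    one is a first input; it is counted as soon as it is an internal edge, that
    is, has more than one element. *)
Definition marks F : {set V} :=
  [set R : V | (1 < #|R|)%N && [exists v, R \in prefixes (F v)]].

Lemma marks_graft F e p s : planar F -> e \in iedges (shape F) ->
  p \in shape F -> F p = e :: s :> seq V -> marks (graft e F) = marks F.
Proof.
move=> hF eI pT Fp; apply/setP => R; rewrite !in_set; congr (_ && _).
have e0 : (F e : seq V) != [::] by have := iedge_vert eI; rewrite inE.
have gp : prefixes (graft e F p) = prefixes (F e) ++ prefixes (F p).
  rewrite (graft_parent hF eI pT Fp) prefixes_cat // (planar_join hF (iedge_vert eI)).
  by rewrite Fp.
have pe : p != e.
  have ein : e \in inputs (shape F) p.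
    by rewrite -(planar_mem hF _ pT) Fp in_cons eqxx.
  exact: contract_neq ein.
apply/existsP/existsP => -[v].
  rewrite (graftE hF eI pT Fp); case: eqP => // _; case: eqP => [_|_ h]; last by exists v.
  rewrite -(graft_parent hF eI pT Fp) gp mem_cat => /orP[h|h]; by [exists e | exists p].
move=> h; case: (eqVneq v e) => [ve|ve]; first by exists p; rewrite gp mem_cat -ve h.
case: (eqVneq v p) => [vp|vp]; first by exists p; rewrite gp mem_cat -vp h orbT.
by exists v; rewrite (graft_other hF eI pT Fp).
Qed.

Lemma marksP F R : planar F -> R \in marks F ->
  exists v i, [/\ v \in shape F, (0 < i < size (F v))%N,
    R = join (take i (F v)) & (1 < #|R|)%N].
Proof.
move=> hF; rewrite inE => /andP[R1 /existsP [v /prefixesP [i hi Ri]]].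
exists v, i; split=> //; rewrite inE; move: hi; case: (F v : seq V) => //=; lia.
Qed.

(** A union of at least two, but not of all, inputs of a vertex is never a vertex
    (expand_notvert), so a mark which is a vertex is a prefix of length one. *)
Lemma mark_is_head F r : planar F -> r \in marks F -> r \in shape F ->
  r \in iedges (shape F) /\
  exists p s, p \in shape F /\ F p = r :: s :> seq V.
Proof.
move=> hF /(marksP hF) [v [i [vT /andP[i0 iv] ri _]]] rT; have hT := planar_tree hF.
have hp : perm_eq (take i (F v) ++ drop i (F v)) (enum (inputs (shape F) v)).
  by rewrite cat_take_drop planar_perm.
have dn : drop i (F v) != [::] by rewrite -size_eq0 size_drop subn_eq0 -ltnNge.
case: (ltnP 1 i) => i1.
  have := @expand_notvert _ _ hT v vT _ _ hp; rewrite (size_takel (ltnW iv)).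
  by move=> /(_ i1 dn); rewrite -ri rT.
have {i0 i1} i1 : i = 1%N by lia.
move: ri iv; rewrite i1; case Fv : (F v : seq V) => [//|x s].
rewrite /= take0 join1 => rx _; split; last by exists v, s; rewrite rx.
apply/setD1P; split=> //.
have /inputsP [/edgesP [+ _] _ _] : x \in inputs (shape F) v.
  by rewrite -(planar_mem hF) // Fv inE eqxx.
by rewrite rx.
Qed.

Lemma mark_can_be_cut F r : planar F -> r \in marks F -> r \notin shape F ->
  exists G p s, [/\ planar G, shape G = r |: shape F, p \in shape G,
    G p = r :: s :> seq V & graft r G = F].
Proof.
move=> hF /(marksP hF) [v [i [vT /andP[i0 iv] ri r1]]] rT; have hT := planar_tree hF.
set s1 := take i (F v); set s2 := drop i (F v).
have hcat : s1 ++ s2 = F v by apply: cat_take_drop.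
have hp : perm_eq (s1 ++ s2) (enum (inputs (shape F) v)) by rewrite hcat planar_perm.
have s2n : s2 != [::] by rewrite -size_eq0 size_drop subn_eq0 -ltnNge.
have s1s : size s1 = i by rewrite size_takel // ltnW.
have gt1 : (1 < size s1)%N.
  rewrite s1s ltn_neqAle i0 andbT; apply: contraNneq rT => i1.
  move: ri; rewrite -i1; case Fv : (F v : seq V) => [|x s]; first by move: iv; rewrite Fv.
  rewrite /= take0 join1 => rx.
  have /inputsP [xE _ _] : x \in inputs (shape F) v.
    by rewrite -(planar_mem hF) // Fv in_cons eqxx.
  case/edgesP: xE => _ [xT|[j xj]]; first by rewrite rx.
  by move: r1; rewrite rx xj cards1.
rewrite -/s1 in ri.
have hp2 := inputs_expand_parent hT vT hp gt1 s2n; rewrite -ri in hp2.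
have hp1 := inputs_expand_new hT vT hp gt1 s2n; rewrite -ri in hp1.
have hrv := expand_proper hT vT hp s2n; rewrite -ri in hrv.
pose g u := if u == r then s1 else if u == v then r :: s2 else F u : seq V.
have vr : v != r by rewrite eq_sym (proper_neq hrv).
have ug u : uniq (g u).
  rewrite /g; case: eqP => [_|_]; first by rewrite (perm_uniq hp1) enum_uniq.
  by case: eqP => [_|_]; [rewrite (perm_uniq hp2) enum_uniq | apply: planar_uniq].
have s10 : s1 != [::] by case: (s1) gt1.
have gE u : mkplan g u = g u :> seq V by apply: mkplanE.
have shG : shape (mkplan g) = r |: shape F.
  apply/setP => u; rewrite in_setU1 !inE gE /g.
  case: (eqVneq u r) => [_|_] //=; case: (eqVneq u v) => [->|//] /=.
  by move: vT; rewrite inE => ->.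
have hG : planar (mkplan g).
  rewrite /planar shG; split; first by rewrite ri; exact: (ntree_expand hT vT hp gt1 s2n).
  have := planar_allowed hF vT; rewrite -hcat allowed_cat //; last first.
    by rewrite hcat; apply: planar_blocks.
  rewrite -ri => /andP[a1 a2] u; rewrite gE /g.
  case: (eqVneq u r) => [->//|ur /setU1P [/eqP /[!(negbTE ur)]//|uT]].
  case: (eqVneq u v) => [->//|uv]; rewrite ri (inputs_expand_other hT vT hp) //.
  by split; [apply: planar_perm | apply: planar_allowed].
have vG : v \in shape (mkplan g) by rewrite shG in_setU1 vT orbT.
have Gv : mkplan g v = r :: s2 :> seq V by rewrite gE /g (negbTE vr) eqxx.
have rI : r \in iedges (shape (mkplan g)).
  by rewrite shG ri; apply: (expand_iedge hT vT hp).
exists (mkplan g), v, s2; split=> //; apply: plan_eq => u.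
rewrite (graftE hG rI vG Gv) !gE /g eqxx; case: eqP => [->|_]; first by rewrite shapePn.
by case: eqP => [->|//]; rewrite hcat.
Qed.

(** A vertex with at least three inputs has the union of the first two as a mark.
    So all vertices have two inputs, and sum_inputs counts the edges. *)
Lemma marks_eq0 F : planar F -> marks F = set0 -> (#|iedges (shape F)| + 2 = n)%N.
Proof.
move=> hF m0; have hT := planar_tree hF.
have s2 v : v \in shape F -> #|inputs (shape F) v| = 2%N.
  move=> vT; have hp := planar_perm hF vT.
  have := planar_size hF vT; rewrite cardE -(perm_size hp) => s1.
  apply/eqP; rewrite eqn_leq s1 andbT leqNgt; apply/negP => s3.
  have hp' : perm_eq (take 2 (F v) ++ drop 2 (F v)) (enum (inputs (shape F) v)).
    by rewrite cat_take_drop.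
  suff : join (take 2 (F v)) \in marks F by rewrite m0 in_set0.
  rewrite inE (expand_gt1 hT hp') ?(size_takel (ltnW s3)) //=.
  by apply/existsP; exists v; apply/prefixesP; exists 2%N.
have := sum_inputs hT; rewrite (eq_bigr (fun=> 2%N)) // sum_nat_const.
rewrite (cardsD1 setT (shape F)) (root_vert hT) /= -/(iedges (shape F)).
by move: #|_| => A; lia.
Qed.

Variable phi : V -> nat.

(** The total weight of the right factors of all products in the combs of F. *)
Definition rank F := (\sum_(v in shape F) \sum_(x <- behead (F v)) phi x)%N.

(** The weights of all inputs of e and p are the weights of all inputs of p in
    the contracted tree plus the weight of e; the rank leaves out the first
    input of every vertex. *)
Lemma rank_contract F G e p : planar F -> planar G -> e \in iedges (shape F) ->
  p \in shape F -> e \in inputs (shape F) p -> shape G = shape F :\ e ->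
  (forall v, v != e -> v != p -> G v = F v :> seq V) ->
  (rank G + phi (head set0 (G p)) + phi e =
   rank F + phi (head set0 (F p)) + phi (head set0 (F e)))%N.
Proof.
move=> hF hG eI pT ein shG GF; have hT := planar_tree hF.
have pe := contract_neq ein; have eT := iedge_vert eI.
have pG : p \in shape G by rewrite shG in_setD1 pe.
have sumE s : s != [::] ->
    (phi (head set0 s) + \sum_(x <- behead s) phi x = \sum_(x <- s) phi x)%N.
  by case: s => // x s _; rewrite big_cons.
have FeN : (F e : seq V) != [::] by move: eT; rewrite inE.
have FpN : (F p : seq V) != [::] by move: pT; rewrite inE.
have GpN : (G p : seq V) != [::] by move: pG; rewrite inE.
have key : (\sum_(x <- G p) phi x + phi e
    = \sum_(x <- F p) phi x + \sum_(x <- F e) phi x)%N.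
  rewrite (perm_big _ (planar_perm hG pG)) (perm_big _ (planar_perm hF pT)) /=.
  rewrite (perm_big _ (planar_perm hF eT)) /= !big_enum shG /=.
  rewrite (inputs_contract_parent hT eI pT ein).
  rewrite (eq_bigl [predU inputs (shape F) e & inputs (shape F) p :\ e]); last first.
    by move=> x; rewrite in_setU.
  rewrite bigU /=; last first.
    rewrite -setI_eq0; apply/eqP/setP => x; rewrite in_set0; apply/negP.
    move=> /setIP [/(inputs_parent_disjoint hT ein)/negP h /setD1P [_ xp]]; exact: h.
  rewrite (big_setD1 e ein) /=.
  by rewrite addnC addnA addnAC.
rewrite /rank (bigD1 p pG) [in RHS](bigD1 p pT) [in RHS](bigD1 e); last first.
  by apply/andP; split; [exact: eT | rewrite eq_sym].
rewrite (_ : (\sum_(v in shape G | v != p) _)%N =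
  (\sum_(v | (v \in shape F) && (v != p) && (v != e)) \sum_(x <- behead (F v)) phi x)%N).
move: key; rewrite -(sumE _ FeN) -(sumE _ FpN) -(sumE _ GpN).
set A := (\sum_(v | _) _)%N; move: A => A.
move: (\sum_(x <- behead (G p)) _)%N (\sum_(x <- behead (F p)) _)%N.
move: (\sum_(x <- behead (F e)) _)%N => b g a /=; lia.
apply: eq_big => [v|v /andP[vG vp]].
  by rewrite shG in_setD1; case: (v == e); rewrite ?andbF ?andbT.
by rewrite GF //; move: vG; rewrite shG => /setD1P [].
Qed.

Lemma rank_graft F e p s : planar F -> e \in iedges (shape F) ->
  p \in shape F -> F p = e :: s :> seq V -> rank (graft e F) = rank F.
Proof.
move=> hF eI pT Fp.
have ein : e \in inputs (shape F) p by rewrite -(planar_mem hF _ pT) Fp in_cons eqxx.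
have := rank_contract hF (planar_graft hF eI pT Fp) eI pT ein
  (shape_graft hF eI pT Fp) (graft_other hF eI pT Fp).
have := iedge_vert eI; rewrite (graft_parent hF eI pT Fp) Fp inE.
case: (F e : seq V) => //= x s' _; lia.
Qed.

End PlanarTrees.

(** * Operations as elements of a free algebra *)

Section Realization.

Variables (k : fieldType) (laws : term k nat -> term k nat -> Prop).
Hypothesis laws_linpart :
  forall l r (e : nat -> k), laws l r -> linpart e l = linpart e r.
Local Notation P := (variety_operad laws_linpart).
Local Notation freealg := (freealg laws).
Local Notation mlpart := (mlpart laws).

Section Letters.

Variable X : eqType.
Implicit Types (a b : lop P X) (s t : seq X) (x y : X).

(** The element of the free algebra on the labels which is obtained from the
    operation by replacing its variables by its labels. *)
Definition realize a : freealg X :=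
  fsubst (fun i => fvar (tnth (lop_label a) i)) (ml_val (lop_op a)).

Definition subst1 x (z : freealg X) (y : X) : freealg X :=
  if y == x then z else fvar y.

Lemma realize_linear m (f : m.-tuple X) : linear (fun x : op_sp P m => realize (@LOp k P X _ f x)).
Proof. by move=> c x y; rewrite /realize /= fsubstD fsubstZ. Qed.

Lemma realize_inj m (f : m.-tuple X) (x y : op_sp P m) : uniq f ->
  realize (@LOp k P X _ f x) = realize (@LOp k P X _ f y) -> x = y.
Proof.
move=> uf; pose g (a : X) : freealg 'I_m := xvar laws m (index a f).
have gK z : fsubst g (realize (@LOp k P X _ f z)) = ml_val z.
  rewrite fsubstA -[RHS]fsubst_id; apply: eq_fsubst => i.
  by rewrite fsubst_var /g (tnth_nth (tnth f i)) index_uniq ?size_tuple // xvar_ord.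
by move=> e; apply: val_inj; rewrite /= -gK e gK.
Qed.

Lemma lop_relabel m (f : m.-tuple X) b : perm_eq (lop_label b) f ->
  exists (s : 'S_m) (x : op_sp P m), b = @LOp k P X m [tuple tnth f (s i) | i < m] x.
Proof.
case: b => m' g x /= gf.
have mm : m' = m by have := perm_size gf; rewrite !size_tuple.
subst m'; have /tuple_permP [s gs] := gf.
by exists s, x; congr LOp; apply: val_inj.
Qed.

Lemma realize_act m (f : m.-tuple X) (s : 'S_m) (x : op_sp P m) :
  realize (@LOp k P X _ [tuple tnth f (s i) | i < m] x) =
  realize (LOp f (op_act s x) : lop P X).
Proof.
rewrite /realize /= fsubstA; apply: eq_fsubst => i.
by rewrite fsubst_var tnth_mktuple.
Qed.

Lemma realize_relabel m (f : m.-tuple X) b : perm_eq (lop_label b) f ->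
  exists y : op_sp P m, realize (@LOp k P X _ f y) = realize b.
Proof.
case/lop_relabel => s [x ->]; rewrite realize_act.
by exists (op_act s x).
Qed.

Lemma subst1_id x z a : x \notin (lop_label a : seq X) ->
  fsubst (subst1 x z) (realize a) = realize a.
Proof.
move=> xa; rewrite /realize fsubstA; apply: eq_fsubst => i.
rewrite fsubst_var /subst1; case: eqP => // e; case/negP: xa.
by rewrite -e mem_tnth.
Qed.

Lemma realize_comp a i b : uniq (lop_label a) ->
  realize (lop_comp i b) = fsubst (subst1 (tnth (lop_label a) i) (realize b)) (realize a).
Proof.
case: a i => m f x /= i uf; case: b => n g y; rewrite /realize /= !fsubstA.
have i_m := ltn_ord i.
have sz : size (take i f) = i by rewrite size_takel // size_tuple ltnW.
apply: eq_fsubst => j; rewrite fsubst_var /subst1.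
rewrite (inj_eq (elimT (tuple_uniqP _) uf)).
have x0 := tnth f i; have j_m := ltn_ord j.
case: (boolP (j == i)) => ji.
  rewrite (slot_eq _ _ ji) fsubstA; apply: eq_fsubst => c; have c_n := ltn_ord c.
  have h : (i + c < (m + n).-1)%N by lia.
  rewrite fsubst_xvar; congr fvar; rewrite !(tnth_nth x0) /=.
  by rewrite nth_cat sz ltnNge leq_addr /= addKn nth_cat size_tuple c_n.
have ji' : (j != i :> nat) by rewrite val_eqE.
rewrite (slot_neq _ _ ji) (fsubst_xvar _ (ins_var_lt (comp_arity n i) ji)).
congr fvar; rewrite !(tnth_nth x0) /= nth_cat sz /ins_var.
case: (ltnP j i) => hij; first by rewrite hij nth_take.
rewrite ifF; last lia.
rewrite nth_cat size_tuple ifF; last lia.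
rewrite nth_drop; congr nth; lia.
Qed.

(** The letter x occurs exactly once in every monomial of realize a. *)
Lemma realize_slot_linear a x c (z1 z2 : freealg X) : uniq (lop_label a) ->
  x \in (lop_label a : seq X) ->
  fsubst (subst1 x (c *: z1 + z2)) (realize a) =
  c *: fsubst (subst1 x z1) (realize a) + fsubst (subst1 x z2) (realize a).
Proof.
case: a => m f y /= uf /tnthP [i ->]; rewrite /realize /= !fsubstA.
have /mlP := ml_valP y; move: (ml_val y); apply: mlspan_linear.
- exact: fsubst_linear.
- move=> b u u'; rewrite !fsubstD !fsubstZ !scalerDr !scalerA addrACA.
  by rewrite mulrC.
move=> b /(_ i); apply: fsubst_slot_linear.
- move=> j ji; rewrite !fsubst_var /subst1 (inj_eq (elimT (tuple_uniqP _) uf)).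
  by case: eqP => // /ji.
- move=> j ji; rewrite !fsubst_var /subst1 (inj_eq (elimT (tuple_uniqP _) uf)).
  by case: eqP => // /ji.
- by rewrite !fsubst_var /subst1 eqxx.
Qed.

(** The comb (..((x_1 x_2) x_3) ..) x_m; the value at the empty list is a filler. *)
Definition lmon s : freealg X :=
  if s is x :: t then foldl (fun z y => fmul z (fvar y)) (fvar x) t else 0.

End Letters.

Definition lmagma X (x : X) (s : seq X) : magma X :=
  foldl (fun b y => Prod b (Gen y)) (Gen x) s.

Lemma leaves_lmagma X (x : X) s : leaves (lmagma x s) = x :: s.
Proof.
elim/last_ind: s => [//|s y IH]; rewrite /lmagma -cats1 foldl_cat /= -/(lmagma x s).
by rewrite IH.
Qed.

Lemma monomial_lmagma (X : eqType) (x : X) s : monomial laws (lmagma x s) = lmon (x :: s).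
Proof.
elim/last_ind: s => [//|s y IH]; rewrite /lmagma /= -cats1 !foldl_cat /= -/(lmagma x s).
by rewrite IH.
Qed.

Lemma comb_subproof m : lmon (enum 'I_m) \in ml laws m.
Proof.
case e : (enum 'I_m) => [|x s]; first exact: rpred0.
apply/mlP; rewrite -monomial_lmagma; apply: mlspan_monomial => i.
by rewrite leaves_lmagma -e count_uniq_mem ?enum_uniq // mem_enum.
Qed.

Definition comb m : mlpart m := MlPart (comb_subproof m).

Definition std (X : eqType) (s : seq X) : lop P X := 
  @LOp k P X _ (in_tuple s) (comb (size s)).

Lemma fsubst_lmon (X Y : eqType) (sigma : X -> freealg Y) x s :
  fsubst sigma (lmon (x :: s)) = foldl (fun z y => fmul z (sigma y)) (sigma x) s.
Proof.
elim/last_ind: s => [|s y IH]; first exact: fsubst_var.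
move: IH; rewrite /= -cats1 !foldl_cat /= => <-.
by rewrite fsubstM fsubst_var.
Qed.

Lemma lmon_map (X Y : eqType) (h : X -> Y) s :
  fsubst (fun x => fvar (h x)) (lmon s) = lmon (map h s).
Proof.
case: s => [|x s]; first by rewrite fsubst0.
rewrite fsubst_lmon /=.
by elim/last_ind: s => // s y IH; rewrite map_rcons -!cats1 !foldl_cat /= IH.
Qed.

Lemma realize_std (X : eqType) (s : seq X) : realize (std s) = lmon s.
Proof. by rewrite /realize lmon_map map_tnth_enum. Qed.

Lemma graft_lmon (X : eqType) (x : X) s t : t != [::] -> x \notin s ->
  fsubst (subst1 x (lmon t)) (lmon (x :: s)) = lmon (t ++ s).
Proof.
case: t => // y t _ xs; rewrite fsubst_lmon /subst1 eqxx /= foldl_cat.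
elim/last_ind: s xs => // s z IH.
rewrite mem_rcons inE negb_or => /andP[xz /IH h].
by rewrite -cats1 !foldl_cat /= h eq_sym (negbTE xz).
Qed.

End Realization.

(** * Cochains and the differential *)

Section IndexRem.

Variable X : eqType.
Implicit Types (x y : X) (s : seq X).

Lemma index_rem_neq x y s : uniq s -> x \in s -> y \in s -> x != y ->
  index y s = (index y (rem x s) + (index x s < index y s))%N.
Proof.
elim: s => // z s IH /= /andP[zs us]; rewrite !inE => xs ys xy.
case: (eqVneq z x) xs => [zx _|zx /= xs]; first by rewrite zx (negbTE xy) addn1.
case: (eqVneq z y) ys => [//|zy /= ys].
by rewrite ltnS {1}(IH us xs ys xy) addSn.
Qed.

Lemma rem_comm x y s : uniq s -> rem x (rem y s) = rem y (rem x s).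
Proof.
move=> us; rewrite !rem_filter ?filter_uniq // -!filter_predI.
by apply: eq_filter => z; rewrite /= andbC.
Qed.

End IndexRem.

Section Cochains.

Variables (k : fieldType) (laws : term k nat -> term k nat -> Prop).
Hypothesis laws_linpart :
  forall l r (e : nat -> k), laws l r -> linpart e l = linpart e r.
Local Notation P := (variety_operad laws_linpart).
Local Notation freealg := (freealg laws).
Variable n : nat.
Local Notation V := {set 'I_n}.
Implicit Types (T : {set V}) (d : V -> lop P V) (w : seq V) (e f u v x : V).
Implicit Types (c b : precochain P n).

Lemma decorates_uniq T d v : decorates T d -> v \in T -> uniq (lop_label (d v)).
Proof. by move=> dT /dT /perm_uniq ->; rewrite enum_uniq. Qed.

Lemma decorates_mem T d v x : decorates T d -> v \in T ->
  (x \in (lop_label (d v) : seq V)) = (x \in inputs T v).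
Proof. by move=> dT /dT /perm_mem ->; rewrite mem_enum. Qed.

Lemma decorates_upd T d v (b : lop P V) : decorates T d ->
  perm_eq (lop_label b) (enum (inputs T v)) -> decorates T [eta d with v |-> b].
Proof. by move=> dT hb u uT /=; case: eqP => [->|_]; [exact: hb | exact: dT]. Qed.

Lemma has_degree_tree j T : has_degree j T -> ntree T.
Proof. by case/andP. Qed.

Lemma has_degree_contract j T e : has_degree j.+1 T -> e \in iedges T ->
  has_degree j (T :\ e).
Proof.
case/andP => hT; rewrite /has_degree (cardsD1 e) => /eqP + eI.
rewrite eI add1n => -[ce]; rewrite ntree_contract //=.
by rewrite -ce /iedges setDDl setUC -setDDl.
Qed.

Lemma orders_uniq T w : orders T w -> uniq w.
Proof. by move=> /perm_uniq ->; rewrite enum_uniq. Qed.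

Lemma orders_mem T w x : orders T w -> (x \in w) = (x \in edges T).
Proof. by move=> /perm_mem ->; rewrite mem_enum. Qed.

Lemma orders_rem T w e : ntree T -> e \in iedges T -> orders T w ->
  orders (T :\ e) (rem e w).
Proof.
move=> hT eI wT; rewrite /orders uniq_perm ?enum_uniq ?rem_uniq ?(orders_uniq wT) //.
move=> x; rewrite mem_enum edges_contract // mem_rem_uniq ?(orders_uniq wT) //.
by rewrite inE /= in_setD1 (orders_mem _ wT).
Qed.

Lemma contract_nin d e v : e \notin (lop_label (d v) : seq V) -> contract e d v = d v.
Proof.
move=> ne; rewrite /contract; case: pickP => // i /eqP ei.
by case/negP: ne; rewrite -ei mem_tnth.
Qed.

Section Contract.

Variables (T : {set V}) (hT : ntree T) (d : V -> lop P V) (dT : decorates T d).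
Variables (e : V) (eI : e \in iedges T).

(** Contraction becomes substitution, also at the vertices not having e as input. *)
Lemma realize_contract v : v \in T ->
  realize (contract e d v) = fsubst (subst1 e (realize (d e))) (realize (d v)).
Proof.
move=> vT; case: (boolP (e \in (lop_label (d v) : seq V))) => ev; last first.
  by rewrite contract_nin // subst1_id.
rewrite /contract; case: pickP => [i /eqP <-|/(_ _)/eqP h].
  by rewrite realize_comp ?(decorates_uniq dT vT).
by case/tnthP: ev => i ei; case: (h i).
Qed.

Lemma decorates_contract : decorates (T :\ e) (contract e d).
Proof.
move=> v /setD1P [ve vT]; have eT := iedge_vert eI.
case: (boolP (e \in (lop_label (d v) : seq V))) => ev; last first.
  rewrite contract_nin //.
  have [p pT ep] := parent_exists hT (iedge_edge eI).
  rewrite (inputs_contract_other hT eI pT ep) //; first exact: dT.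
  by apply: contraNneq ev => ->; rewrite (decorates_mem _ dT).
rewrite /contract; case: pickP => [i /eqP ei|/(_ _)/eqP h]; last first.
  by case/tnthP: ev => i ei; case: (h i).
have ep := ev; rewrite (decorates_mem _ dT vT) in ep.
rewrite (inputs_contract_parent hT eI vT ep) /lop_comp /=.
move: (decorates_uniq dT vT) (fun x => decorates_mem x dT vT)
  (decorates_uniq dT eT) (fun x => decorates_mem x dT eT).
have is_ := ltn_ord i.
rewrite -{1 2}(cat_take_drop i (lop_label (d v))).
have := drop_nth e; move=> /(_ i (lop_label (d v))); rewrite size_tuple => /(_ is_) ->.
rewrite -tnth_nth ei cat_uniq /= => /and3P[u1 + /andP[ne u2]] mv ue me.
rewrite negb_or => /andP[ne' nh].
have me' x : x \in (lop_label (d e) : seq V) ->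
    (x \in take i (lop_label (d v))) || (x \in drop i.+1 (lop_label (d v))) = false.
  rewrite me => /(inputs_parent_disjoint hT ep); rewrite -mv mem_cat inE.
  by rewrite !negb_or => /and3P[/negbTE -> _ /negbTE ->].
apply: uniq_perm; rewrite ?enum_uniq //.
  rewrite cat_uniq u1 cat_uniq ue u2 !andbT /= has_cat negb_or nh andbT.
  apply/andP; split; apply/hasPn => x xs; apply/negP => xs'.
    by have := me' x xs; rewrite xs'.
  by have := me' x xs'; rewrite xs orbT.
move=> x; rewrite mem_enum in_setU in_setD1 -me -mv !mem_cat inE.
case: (eqVneq x e) => [->|_] /=; last by rewrite orbCA.
by rewrite (negbTE ne) (negbTE ne') orbF.
Qed.

End Contract.

(** Cochains seen as functions of the realizations of the operations at the
    vertices.  The two descriptions agree (cochain_rcochain, rcochain_cochain),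
    and this one makes no reference to labellings. *)
Record rcochain (j : nat) c : Prop := RCochain {
  rc_ext : forall T d d' w, has_degree j T -> decorates T d -> decorates T d' ->
    orders T w -> (forall v, v \in T -> realize (d v) = realize (d' v)) ->
    c T d w = c T d' w;
  rc_lin : forall T d d1 d2 w v (a : k), has_degree j T ->
    decorates T d -> decorates T d1 -> decorates T d2 -> orders T w -> v \in T ->
    (forall u, u \in T -> u != v ->
       realize (d1 u) = realize (d u) /\ realize (d2 u) = realize (d u)) ->
    realize (d v) = a *: realize (d1 v) + realize (d2 v) ->
    c T d w = a * c T d1 w + c T d2 w;
  rc_alt : forall T d w1 e f w2,
    has_degree j T -> decorates T d -> orders T (w1 ++ [:: e, f & w2]) ->
    c T d (w1 ++ [:: f, e & w2]) = - c T d (w1 ++ [:: e, f & w2]) }.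

Lemma rcochain_cochain j c : rcochain j c -> cochain j c.
Proof.
move=> [ext lin alt]; split=> //.
- move=> T d d' w hj dT wT dd'; apply: ext => //.
    by move=> v vT; rewrite -dd' //; apply: dT.
  by move=> v vT; rewrite dd'.
- move=> T d w v m f hj dT wT vT fv a x y.
  apply: (lin T _ _ _ w v) => //; try exact: decorates_upd.
    by move=> u uT /negbTE uv /=; rewrite uv.
  by rewrite /= eqxx; apply: realize_linear.
- move=> T d w v m f hj dT wT vT fv s x.
  apply: ext => //; try exact: decorates_upd.
    apply: decorates_upd => //; apply: perm_trans fv.
    by apply/tuple_permP; exists s.
  by move=> u uT /=; case: eqP => // _; apply: realize_act.
Qed.

(** Two operations with the same realization differ by a permutation of the
    labels, because an operation is determined by its realization when the
    labels are distinct. *)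
Lemma cochain_realize1 j c T d w v (b : lop P V) : cochain j c -> has_degree j T ->
  decorates T d -> orders T w -> v \in T ->
  perm_eq (lop_label b) (enum (inputs T v)) -> realize b = realize (d v) ->
  c T d w = c T [eta d with v |-> b] w.
Proof.
move=> hc hj dT wT vT bv bd; have := dT v vT.
have := cochain_local hc hj dT wT (d' := [eta d with v |-> d v]).
move=> -> => [|u _ /=]; last by case: eqP => // ->.
have := decorates_uniq dT vT.
case: (d v) bd => m f x /= bd uf fv.
have bf : perm_eq (lop_label b) f by rewrite (perm_trans bv) // perm_sym.
move: bd; have [s [y ->]] := lop_relabel bf; rewrite realize_act => /realize_inj <- //.
by rewrite (cochain_equivariant hc hj dT wT vT fv).
Qed.

Lemma cochain_rcochain j c : cochain j c -> rcochain j c.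
Proof.
move=> hc.
have ext T d d' w : has_degree j T -> decorates T d -> decorates T d' ->
    orders T w -> (forall v, v \in T -> realize (d v) = realize (d' v)) ->
    c T d w = c T d' w.
  move=> hj dT dT' wT dd'.
  (* The decoration d is changed into d' at one vertex after the other. *)
  pose mix (s : seq V) v := if v \in s then d' v else d v.
  have mixT s : decorates T (mix s) by rewrite /mix => v vT; case: ifP => _; auto.
  have step s : c T d w = c T (mix s) w.
    elim: s => [|v s ->]; first by apply: (cochain_local hc hj dT wT).
    case: (boolP (v \in T)) => vT; last first.
      apply: (cochain_local hc hj (mixT s) wT) => u uT; rewrite /mix inE.
      by case: eqP => // uv; rewrite -uv uT in vT.
    rewrite (cochain_realize1 hc hj (mixT s) wT vT (dT' v vT)); last first.
      by rewrite /mix; case: ifP => // _; rewrite dd'.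
    apply: (cochain_local hc hj _ wT) => [|u uT /=].
      by apply: decorates_upd => //; apply: dT'.
    by rewrite /mix inE; case: eqP => //= ->.
  rewrite (step (enum T)); apply: (cochain_local hc hj (mixT _) wT).
  by move=> v vT; rewrite /mix mem_enum vT.
split=> //; last exact: cochain_alternating hc.
move=> T d d1 d2 w v a hj dT dT1 dT2 wT vT du dv.
case dvE: (d v) (dT v vT) => [m f x] /= fv.
have rel d' : decorates T d' -> exists y, realize (@LOp k P V m f y) = realize (d' v).
  move=> dT'; apply: realize_relabel; apply: perm_trans (dT' v vT) _.
  by rewrite perm_sym.
have [y1 h1] := rel _ dT1; have [y2 h2] := rel _ dT2.
have upd y : decorates T [eta d with v |-> @LOp k P V m f y] by apply: decorates_upd.
rewrite (ext _ _ _ w hj dT (upd (a *: y1 + y2)) wT); last first.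
  move=> u uT /=; case: eqP => // ->; rewrite dv -h1 -h2; symmetry.
  exact: realize_linear.
rewrite (cochain_linear hc hj dT wT vT fv); congr (_ * _ + _).
  apply: ext => // u uT /=; case: eqP => [->//|/eqP uv].
  by have [-> _] := du u uT uv.
apply: ext => // u uT /=; case: eqP => [->//|/eqP uv].
by have [_ ->] := du u uT uv.
Qed.

Lemma rcochain_sub j c b : rcochain j c -> rcochain j b ->
  rcochain j (fun T d w => c T d w - b T d w).
Proof.
move=> [e1 l1 a1] [e2 l2 a2]; split.
- by move=> T d d' w hj h1 h2 wT dd; rewrite (e1 T d d') // (e2 T d d').
- move=> T d d1 d2 w v a hj h h1 h2 wT vT du dv.
  rewrite (l1 T d d1 d2 w v a) // (l2 T d d1 d2 w v a) // mulrBr.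
  by rewrite opprD addrACA.
- by move=> T d w1 e f w2 hj dT wT; rewrite a1 // a2 // opprD.
Qed.

Lemma rcochain_add j c b : rcochain j c -> rcochain j b ->
  rcochain j (fun T d w => c T d w + b T d w).
Proof.
move=> [e1 l1 a1] [e2 l2 a2]; split.
- by move=> T d d' w hj h1 h2 wT dd; rewrite (e1 T d d') // (e2 T d d').
- move=> T d d1 d2 w v a hj h h1 h2 wT vT du dv.
  rewrite (l1 T d d1 d2 w v a) // (l2 T d d1 d2 w v a) // mulrDr.
  by rewrite addrACA.
- by move=> T d w1 e f w2 hj dT wT; rewrite a1 // a2 // opprD.
Qed.

Lemma rcochain0 j : rcochain j (fun _ _ _ => 0).
Proof. by split=> *; rewrite ?mulr0 ?addr0 ?oppr0. Qed.

Lemma rc_alt_head j c T d e w1 w2 : rcochain j c -> has_degree j T ->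
  decorates T d -> orders T (w1 ++ e :: w2) ->
  c T d (e :: w1 ++ w2) = (-1) ^+ size w1 * c T d (w1 ++ e :: w2).
Proof.
move=> hc hj dT; elim/last_ind: w1 w2 => [|w1 f IH] w2 wT; first by rewrite mul1r.
rewrite size_rcons exprS mulN1r mulNr cat_rcons IH; last first.
  apply: perm_trans wT; rewrite cat_rcons perm_cat2l.
  exact: (permEl (perm_catCA [:: e] [:: f] w2)).
rewrite cat_rcons (rc_alt hc hj dT) ?mulrN //.
by rewrite -cat_rcons.
Qed.

Lemma rc_alt_rem j c T d e w : rcochain j c -> has_degree j T ->
  decorates T d -> orders T w -> e \in w ->
  c T d (e :: rem e w) = (-1) ^+ index e w * c T d w.
Proof.
move=> hc hj dT wT ew; have uw := orders_uniq wT; move: uw wT.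
case/splitPr: ew => w1 w2 uw wT.
have ne : e \notin w1.
  by move: uw; rewrite cat_uniq /= => /and3P[_]; rewrite negb_or => /andP[].
rewrite index_cat (negbTE ne) /= eqxx addn0 -(rc_alt_head hc) //.
congr (c T d (_ :: _)); elim: w1 ne {wT uw} => /= [|x w1 IH]; first by rewrite eqxx.
by rewrite inE negb_or eq_sym => /andP[/negbTE -> /IH ->].
Qed.

Lemma differential_rcochain j c : rcochain j c -> rcochain j.+1 (differential c).
Proof.
move=> hc; split.
- move=> T d d' w hj dT dT' wT dd'; have hT := has_degree_tree hj.
  apply: eq_bigr => e eI; congr (_ * _).
  apply: (rc_ext hc); [exact: has_degree_contract | exact: decorates_contract
    | exact: decorates_contract | exact: orders_rem |].
  move=> v /setD1P [_ vT]; rewrite (realize_contract dT) // (realize_contract dT') //.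
  by rewrite (dd' v vT) (dd' e (iedge_vert eI)).
- move=> T d d1 d2 w v a hj dT dT1 dT2 wT vT du dv; have hT := has_degree_tree hj.
  rewrite /differential mulr_sumr -big_split; apply: eq_bigr => e eI /=.
  have eT := iedge_vert eI.
  rewrite mulrCA -mulrDr; congr (_ * _).
  have lin := rc_lin hc (has_degree_contract hj eI) (decorates_contract hT dT eI)
    (decorates_contract hT dT1 eI) (decorates_contract hT dT2 eI) (orders_rem hT eI wT).
  case: (eqVneq v e) => [ve|ve].
    have [p pT ep] := parent_exists hT (iedge_edge eI).
    have pe := contract_neq ep; have pv : p != v by rewrite ve.
    apply: (lin p); first by rewrite in_setD1 pe.
      move=> u /setD1P [ue uT] up; rewrite (realize_contract dT) // (realize_contract dT1) //
        (realize_contract dT2) //.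
      have uv : u != v by rewrite ve.
      have eu : e \notin inputs T u.
        by apply: contra up => eu; apply/eqP/(parent_uniq hT uT pT eu ep).
      by rewrite !subst1_id ?(decorates_mem _ _ uT) //; apply: du.
    rewrite (realize_contract dT) // (realize_contract dT1) //
      (realize_contract dT2) //; have [-> ->] := du p pT pv.
    rewrite -ve dv; apply: realize_slot_linear; first exact: decorates_uniq dT pT.
    by rewrite (decorates_mem _ dT) ?ve.
  have ev : e != v by rewrite eq_sym.
  have [e1 e2] := du e eT ev.
  apply: (lin v); first by rewrite in_setD1 ve.
    move=> u /setD1P [ue uT] uv; rewrite (realize_contract dT) // (realize_contract dT1) //
      (realize_contract dT2) // e1 e2.
    by have [-> ->] := du u uT uv.
  by rewrite (realize_contract dT) // (realize_contract dT1) //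
    (realize_contract dT2) // dv e1 e2 fsubstD fsubstZ.
- move=> T d w1 e f w2 hj dT wT; have hT := has_degree_tree hj.
  have /[dup] uw := orders_uniq wT.
  rewrite cat_uniq /= !inE !negb_or => /and5P[_ /and3P[ew fw _] /andP[ef _] _ _].
  rewrite /differential -sumrN; apply: eq_bigr => g gI.
  have rem_cat s1 s2 : g \notin s1 -> rem g (s1 ++ s2) = s1 ++ rem g s2.
    elim: s1 => //= x s1 IH; rewrite inE negb_or eq_sym => /andP[/negbTE -> /IH ->] //.
  have rem_cat' s1 s2 : g \in s1 -> rem g (s1 ++ s2) = rem g s1 ++ s2.
    by elim: s1 => //= x s1 IH; rewrite inE eq_sym; case: eqP => //= _ /IH ->.
  have hg := has_degree_contract hj gI; have dg := decorates_contract hT dT gI.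
  have := orders_rem hT gI wT.
  case: (boolP (g \in w1)) => gw.
    rewrite !index_cat gw !rem_cat' // => og.
    by rewrite (rc_alt hc hg dg og) mulrN.
  rewrite !index_cat (negbTE gw) !rem_cat //= => og.
  case: (eqVneq e g) og => [eg|eg].
    rewrite -eg [f == e]eq_sym (negbTE ef) => og.
    by rewrite addn0 addn1 exprS mulN1r mulNr.
  case: (eqVneq f g) => [fg|fg] og.
    by rewrite addn0 addn1 exprS mulN1r mulNr opprK.
  by rewrite (rc_alt hc hg dg og) mulrN.
Qed.

Hypothesis char0 : [pchar k] =i pred0.

(** Contracting e and f in either order gives the same realizations, since e and f
    cannot be inputs of each other, while exchanging e and f in the exterior
    product changes the sign. *)
Lemma differential2 j c T d w : rcochain j c -> has_degree j.+2 T ->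
  decorates T d -> orders T w -> differential (differential c) T d w = 0.
Proof.
move=> hc hj dT wT; have hT := has_degree_tree hj.
(* The double sum over e and f is antisymmetric in e and f. *)
pose A e f := (-1) ^+ index e w * ((-1) ^+ index f (rem e w) *
  c (T :\ e :\ f) (contract f (contract e d)) (rem f (rem e w))).
have -> : differential (differential c) T d w =
    \sum_(e in iedges T) \sum_(f in iedges T | f != e) A e f.
  apply: eq_bigr => e eI; rewrite mulr_sumr; apply: eq_bigl => f.
  by rewrite !in_setD1 andbCA andbC.
have anti e f : e \in iedges T -> f \in iedges T -> f != e -> A f e = - A e f.
  move=> eI fI fe; have ef : e != f by rewrite eq_sym.
  have ew : e \in w by rewrite (orders_mem _ wT) iedge_edge.
  have fw : f \in w by rewrite (orders_mem _ wT) iedge_edge.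
  have uw := orders_uniq wT.
  have eI' : e \in iedges (T :\ f) by move: eI; rewrite !in_setD1 ef.
  have fI' : f \in iedges (T :\ e) by move: fI; rewrite !in_setD1 fe.
  have he := has_degree_contract hj eI; have hf := has_degree_contract hj fI.
  have hTe := has_degree_tree he; have hTf := has_degree_tree hf.
  have de := decorates_contract hT dT eI; have df := decorates_contract hT dT fI.
  have wE : T :\ f :\ e = T :\ e :\ f by rewrite !setDDl setUC.
  have cE : c (T :\ f :\ e) (contract e (contract f d)) (rem e (rem f w))
          = c (T :\ e :\ f) (contract f (contract e d)) (rem f (rem e w)).
    rewrite rem_comm // wE; apply: (rc_ext hc).
    - exact: has_degree_contract.
    - by rewrite -wE; apply: decorates_contract.
    - exact: decorates_contract.
    - exact/orders_rem/orders_rem.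
    move=> v; rewrite !in_setD1 => /and3P[vf ve vT].
    have eT := iedge_vert eI; have fT := iedge_vert fI.
    have vTe : v \in T :\ e by rewrite in_setD1 ve.
    have vTf : v \in T :\ f by rewrite in_setD1 vf.
    have eTf : e \in T :\ f by rewrite in_setD1 ef.
    have fTe : f \in T :\ e by rewrite in_setD1 fe.
    rewrite (realize_contract df) // (realize_contract de) //.
    rewrite !(realize_contract dT) // [LHS]fsubstA [RHS]fsubstA.
    apply: eq_fsubst => x; rewrite /subst1.
    (* One of the two substitutions does not involve the other letter. *)
    have nest : (e \notin inputs T f) || (f \notin inputs T e).
      apply/norP => -[/negPn /inputsP [_ h1 _] /negPn /inputsP [_ h2 _]].
      by have := proper_trans h1 h2; rewrite properxx.
    have sub1 g z u : g \notin inputs T u -> u \in T ->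
        fsubst (subst1 g z) (realize (d u)) = realize (d u).
      by move=> gu uT; apply: subst1_id; rewrite (decorates_mem _ dT).
    case: (eqVneq x f) => [->|xf].
      rewrite (negbTE fe) fsubst_var /subst1 eqxx.
      case/orP: nest => nst; first by rewrite !(sub1 e) // .
      by rewrite (sub1 f _ e).
    case: (eqVneq x e) => [->|xe].
      rewrite fsubst_var /subst1 eqxx.
      case/orP: nest => nst; first by rewrite (sub1 e _ f).
      by rewrite !(sub1 f).
    by rewrite !fsubst_var /subst1 (negbTE xe) (negbTE xf).
  rewrite /A cE !mulrA -!exprD -mulNr; congr (_ * _).
  have ie : index e w != index f w.
    apply: contraNneq fe => h; apply/eqP.
    by have := congr1 (nth e w) h; rewrite !nth_index.
  have := index_rem_neq uw fw ew fe; have := index_rem_neq uw ew fw ef.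
  case: (ltngtP (index e w) (index f w)) ie => // _ _ -> ->.
    by rewrite addn0 addn1 addSn addnC exprS mulN1r.
  by rewrite addn0 addn1 addSn addnC exprS mulN1r opprK.
set S := (\sum_(e in _) _).
have : S = - S.
  rewrite {1}/S (exchange_big_dep (mem (iedges T))) /=; last by move=> e f _ /andP[].
  rewrite /S -sumrN; apply: eq_bigr => e eI; rewrite -sumrN.
  apply: eq_big => [f|f /and3P[fI _ fe]].
    by rewrite eI eq_sym.
  by apply: anti; rewrite // eq_sym.
(* From S = - S to S = 0, since 2 is not zero in k. *)
move/eqP; rewrite -addr_eq0 -mulr2n -mulr_natl mulf_eq0 => /orP[|/eqP //].
by have := (pcharf0P k).1 char0 2%N => ->.
Qed.

End Cochains.

(** * Exactness from a basis of combs *)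

Lemma leaves_map (X Y : Type) (h : X -> Y) (a : magma X) :
  leaves (mbind (fun x => Gen (h x)) a) = map h (leaves a).
Proof. by elim: a => //= a -> b ->; rewrite map_cat. Qed.

Section CombSpan.

Variables (k : fieldType) (laws : term k nat -> term k nat -> Prop) (X : eqType).
Implicit Types (Q : pred (seq X)) (x y : freealg laws X).

Inductive comb_span Q : freealg laws X -> Prop :=
| comb_span0 : comb_span Q 0
| comb_span_step (a : k) g x : Q g -> comb_span Q x -> comb_span Q (a *: lmon laws g + x).

Lemma comb_span_lmon Q g : Q g -> comb_span Q (lmon laws g).
Proof.
move=> Qg; rewrite -[lmon _ _]scale1r -[_ *: _]addr0.
by apply: comb_span_step => //; apply: comb_span0.
Qed.

Lemma comb_spanD Q x y : comb_span Q x -> comb_span Q y -> comb_span Q (x + y).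
Proof. by elim=> [|a g z Qg _ IH] hy; rewrite ?add0r // -addrA; constructor; auto. Qed.

Lemma comb_spanZ Q a x : comb_span Q x -> comb_span Q (a *: x).
Proof.
elim=> [|b g z Qg _ IH]; first by rewrite scaler0; constructor.
by rewrite scalerDr scalerA; constructor.
Qed.

Lemma comb_span_sub Q Q' x : (forall g, Q g -> Q' g) -> comb_span Q x -> comb_span Q' x.
Proof. by move=> QQ; elim=> *; constructor; auto. Qed.

End CombSpan.

(** The hypotheses say that the combs with allowed order form a basis with
    coordinate functions coef (coef_comb, monomial_span), that contraction at a
    first input respects it (allowed_cat), and that the combs which occur when a
    comb t is substituted for another letter have smaller rank: coef_contract is
    the inequality of ranks, in the form provided by rank_contract. *)
Section PBW.

Variables (k : fieldType) (laws : term k nat -> term k nat -> Prop).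
Hypothesis laws_linpart :
  forall l r (e : nat -> k), laws l r -> linpart e l = linpart e r.
Local Notation P := (variety_operad laws_linpart).
Local Notation freealg := (freealg laws).
Local Notation lmon := (lmon laws).
Local Notation std := (std laws_linpart).
Variable n : nat.
Local Notation V := {set 'I_n}.
Implicit Types (T : {set V}) (d : V -> lop P V) (w s t g : seq V) (e f u v x : V).
Implicit Types (c b : precochain P n) (F G : plan n).

Variables (allowed : pred (seq V)) (coef : seq V -> freealg V -> k) (phi : V -> nat).

Hypothesis coef_linear : forall g a (x y : freealg V),
  coef g (a *: x + y) = a * coef g x + coef g y.
Hypothesis coef_comb : forall s t, s != [::] -> blocks s -> perm_eq s t ->
  allowed s -> allowed t ->
  coef s (lmon t) = (s == t)%:R.
Hypothesis monomial_span : forall a : magma V, blocks (leaves a) ->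
  comb_span (fun g => allowed g && perm_eq g (leaves a)) (monomial laws a).
Hypothesis allowed_cat : forall s t, s != [::] -> blocks (s ++ t) ->
  allowed (s ++ t) = allowed s && allowed (join s :: t).
Hypothesis coef_contract : forall s1 s2 t g, s1 != [::] -> (1 < size t)%N ->
  blocks (s1 ++ join t :: s2) -> allowed (s1 ++ join t :: s2) ->
  blocks t -> allowed t -> blocks g -> allowed g -> perm_eq g (s1 ++ t ++ s2) ->
  coef g (fsubst (subst1 (join t) (lmon t)) (lmon (s1 ++ join t :: s2))) != 0 ->
  (phi (head set0 t) + phi (head set0 s1) < phi (join t) + phi (head set0 g))%N.

Local Notation planar := (planar allowed).
Local Notation rank := (rank phi).

Lemma coef0 g : coef g 0 = 0.
Proof.
by have := coef_linear g (-1) 0 0; rewrite scaler0 addr0 mulN1r addNr.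
Qed.

Lemma comb_span_coef s (x : freealg V) : s != [::] -> blocks s ->
  comb_span (fun g => allowed g && perm_eq g s) x ->
  x = \sum_(g <- permutations s | allowed g) coef g x *: lmon g.
Proof.
move=> s0 bs.
have nz g : perm_eq g s -> g != [::].
  by move=> /perm_size gs; rewrite -size_eq0 gs size_eq0.
elim=> [|a h y /andP[ah hs] _ IH].
  by rewrite big1 // => g _; rewrite coef0 scale0r.
have hp : h \in permutations s by rewrite mem_permutations.
under eq_bigr do rewrite coef_linear scalerDl -scalerA.
rewrite big_split /= -IH -scaler_sumr; congr (_ *: _ + _).
rewrite big_mkcond (bigD1_seq h) ?permutations_uniq //= ah.
rewrite coef_comb ?eqxx ?scale1r ?nz //; last by apply: perm_blocks bs; rewrite perm_sym.
rewrite big_seq_cond big1 ?addr0 // => g /andP[gp gh]; case: ifP => // ag.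
move: gp; rewrite mem_permutations => gs.
rewrite coef_comb ?(negbTE gh) ?scale0r ?nz //.
  by apply: perm_blocks bs; rewrite perm_sym.
by rewrite (perm_trans gs) // perm_sym.
Qed.

Lemma realize_span (a : lop P V) s : perm_eq (lop_label a) s -> blocks s ->
  comb_span (fun g => allowed g && perm_eq g s) (realize a).
Proof.
case: a => m f x /= fs bs; rewrite /realize /=.
have /mlP := ml_valP x; elim=> [b hb||y z _ hy _ hz|a y _ hy].
- rewrite (@fsubst_mbind _ _ _ _ _ (fun i => Gen (tnth f i))) //.
  have ps : perm_eq (leaves (mbind (fun i => Gen (tnth f i)) b)) s.
    rewrite leaves_map; apply: perm_trans fs; rewrite -[X in perm_eq _ X](map_tnth_enum f).
    apply: perm_map; apply/allP => i _ /=; rewrite hb.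
    by rewrite count_uniq_mem ?enum_uniq // mem_enum.
  apply: (comb_span_sub _ (monomial_span _)); last by apply: perm_blocks bs; rewrite perm_sym.
  by move=> g /andP[-> /perm_trans]; apply.
- by rewrite fsubst0; apply: comb_span0.
- by rewrite fsubstD; apply: comb_spanD.
- by rewrite fsubstZ; apply: comb_spanZ.
Qed.

Lemma std_label s : lop_label (std s) = s :> seq V. Proof. by []. Qed.

Lemma rc_sum j c T w v (r : seq (seq V)) (a : seq V -> k) d : rcochain j c ->
  has_degree j T -> orders T w -> v \in T -> decorates T d ->
  (forall g, g \in r -> perm_eq g (enum (inputs T v))) ->
  realize (d v) = \sum_(g <- r) a g *: lmon g ->
  c T d w = \sum_(g <- r) a g * c T [eta d with v |-> std g] w.
Proof.
move=> hc hj wT vT; elim: r d => [|g r IH] d dT hr dv.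
  rewrite big_nil in dv *.
  (* A linear form vanishes at 0: apply linearity to 0 = -1 *: 0 + 0. *)
  have dvE : realize (d v) = -1 *: realize (d v) + realize (d v).
    by rewrite dv scaler0 addr0.
  have := rc_lin hc hj dT dT dT wT vT (fun u _ _ => conj erefl erefl) dvE.
  by rewrite mulN1r addNr big_nil.
rewrite big_cons in dv; rewrite big_cons.
have gT : perm_eq g (enum (inputs T v)) by apply: hr; rewrite inE eqxx.
have [z [zT zE]] : exists z : lop P V, perm_eq (lop_label z) (enum (inputs T v)) /\
    realize z = \sum_(g <- r) a g *: lmon g.
  have fT := dT v vT; move: dv fT; case: (d v) => m f x /= dv fT.
  have [|y hy] := @realize_relabel _ _ laws_linpart _ m f (std g).
    by rewrite (perm_trans gT) // perm_sym.
  exists (@LOp k P V m f (- a g *: y + x)); split=> //.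
  rewrite (realize_linear (laws_linpart := laws_linpart) f (- a g) y x) hy dv.
  by rewrite realize_std addrA scaleNr addNr add0r.
have zD : decorates T [eta d with v |-> z] by apply: decorates_upd.
have gD : decorates T [eta d with v |-> std g] by apply: decorates_upd.
have off u : u \in T -> u != v ->
    realize ([eta d with v |-> std g] u) = realize (d u) /\
    realize ([eta d with v |-> z] u) = realize (d u).
  by move=> uT /negbTE uv /=; rewrite uv.
rewrite (rc_lin hc hj dT gD zD wT vT (a := a g) off); last first.
  by rewrite /= eqxx realize_std zE.
congr (_ + _); rewrite (IH _ zD); last by rewrite /= eqxx.
  rewrite !big_seq; apply: eq_bigr => h hin; congr (_ * _).
  have hT : perm_eq h (enum (inputs T v)) by apply: hr; rewrite inE hin orbT.
  apply: (rc_ext hc) => //.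
  - exact: decorates_upd.
  - exact: decorates_upd.
  by move=> u uT /=; case: eqP.
by move=> h hin; apply: hr; rewrite inE hin orbT.
Qed.

(** Multilinearity in the operation at v, written in the basis of combs. *)
Lemma rc_expand j c T w v d : rcochain j c ->
  has_degree j T -> orders T w -> v \in T -> decorates T d ->
  c T d w = \sum_(g <- permutations (enum (inputs T v)) | allowed g)
              coef g (realize (d v)) * c T [eta d with v |-> std g] w.
Proof.
move=> hc hj wT vT dT; rewrite -big_filter.
apply: (rc_sum (a := fun g => coef g (realize (d v))) hc) => //.
  by move=> g; rewrite mem_filter mem_permutations => /andP[].
have bT : blocks (enum (inputs T v)).
  exact: (blocks_inputs (has_degree_tree hj) (perm_refl _)).
have T0 : enum (inputs T v) != [::].
  by have := inputs_gt1 (has_degree_tree hj) vT (perm_refl _); case: (enum _).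
by rewrite big_filter; apply: comb_span_coef => //; apply: realize_span => //; apply: dT.
Qed.

Definition comb_decor F v : lop P V := std (F v).

Lemma decorates_comb_decor F : planar F -> decorates (shape F) (comb_decor F).
Proof. by move=> hF v vT; apply: (planar_perm hF vT). Qed.

(** The operations at the vertices are replaced by combs one vertex after the
    other; s lists the vertices still to be treated. *)
Lemma rc_vanish j c T w : rcochain j c -> has_degree j T -> orders T w ->
  (forall F, planar F -> shape F = T -> c T (comb_decor F) w = 0) ->
  forall d, decorates T d -> c T d w = 0.
Proof.
move=> hc hj wT h0.
suff vs s d : decorates T d ->
    (forall v, v \in T -> v \notin s -> exists2 g, d v = std g & allowed g) ->
    c T d w = 0.
  by move=> d dT; apply: (vs (enum T)) => // v vT; rewrite mem_enum vT.
elim: s d => [|v s IH] d dT hd.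
  have hT := has_degree_tree hj.
  pose F : plan n := mkplan (fun v => if v \in T then lop_label (d v) : seq V else [::]).
  have FE v : F v = (if v \in T then lop_label (d v) : seq V else [::]) :> seq V.
    by apply: mkplanE; case: ifP => // vT; apply: decorates_uniq dT vT.
  have shF : shape F = T.
    apply/setP => v; rewrite inE FE; case: ifP => // vT.
    by have := inputs_gt1 hT vT (dT v vT); case: (tval _).
  have hF : planar F.
    split; rewrite shF // => v vT; rewrite FE vT; split; first exact: dT.
    by have [//|g -> ag] := hd v vT; rewrite std_label.
  rewrite -(h0 F hF shF); apply: (rc_ext hc) => //; first by rewrite -shF; apply: decorates_comb_decor.
  move=> v vT; rewrite /comb_decor FE vT; have [//|g -> _] := hd v vT.
  by rewrite std_label.
case: (boolP (v \in T)) => vT; last first.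
  apply: IH => // u uT us; apply: hd => //; rewrite inE negb_or us andbT.
  by apply: contraNneq vT => <-.
rewrite (rc_expand hc hj wT vT dT) big_seq_cond big1 // => g /andP[].
rewrite mem_permutations => gT ag; rewrite IH ?mulr0 //.
  exact: decorates_upd.
move=> u uT us /=; case: eqP => [_|uv]; first by exists g.
by apply: hd => //; rewrite inE negb_or us andbT; apply/eqP.
Qed.

(** The cochain with prescribed values y on the cells, see extend_comb_decor. *)
Definition extend (y : plan n -> seq V -> k) : precochain P n := fun T d w =>
  \sum_(F : plan n | `[< planar F >] && (shape F == T))
    y F w * \prod_(v in T) coef (F v) (realize (d v)).

Lemma extend_rcochain j y :
  (forall F w1 e f w2, planar F -> has_degree j (shape F) ->
     orders (shape F) (w1 ++ [:: e, f & w2]) ->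
     y F (w1 ++ [:: f, e & w2]) = - y F (w1 ++ [:: e, f & w2])) ->
  rcochain j (extend y).
Proof.
move=> alt; split.
- move=> T d d' w hj dT dT' wT dd'; apply: eq_bigr => F _; congr (_ * _).
  by apply: eq_bigr => v vT; rewrite dd'.
- move=> T d d1 d2 w v a hj dT dT1 dT2 wT vT du dv.
  rewrite /extend mulr_sumr -big_split; apply: eq_bigr => F _ /=.
  rewrite (bigD1 v) // [in X in _ = X + _](bigD1 v) // [in X in _ = _ + X](bigD1 v) //=.
  rewrite dv coef_linear.
  set p := \prod_(i in T | i != v) coef (F i) (realize (d i)).
  have -> : \prod_(i in T | i != v) coef (F i) (realize (d1 i)) = p.
    by apply: eq_bigr => u /andP[uT uv]; have [-> _] := du u uT uv.
  have -> : \prod_(i in T | i != v) coef (F i) (realize (d2 i)) = p.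
    by apply: eq_bigr => u /andP[uT uv]; have [_ ->] := du u uT uv.
  by rewrite mulrDl mulrDr -!mulrA [X in X + _]mulrCA.
- move=> T d w1 e f w2 hj dT wT; rewrite -sumrN; apply: eq_bigr => F.
  by move=> /andP[/asboolP hF /eqP shF]; rewrite alt ?shF // mulNr.
Qed.

Lemma extend_comb_decor y F w : planar F -> extend y (shape F) (comb_decor F) w = y F w.
Proof.
move=> hF; rewrite /extend (bigD1 F) /=; last first.
  by rewrite eqxx andbT; apply/asboolP.
rewrite [X in _ * X]big1 ?mulr1 => [|v vT]; last first.
  have Fv : (F v : seq V) != [::] by move: vT; rewrite inE.
  rewrite realize_std coef_comb ?eqxx //; first exact: (planar_blocks hF _).
    exact: (planar_allowed hF vT).
  exact: (planar_allowed hF vT).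
rewrite big1 ?addr0 // => G /andP[/andP[/asboolP hG /eqP shG] GF].
have [v vT Gv] : exists2 v, v \in shape F & G v != F v :> seq V.
  apply/exists_inP; apply: contraNT GF; rewrite negb_exists_in => /forall_inP h.
  apply/eqP/plan_eq => v; case: (boolP (v \in shape F)) => vT.
    by apply/eqP; have := h v vT; rewrite negbK.
  by rewrite !shapePn ?shG.
have Gv0 : (G v : seq V) != [::] by move: vT; rewrite -shG inE.
rewrite (bigD1 v) //= realize_std coef_comb ?(negbTE Gv) ?mul0r ?mulr0 //.
- exact: (planar_blocks hG _).
- apply: perm_trans (planar_perm hG _) _; rewrite shG // perm_sym.
  exact: (planar_perm hF vT).
- by apply: (planar_allowed hG); rewrite shG.
- exact: (planar_allowed hF vT).
Qed.

Section ContractStd.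

Variables (j : nat) (c : precochain P n) (F : plan n) (e p : V) (w : seq V).
Hypotheses (hc : rcochain j c) (hF : planar F) (hj : has_degree j.+1 (shape F)).
Hypotheses (eI : e \in iedges (shape F)) (pT : p \in shape F).
Hypothesis wT : orders (shape F :\ e) w.

Let hT := planar_tree hF.
Let sdT := decorates_comb_decor hF.

Lemma contract_head_edge s : F p = e :: s :> seq V ->
  c (shape F :\ e) (contract e (comb_decor F)) w =
  c (shape (graft e F)) (comb_decor (graft e F)) w.
Proof.
move=> Fp; rewrite (shape_graft hF eI pT Fp).
have hG := planar_graft allowed_cat hF eI pT Fp.
apply: (rc_ext hc) => //.
- exact: has_degree_contract.
- exact: decorates_contract.
- by rewrite -(shape_graft hF eI pT Fp); apply: decorates_comb_decor.
move=> v /setD1P [ve vT]; rewrite (realize_contract sdT) // /comb_decor !realize_std.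
rewrite (graftE hF eI pT Fp) (negbTE ve); case: (eqVneq v p) => [->|vp].
  rewrite Fp graft_lmon //; first by have := iedge_vert eI; rewrite inE.
  by have := planar_uniq hF p; rewrite Fp => /andP[].
rewrite -(realize_std laws_linpart (F v)) subst1_id // std_label (planar_mem hF) //.
have ein : e \in inputs (shape F) p by rewrite -(planar_mem hF _ pT) Fp in_cons eqxx.
by apply: contra vp => ev; apply/eqP/(parent_uniq hT vT pT ev ein).
Qed.

(** The contracted operation at p is expanded in combs by rc_expand; those with
    nonzero coefficient give cells of smaller rank by coef_contract. *)
Lemma contract_tail_edge s1 s2 : s1 != [::] -> F p = s1 ++ e :: s2 :> seq V ->
  (forall G, planar G -> shape G = shape F :\ e -> (rank G < rank F)%N ->
     c (shape G) (comb_decor G) w = 0) ->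
  c (shape F :\ e) (contract e (comb_decor F)) w = 0.
Proof.
move=> s10 Fp h0.
have eT := iedge_vert eI.
have ein : e \in inputs (shape F) p.
  by rewrite -(planar_mem hF _ pT) Fp mem_cat in_cons eqxx orbT.
have pe := contract_neq ein.
have pT' : p \in shape F :\ e by rewrite in_setD1 pe.
have hjc := has_degree_contract hj eI.
have hTc := has_degree_tree hjc.
have dc := decorates_contract hT sdT eI.
have lab : lop_label (contract e (comb_decor F) p) = s1 ++ F e ++ s2 :> seq V.
  rewrite /contract; case: pickP => [i|/(_ _)/eqP h]; last first.
    have : e \in (lop_label (comb_decor F p) : seq V) by rewrite std_label (planar_mem hF).
    by case/tnthP => i ei; case: (h i).
  rewrite (tnth_nth e) /= => /eqP ie; move: (planar_uniq hF p).
  have : (i < size (F p))%N by case: i {ie}.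
  move: ie; move: (nat_of_ord i) => m; rewrite Fp => mE msz us.
  have -> : m = size s1.
    have := index_uniq e msz us; rewrite mE index_cat /= eqxx addn0 => <-.
    by move: us; rewrite cat_uniq /= negb_or => /and3P[_ /andP[/negbTE -> _]].
  by rewrite take_size_cat // -cat_rcons drop_size_cat ?size_rcons.
rewrite (rc_expand hc hjc wT pT' dc) big_seq_cond big1 // => g /andP[].
rewrite mem_permutations => gT ag.
case: (eqVneq (coef g (realize (contract e (comb_decor F) p))) 0) => [->|nz]; first by rewrite mul0r.
pose G : plan n := mkplan (fun v => if v == e then [::] else
  if v == p then g else F v : seq V).
have GE v : G v = (if v == e then [::] else if v == p then g else F v : seq V) :> seq V.
  apply: mkplanE; case: eqP => // _; case: eqP => // _; last exact: (planar_uniq hF _).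
  by rewrite (perm_uniq gT) enum_uniq.
have Gp : G p = g :> seq V by rewrite GE (negbTE pe) eqxx.
have shG : shape G = shape F :\ e.
  apply/setP => v; rewrite in_setD1 !inE GE.
  case: (eqVneq v e) => //= ve; case: (eqVneq v p) => [->|//].
  have := inputs_gt1 hTc pT' gT; move: pT; rewrite inE => ->.
  by case: (g).
have hG : planar G.
  split; rewrite shG // => v /setD1P [ve vT]; rewrite GE (negbTE ve).
  case: (eqVneq v p) => [->//|vp]; rewrite (inputs_contract_other hT eI pT ein) //.
  by split; [apply: (planar_perm hF vT) | apply: (planar_allowed hF vT)].
have je : join (F e) = e := planar_join hF eT.
have GF v : v != e -> v != p -> G v = F v :> seq V.
  by move=> /negbTE ve /negbTE vp; rewrite GE ve vp.
have lt : (rank G < rank F)%N.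
  have := rank_contract phi hF hG eI pT ein shG GF; rewrite Gp Fp.
  have -> : head set0 (s1 ++ e :: s2) = head set0 s1 by case: (s1) s10.
  have := @coef_contract s1 s2 (F e) g s10 (planar_size hF eT).
  rewrite je -Fp => /(_ (planar_blocks hF _) (planar_allowed hF pT)).
  move=> /(_ (planar_blocks hF _) (planar_allowed hF eT)).
  move=> /(_ (blocks_inputs hTc gT) ag).
  have -> : perm_eq g (s1 ++ F e ++ s2).
    by rewrite (perm_trans gT) // perm_sym -lab; apply: dc.
  move: nz; rewrite (realize_contract sdT) // /comb_decor.
  rewrite !realize_std => nz /(_ isT nz); clear; lia.
rewrite -[RHS](mulr0 (coef g (realize (contract e (comb_decor F) p)))); congr (_ * _).
rewrite -(h0 G hG shG lt) shG; apply: (rc_ext hc) => //.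
- exact: decorates_upd.
- by rewrite -shG; apply: decorates_comb_decor.
move=> v /setD1P [ve vT] /=; rewrite /comb_decor GE (negbTE ve); case: (eqVneq v p) => // vp.
rewrite (realize_contract sdT) // subst1_id // std_label (planar_mem hF) //.
by apply: contra vp => ev; apply/eqP/(parent_uniq hT vT pT ev ein).
Qed.

End ContractStd.

Lemma edge_cases F e : planar F -> e \in iedges (shape F) ->
  exists2 p, p \in shape F & (exists s, F p = e :: s :> seq V) \/
    exists s1 s2, s1 != [::] /\ F p = s1 ++ e :: s2 :> seq V.
Proof.
move=> hF eI; have [p pT ep] := parent_exists (planar_tree hF) (iedge_edge eI).
exists p => //; rewrite -(planar_mem hF _ pT) in ep; case/splitPr: ep => s1 s2.
by case: s1 => [|x s1]; [left; exists s2 | right; exists (x :: s1), s2].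
Qed.

(** The chosen mark.  It depends on F through the set of marks only. *)
Definition mark F := [pick R in marks F].

Definition mark_cut F := if mark F is Some r then r \in shape F else false.

Lemma mark_cases F j : planar F -> has_degree j (shape F) -> (j < n - 2)%N ->
  exists2 r, mark F = Some r & r \in marks F.
Proof.
move=> hF /andP[_ /eqP hj] jn; rewrite /mark; case: pickP => [r rF|h]; first by exists r.
have m0 : marks F = set0 by apply/setP => r; rewrite in_set0; apply: h.
by have := marks_eq0 hF m0; rewrite hj; lia.
Qed.

Lemma mark_graft F e p s : planar F -> e \in iedges (shape F) -> p \in shape F ->
  F p = e :: s :> seq V -> mark (graft e F) = mark F.
Proof.
by move=> hF eI pT Fp; apply: eq_pick => R; rewrite (marks_graft hF eI pT Fp).
Qed.

(** G is obtained from F by cutting at r. *)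
Definition flip r F G := [/\ planar G, r \in iedges (shape G),
  exists p s, p \in shape G /\ G p = r :: s :> seq V & graft r G = F].

Lemma flip_facts r F G : flip r F G ->
  [/\ planar F, shape F = shape G :\ r, shape G = r |: shape F,
      mark F = mark G & rank F = rank G].
Proof.
move=> [hG rI [p [s [pT Gp]]] <-]; have rT := iedge_vert rI.
split; first exact: (planar_graft allowed_cat hG rI pT Gp).
- exact: (shape_graft hG rI pT Gp).
- by rewrite (shape_graft hG rI pT Gp) setD1K.
- exact: (mark_graft hG rI pT Gp).
- exact: (rank_graft allowed_cat phi hG rI pT Gp).
Qed.

Lemma flip_uniq r F G G' : flip r F G -> flip r F G' -> G = G'.
Proof.
move=> h h'; have [_ _ shG _ _] := flip_facts h; have [_ _ shG' _ _] := flip_facts h'.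
have GG : shape G = shape G' by rewrite shG shG'.
case: h h' => [hG rI [p [s [pT Gp]]] gG] [hG' _ [p' [s' [pT' Gp']]] gG'].
rewrite -GG in pT'.
by apply: (graft_inj hG hG' GG rI pT Gp pT' Gp'); rewrite gG.
Qed.

Lemma flip_exists r F : planar F -> r \in marks F -> r \notin shape F ->
  exists G, flip r F G.
Proof.
move=> hF rF rT; have [G [p [s [hG shG pG Gp gG]]]] := mark_can_be_cut allowed_cat hF rF rT.
exists G; split=> //; last by exists p, s.
apply/setD1P; split; last by rewrite shG in_setU1 eqxx.
by apply: contraNneq rT => ->; apply: (root_vert (planar_tree hF)).
Qed.

Lemma flip_mark_cut r G : planar G -> mark G = Some r -> r \in shape G ->
  flip r (graft r G) G.
Proof.
move=> hG mG rT; have rG : r \in marks G.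
  by move: mG; rewrite /mark; case: pickP => // r' + [<-].
by have [rI ps] := mark_is_head hG rG rT; split.
Qed.

Lemma has_degree_expand j T e : has_degree j (T :\ e) -> ntree T ->
  e \in iedges T -> has_degree j.+1 T.
Proof.
move=> /andP[_ /eqP hj] hT eI; rewrite /has_degree hT (cardsD1 e) eI.
by rewrite -hj /iedges setDDl setUC -setDDl eqxx.
Qed.

Lemma orders_cons T e w : ntree T -> e \in iedges T -> orders (T :\ e) w ->
  orders T (e :: w).
Proof.
move=> hT eI wT; rewrite /orders uniq_perm ?enum_uniq //=.
  by rewrite (orders_uniq wT) (orders_mem _ wT) edges_contract // in_setD1 eqxx.
move=> x; rewrite mem_enum in_cons (orders_mem _ wT) edges_contract // in_setD1.
by case: eqP => // ->; rewrite iedge_edge.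
Qed.

(** Triangularity.  Among the faces of a cell G whose chosen mark r is cut, the
    one obtained by contracting r is uncut.  Contracting another first input
    keeps r cut, and all other faces have smaller rank. *)
Lemma differential_mark_cut j c G r w : rcochain j c -> planar G ->
  has_degree j.+1 (shape G) -> orders (shape G) w -> mark G = Some r -> r \in shape G ->
  (forall F w, planar F -> has_degree j (shape F) -> orders (shape F) w ->
     mark_cut F || (rank F < rank G)%N -> c (shape F) (comb_decor F) w = 0) ->
  differential c (shape G) (comb_decor G) w =
  (-1) ^+ index r w * c (shape (graft r G)) (comb_decor (graft r G)) (rem r w).
Proof.
move=> hc hG hj wT mG rT h0; have hT := planar_tree hG.
have [_ rI [p [s [pT Gp]]] _] := flip_mark_cut hG mG rT.
rewrite /differential (bigD1 r) //= -(contract_head_edge hc hG hj rI pT (orders_rem hT rI wT) Gp).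
rewrite big1 ?addr0 // => e /andP[eI er]; have wT' := orders_rem hT eI wT.
have hje := has_degree_contract hj eI.
have [q qT [[t Gq]|[s1 [s2 [s10 Gq]]]]] := edge_cases hG eI.
  rewrite (contract_head_edge hc hG hj eI qT wT' Gq).
  have shE := shape_graft hG eI qT Gq.
  rewrite h0 ?mulr0 ?shE //; first exact: (planar_graft allowed_cat hG eI qT Gq).
  by rewrite /mark_cut (mark_graft hG eI qT Gq) mG shE in_setD1 eq_sym er rT.
rewrite (contract_tail_edge hc hG hj eI qT wT' s10 Gq) ?mulr0 // => F hF shF lt.
by rewrite h0 ?shF // lt orbT.
Qed.

(** By induction on the rank: a cell F with uncut mark is the diagonal term of the
    differential at the cell obtained by cutting F at its mark. *)
Lemma vanish_from_cut j c : (j < n - 2)%N -> rcochain j c ->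
  (forall F w, planar F -> has_degree j (shape F) -> orders (shape F) w ->
     mark_cut F -> c (shape F) (comb_decor F) w = 0) ->
  (forall F w, planar F -> has_degree j.+1 (shape F) -> orders (shape F) w ->
     mark_cut F -> differential c (shape F) (comb_decor F) w = 0) ->
  forall F w, planar F -> has_degree j (shape F) -> orders (shape F) w ->
  c (shape F) (comb_decor F) w = 0.
Proof.
move=> jn hc hD hdD F w; have [m] := ubnP (rank F).
elim: m F w => // m IH F w; rewrite ltnS => Fm hF hj wT.
case: (boolP (mark_cut F)) => [dF|]; first exact: hD.
have [r mF rF] := mark_cases hF hj jn; rewrite /mark_cut mF => rT.
have [G hflip] := flip_exists hF rF rT.
have [_ shF shG mm rk] := flip_facts hflip; case: hflip => [hG rI _ gG].
have hT := planar_tree hG; have rG := iedge_vert rI.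
have hjG : has_degree j.+1 (shape G) by apply: has_degree_expand hT rI; rewrite -shF.
have wG : orders (shape G) (r :: w) by apply: orders_cons => //; rewrite -shF.
have mG : mark G = Some r by rewrite -mm.
have dG : mark_cut G by rewrite /mark_cut mG.
have := hdD G _ hG hjG wG dG.
rewrite (differential_mark_cut hc hG hjG wG mG rG) /=; last first.
  move=> F' w' hF' hj' wT' /orP[|lt]; first exact: hD.
  by apply: IH => //; apply: leq_trans lt _; rewrite -rk.
by rewrite eqxx mul1r gG.
Qed.

Lemma differential_add c b T d w :
  differential (fun T d w => c T d w + b T d w) T d w =
  differential c T d w + differential b T d w.
Proof. by rewrite /differential -big_split; apply: eq_bigr => e _; rewrite mulrDr. Qed.

Lemma differential_sub c b T d w :
  differential (fun T d w => c T d w - b T d w) T d w =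
  differential c T d w - differential b T d w.
Proof. by rewrite /differential -sumrB; apply: eq_bigr => e _; rewrite mulrBr. Qed.

(** The system is solved by increasing rank.  The correction y made at rank m is
    supported on uncut cells of rank m, so it does not disturb the equations at
    cut cells of smaller rank. *)
Lemma solve_on_cut j c m : rcochain j.+1 c ->
  exists2 b, rcochain j b &
    forall F w, planar F -> has_degree j.+1 (shape F) -> orders (shape F) w ->
      mark_cut F -> (rank F < m)%N ->
      differential b (shape F) (comb_decor F) w = c (shape F) (comb_decor F) w.
Proof.
move=> hc; elim: m => [|m [b hb IH]].
  by exists (fun _ _ _ => 0); first exact: rcochain0.
have hcb := rcochain_sub hc (differential_rcochain hb).
(* The value at F of the defect at the cell G from which F arises by contraction. *)
pose y F w := if mark F is Some r then
  if [pick G | (rank G == m) && `[< flip r F G >]] is Some G then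
    c (shape G) (comb_decor G) (r :: w) - differential b (shape G) (comb_decor G) (r :: w)
  else 0 else 0.
have hy : rcochain j (extend y).
  apply: extend_rcochain => F w1 e f w2 hF hj wT; rewrite /y.
  case: (mark F) => [r|]; last by rewrite oppr0.
  case: pickP => [G /andP[_ /asboolP hfl]|_]; last by rewrite oppr0.
  have [_ shF shG _ _] := flip_facts hfl; case: hfl => [hG rI _ _].
  rewrite shF in hj wT; have hT := planar_tree hG.
  apply: (rc_alt hcb (w1 := r :: w1)).
  - exact: (has_degree_expand hj hT rI).
  - exact: decorates_comb_decor.
  - exact: (orders_cons hT rI wT).
exists (fun T d w => b T d w + extend y T d w); first exact: rcochain_add.
move=> G w hG hj wT dG; rewrite ltnS differential_add => Gm.
move: (dG); rewrite /mark_cut; case mG: (mark G) => [r|//] rT.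
have hfl := flip_mark_cut hG mG rT; have [hF shF _ mF rF] := flip_facts hfl.
have hT := planar_tree hG; have rI : r \in iedges (shape G) by case: hfl.
rewrite (differential_mark_cut hy hG hj wT mG rT); last first.
  move=> F w' hF' hj' wT' h; rewrite extend_comb_decor // /y.
  case mF': (mark F) => [r'|//]; case: pickP => [G' /andP[/eqP rk /asboolP hfl']|//].
  have [_ shF' _ _ rk'] := flip_facts hfl'; case/orP: h.
    by rewrite /mark_cut mF' shF' in_setD1 eqxx.
  by rewrite rk' rk ltnNge Gm.
rewrite extend_comb_decor // /y mF mG.
case: pickP => [G' /andP[/eqP rk /asboolP hfl']|nG]; last first.
  rewrite mulr0 addr0; apply: IH => //; rewrite ltn_neqAle Gm andbT.
  by apply: contraFN (nG G) => ->; apply/asboolP.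
rewrite (flip_uniq hfl' hfl).
have rw : r \in w by rewrite (orders_mem _ wT) iedge_edge.
rewrite (rc_alt_rem hcb hj (decorates_comb_decor hG) wT rw) mulrA -expr2 sqrr_sign mul1r.
by rewrite addrC subrK.
Qed.

Hypothesis char0 : [pchar k] =i pred0.

(** In degree 0 no mark is cut, because there is no internal edge, so
    vanish_from_cut applies directly.  In higher degree it is applied to the
    difference of c and the coboundary provided by solve_on_cut. *)
Theorem pbw_exact j : (j < n - 2)%N -> exact_at P n j.
Proof.
move=> jn c /cochain_rcochain hc dc0.
case: j jn c hc dc0 => [|j] jn c hc dc0.
  move=> T d w hj dT wT; apply: (rc_vanish hc hj wT) dT => F hF shF; subst T.
  apply: (vanish_from_cut jn hc) => // {hj wT} G w' hG hj wT; last first.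
    by move=> _; apply: dc0 => //; apply: decorates_comb_decor.
  rewrite /mark_cut; case mG: (mark G) => [r|//] rT; have [_ rI _ _] := flip_mark_cut hG mG rT.
  by case/andP: hj => _; rewrite cards_eq0 => /eqP r0; rewrite r0 inE in rI.
have [b hb db] := solve_on_cut (\max_(F : plan n) rank F).+1 hc.
exists b; first exact: rcochain_cochain.
have hcb := rcochain_sub hc (differential_rcochain hb).
move=> T d w hj dT wT; apply/eqP; rewrite -subr_eq0; apply/eqP.
apply: (rc_vanish hcb hj wT) dT => F hF shF; subst T.
apply: (vanish_from_cut jn hcb) => // {hj wT} G w' hG hj wT dG.
  by rewrite db ?subrr // ltnS (leq_bigmax (F := fun F : plan n => rank F)).
have sdG := decorates_comb_decor hG.
by rewrite differential_sub dc0 // (differential2 char0 hb) // subrr.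
Qed.

End PBW.

(** * Evaluation of free algebras and coefficients of words *)

Section Evaluation.

Variables (k : fieldType) (laws : term k nat -> term k nat -> Prop).
Variables (A : lmodType k) (mul : A -> A -> A).
Hypothesis mulDl : forall x y z, mul (x + y) z = mul x z + mul y z.
Hypothesis mulDr : forall x y z, mul x (y + z) = mul x y + mul x z.
Hypothesis mulZl : forall a x y, mul (a *: x) y = a *: mul x y.
Hypothesis mulZr : forall a x y, mul x (a *: y) = a *: mul x y.

Fixpoint eval (X : Type) (e : X -> A) (t : term k X) : A :=
  match t with
  | Var x => e x
  | Zero => 0
  | Add t u => eval e t + eval e u
  | Scale a t => a *: eval e t
  | Mul t u => mul (eval e t) (eval e u)
  end.

Hypothesis eval_laws : forall l r (e : nat -> A), laws l r -> eval e l = eval e r.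

Lemma eval_tsubst (X Y : Type) (s : X -> term k Y) (e : Y -> A) t :
  eval e (tsubst s t) = eval (fun x => eval e (s x)) t.
Proof. by elim: t => //= [t -> u ->|a t ->|t -> u ->]. Qed.

Lemma eval_teq (X : Type) (e : X -> A) t u : teq laws t u -> eval e t = eval e u.
Proof.
elim=> {t u} //=.
- by move=> t u v _ -> _ ->.
- by move=> t t' u u' _ -> _ ->.
- by move=> a t t' _ ->.
- by move=> t t' u u' _ -> _ ->.
- by move=> *; rewrite addrA.
- by move=> *; rewrite addrC.
- by move=> *; rewrite add0r.
- by move=> *; rewrite scaleN1r addNr.
- by move=> *; rewrite scalerA.
- by move=> *; rewrite scale1r.
- by move=> *; rewrite scalerDr.
- by move=> *; rewrite scalerDl.
- by move=> l r s /eval_laws h; rewrite !eval_tsubst.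
Qed.

Definition feval (X : Type) (e : X -> A) (x : freealg laws X) : A := eval e (frepr x).

Lemma feval_pi (X : Type) (e : X -> A) t : feval e (fpi t) = eval e t.
Proof. exact/eval_teq/frepr_pi. Qed.

Lemma feval_linear (X : Type) (e : X -> A) : linear (feval e).
Proof.
move=> a; elim/free_ind=> t; elim/free_ind=> u.
by rewrite -fpiZ -fpiD !feval_pi.
Qed.

Lemma fevalM (X : Type) (e : X -> A) x y : feval e (fmul x y) = mul (feval e x) (feval e y).
Proof.
elim/free_ind: x => t; elim/free_ind: y => u.
by rewrite -fpi_mul !feval_pi.
Qed.

Lemma feval_var (X : Type) (e : X -> A) x : feval e (fvar x) = e x.
Proof. exact: feval_pi. Qed.

Lemma feval_lmon (X : eqType) (e : X -> A) x s :
  feval e (lmon laws (x :: s)) = foldl (fun a y => mul a (e y)) (e x) s.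
Proof.
elim/last_ind: s => [|s y IH]; first exact: feval_var.
move: IH; rewrite /= -!cats1 !foldl_cat /= => <-.
by rewrite fevalM feval_var.
Qed.

End Evaluation.

(** Let letter x be the sum of the matrix units E_(i, i+1) over the positions i of
    x in s.  The row vector pos i moves one step to the right under letter x if x
    is at position i, and is killed otherwise.  So the entry in the first row and
    last column of a product of letters tells whether this product spells s.
    The default value x of nth matters only in the last row, where no column
    i.+1 exists; for the same reason pos i vanishes when i exceeds size s. *)
Section WordCoefficient.

Variables (k : fieldType) (X : eqType) (s : seq X).

Definition letter (x : X) : 'M[k]_((size s).+1) :=
  \matrix_(i, j) ((j == i.+1 :> nat) && (nth x s i == x))%:R.

Definition pos (i : nat) : 'rV[k]_((size s).+1) := \row_j (j == i :> nat)%:R.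

Lemma pos_letter i x : pos i *m letter x = (nth x s i == x)%:R *: pos i.+1.
Proof.
apply/rowP => j; rewrite !mxE.
case: (ltnP i (size s).+1) => hi.
  rewrite (bigD1 (Ordinal hi)) //= !mxE /= eqxx mul1r big1 ?addr0 => [|l li].
    by rewrite -natrM mulnb andbC.
  rewrite -(inj_eq val_inj) /= in li.
  by rewrite !mxE (negbTE li) mul0r.
rewrite big1 => [|l _].
  have -> : (j == i.+1 :> nat) = false.
    by apply/eqP => e; have := ltn_ord j; rewrite e ltnS ltnNge (leq_trans _ hi).
  by rewrite mulr0.
rewrite !mxE (_ : (l == i :> nat) = false) ?mul0r //.
by apply/eqP => e; have := ltn_ord l; rewrite e ltnNge hi.
Qed.

Lemma pos_last i : i = size s -> pos i 0 ord_max = 1.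
Proof. by move=> ->; rewrite mxE eqxx. Qed.

Lemma pos_out i : (size s < i)%N -> pos i = 0.
Proof.
move=> hi; apply/rowP => j; rewrite !mxE (_ : (j == i :> nat) = false) //.
by apply/eqP => e; have := ltn_ord j; rewrite e ltnNge hi.
Qed.

Lemma prefix_step x y t : (size t < size s)%N ->
  ((x :: t == take (size t).+1 s) && (nth y s (size t).+1 == y))%:R *: pos (size t).+2
  = (rcons (x :: t) y == take (size t).+2 s)%:R *: pos (size t).+2.
Proof.
rewrite leq_eqVlt => /orP[/eqP sz|sz].
  by rewrite pos_out ?scaler0 // -sz.
by rewrite (take_nth y sz) eqseq_rcons [y == _]eq_sym.
Qed.

End WordCoefficient.

(** * Least elements of clusters *)

Section Keys.

Variable n : nat.
Local Notation V := {set 'I_n}.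
Implicit Types (x y : V) (s t : seq V).

(** The least element of a cluster; disjoint clusters have distinct keys. *)
Definition key x : nat := find (fun i => i \in x) (enum 'I_n).

Lemma key_has x : x != set0 -> has (fun i => i \in x) (enum 'I_n).
Proof. by case/set0Pn => i ix; apply/hasP; exists i; rewrite ?mem_enum. Qed.

Lemma key_lt x i : x != set0 -> (key x < i)%N = has (fun j => j \in x) (take i (enum 'I_n)).
Proof. by move=> /key_has/has_take ->. Qed.

Lemma key_ltn x : x != set0 -> (key x < n)%N.
Proof. by move=> x0; have := key_has x0; rewrite has_find size_enum_ord. Qed.

Lemma key_inj s x y : blocks s -> x \in s -> y \in s -> key x = key y -> x = y.
Proof.
move=> [_ s0 sd] xs ys kxy; apply/eqP; apply: contraT => /(sd _ _ xs ys).
have x0 : x != set0 by apply: contraNneq s0 => <-.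
have y0 : y != set0 by apply: contraNneq s0 => <-.
have [i ix] := set0Pn _ x0.
have := nth_find i (key_has x0); have := nth_find i (key_has y0).
rewrite -/(key x) -/(key y) kxy => jy jx.
by move=> /disjoint_setI0/setP/(_ (nth i (enum 'I_n) (key y))); rewrite !inE jx jy.
Qed.

Lemma key_join s i : s != [::] -> blocks s ->
  (key (join s) < i)%N = has (fun x => (key x < i)%N) s.
Proof.
move=> s_ bs; rewrite key_lt ?join_neq0 //.
have [_ s0 _] := bs.
have -> : has (fun x => (key x < i)%N) s
    = has (fun x : V => has (fun j => j \in x) (take i (enum 'I_n))) s.
  apply: eq_in_has => x xs; rewrite key_lt //.
  by apply: contraNneq s0 => <-.
apply/hasP/hasP => -[].
  move=> j ji; rewrite mem_join => /hasP [x xs jx]; exists x => //.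
  by apply/hasP; exists j.
move=> x xs /hasP [j ji jx]; exists j => //; rewrite mem_join.
by apply/hasP; exists x.
Qed.

Lemma key_join_gt s i : s != [::] -> blocks s ->
  (i < key (join s))%N = all (fun x => (i < key x)%N) s.
Proof.
move=> s_ bs; rewrite ltnNge -ltnS key_join // -all_predC.
by apply: eq_all => x /=; rewrite ltnS -ltnNge.
Qed.

Lemma key_join_le s x : x \in s -> blocks s -> (key (join s) <= key x)%N.
Proof.
move=> xs bs; rewrite -ltnS key_join //; last by case: (s) xs.
by apply/hasP; exists x.
Qed.

Lemma card_head_join t : blocks t -> (1 < size t)%N ->
  (#|head set0 t| < #|join t|)%N.
Proof.
case: t => [|x [|y t]] // bt _; apply: proper_card.
have := blocks_disjoint (s := [:: x]) bt; rewrite join1 => dis.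
have j0 : join (y :: t) != set0 by apply: join_neq0; last exact: (blocks_catr (s := [:: x]) bt).
rewrite join_cons properE subsetUl; apply/negP; rewrite subUset => /andP[_ h].
by have := subset_disjoint0 j0 h; rewrite disjoint_sym dis.
Qed.

Lemma head_mem s : s != [::] -> head set0 s \in s.
Proof. by case: s => // x s _; rewrite inE eqxx. Qed.

End Keys.

(** * The associative operad *)

Section Associative.

Variables (k : fieldType) (laws : term k nat -> term k nat -> Prop) (X : eqType).
Local Notation freealg := (freealg laws).
Local Notation lmon := (lmon laws).
Hypothesis fmulA : forall x y z : freealg X, fmul (fmul x y) z = fmul x (fmul y z).
Implicit Types (s t : seq X) (x : X).

Lemma lmon_foldl s t : s != [::] ->
  foldl (fun z y => fmul z (fvar y)) (lmon s) t = lmon (s ++ t).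
Proof. by case: s => // x s _; rewrite /= foldl_cat. Qed.

Lemma lmon_cat s t : s != [::] -> t != [::] -> fmul (lmon s) (lmon t) = lmon (s ++ t).
Proof.
move=> s0; case: t => // x t _; elim/last_ind: t => [|t y IH].
  by rewrite -lmon_foldl.
have E (r : seq X) z : r != [::] -> lmon (r ++ [:: z]) = fmul (lmon r) (fvar z).
  by move=> r0; rewrite -lmon_foldl.
rewrite -rcons_cons -cats1 catA !E // -?fmulA ?IH //.
by case: (s) s0.
Qed.

Lemma monomial_leaves (a : magma X) : monomial laws a = lmon (leaves a).
Proof.
have leaves0 (b : magma X) : leaves b != [::].
  by elim: b => //= b hb c _; case: (leaves b) hb.
by elim: a => //= a -> b ->; rewrite lmon_cat.
Qed.

Lemma fsubst_lmon_cat x s1 s2 t : s1 != [::] -> t != [::] ->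
  uniq (s1 ++ x :: s2) ->
  fsubst (subst1 x (lmon t)) (lmon (s1 ++ x :: s2)) = lmon (s1 ++ t ++ s2).
Proof.
move=> s10 t0; rewrite cat_uniq /= negb_or => /and4P[_ /andP[x1 _] x2 _].
have fix_ z s : x \notin s ->
    foldl (fun z y => fmul z (subst1 x (lmon t) y)) z s =
    foldl (fun z y => fmul z (fvar y)) z s.
  elim: s z => //= y s IH z; rewrite inE negb_or => /andP[xy /IH ->].
  by rewrite /subst1 eq_sym (negbTE xy).
case: s1 s10 x1 => // y s1 _; rewrite inE negb_or => /andP[xy x1].
rewrite cat_cons fsubst_lmon foldl_cat /= !fix_ //.
rewrite {1 2}/subst1 eqxx eq_sym (negbTE xy) -/(lmon (y :: s1)).
rewrite lmon_cat // lmon_foldl ?catA //.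
Qed.

End Associative.

Section AsKoszul.

Variable k : fieldType.
Local Notation laws := (@As_laws k).

Lemma As_fmulA X (x y z : freealg laws X) : fmul (fmul x y) z = fmul x (fmul y z).
Proof.
elim/free_ind: x => t; elim/free_ind: y => u; elim/free_ind: z => v.
rewrite -!fpi_mul; apply/fpiP.
by have := @teq_law k laws X _ _ (nth v [:: t; u]) (conj erefl erefl).
Qed.

Definition word_coef (X : eqType) (s : seq X) (x : freealg laws X) : k :=
  (pos k s 0 *m feval (@mulmx k _ _ _) (letter k s) x) 0 ord_max.

Lemma mulmx_As m l r (e : nat -> 'M[k]_m) : laws l r ->
  eval (@mulmx k _ _ _) e l = eval (@mulmx k _ _ _) e r.
Proof. by case=> -> ->; rewrite /= mulmxA. Qed.

Lemma word_coef_linear (X : eqType) (s : seq X) a (x y : freealg laws X) :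
  word_coef s (a *: x + y) = a * word_coef s x + word_coef s y.
Proof.
rewrite /word_coef (feval_linear (@mulmxDl k _ _ _) (@mulmxDr k _ _ _)
  (fun a x y => esym (scalemxAl a x y)) (fun a x y => esym (scalemxAr a x y))
  (@mulmx_As _)).
by rewrite mulmxDr -scalemxAr !mxE.
Qed.

Lemma word_prefix (X : eqType) (s : seq X) x t : (size t < size s)%N ->
  pos k s 0 *m feval (@mulmx k _ _ _) (letter k s) (lmon laws (x :: t)) =
  (x :: t == take (size t).+1 s)%:R *: pos k s (size t).+1.
Proof.
rewrite (feval_lmon (@mulmxDl k _ _ _) (@mulmxDr k _ _ _)
  (fun a x y => esym (scalemxAl a x y)) (fun a x y => esym (scalemxAr a x y))
  (@mulmx_As _)).
elim/last_ind: t => [|t y IH].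
  by case: s => // z s _; rewrite pos_letter /= take0 eqseq_cons andbT eq_sym.
rewrite size_rcons => /ltnW ts; rewrite -cats1 foldl_cat /= mulmxA IH //.
rewrite -scalemxAl pos_letter scalerA -natrM mulnb prefix_step //.
by rewrite cats1.
Qed.

Lemma word_coef_lmon (X : eqType) (s t : seq X) : s != [::] -> perm_eq s t ->
  word_coef s (lmon laws t) = (s == t)%:R.
Proof.
move=> s0 st; have sz := perm_size st.
case: t st sz => [|x t] st sz; first by move: s0; rewrite -size_eq0 sz.
rewrite /word_coef word_prefix ?sz // mxE pos_last ?sz // mulr1.
by rewrite -[(size t).+1]/(size (x :: t)) -[size (x :: t)]sz take_size eq_sym.
Qed.

(** Contraction at a later input turns X (Y Z) into (X Y) Z, so the weight of the
    right factor Y Z is replaced by that of Y, which is smaller when the weight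
    is the cardinality. *)
Theorem As_koszul : [pchar k] =i pred0 -> koszul (As k).
Proof.
move=> char0 n j _ jn; pose phi (x : {set 'I_n}) := #|x|.
apply: (@pbw_exact k laws (@As_linpart k) n xpredT (@word_coef _) phi) jn => //.
- exact: word_coef_linear.
- by move=> s t s0 _ st _ _; apply: word_coef_lmon.
- by move=> a _; rewrite (monomial_leaves (@As_fmulA _)); apply: comb_span_lmon => /=.
move=> s1 s2 t g s10 t1 [us _ _] _ bt _ _ _ gp.
have t0 : t != [::] by case: (t) t1.
rewrite (fsubst_lmon_cat (@As_fmulA _)) // word_coef_lmon //; last first.
  by rewrite -size_eq0 (perm_size gp) size_cat; case: (s1) s10.
case: (eqVneq g (s1 ++ t ++ s2)) => [-> _|_]; last by rewrite eqxx.
have -> : head set0 (s1 ++ t ++ s2) = head set0 s1 by case: (s1) s10.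
by rewrite ltn_add2r card_head_join.
Qed.

End AsKoszul.

(** * The Lie operad *)

Section LieKoszul.

Variable k : fieldType.
Local Notation laws := (@Lie_laws k).
Local Notation lmon := (lmon laws).

Lemma Lie_fmulxx X (x : freealg laws X) : fmul x x = 0.
Proof.
elim/free_ind: x => t; rewrite -fpi_mul -fpi0; apply/fpiP.
by have := @teq_law k laws X _ _ (fun=> t) (or_introl (conj erefl erefl)).
Qed.

Lemma Lie_anti X (x y : freealg laws X) : fmul y x = - fmul x y.
Proof.
apply/eqP; rewrite -addr_eq0 addrC; apply/eqP.
have := Lie_fmulxx (x + y).
by rewrite fmulDl !fmulDr !Lie_fmulxx add0r addr0.
Qed.

Lemma Lie_jacobi X (x y z : freealg laws X) :
  fmul x (fmul y z) = fmul (fmul x y) z - fmul (fmul x z) y.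
Proof.
have : fmul x (fmul y z) + (fmul y (fmul z x) + fmul z (fmul x y)) = 0.
  elim/free_ind: x => t; elim/free_ind: y => u; elim/free_ind: z => v.
  rewrite -!fpi_mul -!fpiD -fpi0; apply/fpiP.
  by have := @teq_law k laws X _ _ (nth v [:: t; u]) (or_intror (conj erefl erefl)).
have -> : fmul y (fmul z x) = fmul (fmul x z) y.
  by rewrite (Lie_anti (fmul z x) y) (Lie_anti x z) -scaleN1r fmulZl scaleN1r opprK.
rewrite (Lie_anti (fmul x y) z) => /eqP; rewrite addr_eq0 => /eqP ->.
by rewrite opprB.
Qed.

Definition bracket m (a b : 'M[k]_m) : 'M[k]_m := a *m b - b *m a.

Lemma bracketDl m (a b c : 'M[k]_m) : bracket (a + b) c = bracket a c + bracket b c.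
Proof. by rewrite /bracket mulmxDl mulmxDr opprD addrACA. Qed.

Lemma bracketDr m (a b c : 'M[k]_m) : bracket a (b + c) = bracket a b + bracket a c.
Proof. by rewrite /bracket mulmxDl mulmxDr opprD addrACA. Qed.

Lemma bracketZl m x (a b : 'M[k]_m) : bracket (x *: a) b = x *: bracket a b.
Proof. by rewrite /bracket -scalemxAl -scalemxAr -scalerBr. Qed.

Lemma bracketZr m x (a b : 'M[k]_m) : bracket a (x *: b) = x *: bracket a b.
Proof. by rewrite /bracket -scalemxAl -scalemxAr -scalerBr. Qed.

Lemma bracket_Lie m l r (e : nat -> 'M[k]_m) : laws l r ->
  eval (@bracket m) e l = eval (@bracket m) e r.
Proof.
case=> [[-> ->]|[-> ->]] /=; first by rewrite /bracket subrr.
rewrite /bracket !mulmxBr !mulmxBl !mulmxA.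
apply/matrixP => i j.
have addE (a b : 'M[k]_m) : (a + b) i j = a i j + b i j by rewrite mxE.
have oppE (a : 'M[k]_m) : (- a) i j = - a i j by rewrite mxE.
by rewrite !(addE, oppE) [RHS]mxE; ring.
Qed.

Definition lie_coef (X : eqType) (s : seq X) (x : freealg laws X) : k :=
  (pos k s 0 *m feval (@bracket _) (letter k s) x) 0 ord_max.

Lemma lie_coef_linear (X : eqType) (s : seq X) a (x y : freealg laws X) :
  lie_coef s (a *: x + y) = a * lie_coef s x + lie_coef s y.
Proof.
rewrite /lie_coef (feval_linear (@bracketDl _) (@bracketDr _)
  (@bracketZl _) (@bracketZr _) (@bracket_Lie _)).
by rewrite mulmxDr -scalemxAr !mxE.
Qed.

(** Reading s from position i, a comb that starts with x = s_0 can only succeed from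
    position 0, since s_0 occurs nowhere else; for the same reason the subtracted
    products, in which a letter precedes x, contribute nothing. *)
Lemma lie_prefix (X : eqType) (s : seq X) x r t i : uniq s -> s = x :: r ->
  (size t < size s)%N ->
  pos k s i *m feval (@bracket _) (letter k s) (lmon (x :: t)) =
  ((i == 0) && (x :: t == take (size t).+1 s))%:R *: pos k s (size t).+1.
Proof.
move=> us sx; rewrite (feval_lmon (@bracketDl _) (@bracketDr _)
  (@bracketZl _) (@bracketZr _) (@bracket_Lie _)).
elim/last_ind: t i => [|t y IH] i.
  move=> _; rewrite /= pos_letter; case: i => [|i].
    by rewrite sx /= take0 !eqxx.
  rewrite /= scale0r; case: (ltnP i.+1 (size s)) => hi.
    rewrite (_ : _ == x = false) ?scale0r //.
    apply/negbTE; rewrite -[x in _ != x](_ : nth x s 0 = x); last by rewrite sx.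
    by rewrite nth_uniq ?(leq_trans _ hi).
  by rewrite pos_out ?scaler0.
rewrite size_rcons => /ltnW ts; rewrite -cats1 foldl_cat /= /bracket mulmxBr !mulmxA IH //.
rewrite pos_letter -[X in _ - X]scalemxAl IH //= scale0r scaler0 subr0.
rewrite -scalemxAl pos_letter scalerA -natrM mulnb -andbA.
case: (i == 0); rewrite ?scale0r //= prefix_step //.
by rewrite cats1.
Qed.

Lemma lie_coef_lmon (X : eqType) (x : X) (s t : seq X) : uniq (x :: s) ->
  perm_eq s t -> lie_coef (x :: s) (lmon (x :: t)) = (s == t)%:R.
Proof.
move=> us st; have sz := perm_size st.
have ts : (size t < size (x :: s))%N by rewrite /= sz.
rewrite /lie_coef (lie_prefix 0 us erefl ts) mxE pos_last /= ?sz // mulr1.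
by rewrite -sz take_size eqseq_cons eqxx eq_sym.
Qed.

(** By the Jacobi identity, bracketing with a product is a difference of two
    iterated brackets; so the bracket of a comb with any monomial is a
    combination of combs with the same first letter. *)
Lemma lie_step (X : eqType) (b : magma X) x s :
  comb_span (fun g => (ohead g == Some x) && perm_eq g (x :: s ++ leaves b))
    (fmul (lmon (x :: s)) (monomial laws b)).
Proof.
elim: b s => [y|b1 IH1 b2 IH2] s /=.
  rewrite (_ : fmul _ _ = lmon (x :: s ++ [:: y])); last by rewrite /= foldl_cat.
  by apply: comb_span_lmon; rewrite /= eqxx perm_refl.
have two (c1 c2 : magma X) :
    (forall s, comb_span (fun g => (ohead g == Some x) && perm_eq g (x :: s ++ leaves c1))
      (fmul (lmon (x :: s)) (monomial laws c1))) ->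
    (forall s, comb_span (fun g => (ohead g == Some x) && perm_eq g (x :: s ++ leaves c2))
      (fmul (lmon (x :: s)) (monomial laws c2))) ->
    comb_span (fun g => (ohead g == Some x) && perm_eq g (x :: s ++ leaves c1 ++ leaves c2))
      (fmul (fmul (lmon (x :: s)) (monomial laws c1)) (monomial laws c2)).
  move=> h1 h2; elim: (h1 s) => [|a g z /andP[gx gs] _ IH].
    by rewrite -[0](scale0r 0) fmulZl scale0r; apply: comb_span0.
  rewrite fmulDl fmulZl; apply: comb_spanD => //; apply: comb_spanZ.
  case: g gx gs => // y g /= /eqP[->]; rewrite perm_cons => gs.
  apply: comb_span_sub (h2 g) => h /andP[-> /=] hg; apply: perm_trans hg _.
  by rewrite perm_cons catA perm_cat2r.
rewrite Lie_jacobi -scaleN1r; apply: comb_spanD; first exact: two.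
apply: comb_spanZ; apply: comb_span_sub (two b2 b1 IH2 IH1) => g /andP[-> /=] hg.
by apply: perm_trans hg _; rewrite perm_cons perm_cat2l perm_catC.
Qed.

(** By antisymmetry the factor containing x can be put on the left. *)
Lemma lie_span (X : eqType) (b : magma X) x : x \in leaves b ->
  comb_span (fun g => (ohead g == Some x) && perm_eq g (leaves b)) (monomial laws b).
Proof.
have right (b1 b2 : magma X) :
    comb_span (fun g => (ohead g == Some x) && perm_eq g (leaves b1)) (monomial laws b1) ->
    comb_span (fun g => (ohead g == Some x) && perm_eq g (leaves b1 ++ leaves b2))
      (fmul (monomial laws b1) (monomial laws b2)).
  elim=> [|a g z /andP[gx gs] _ IH].
    by rewrite -[0](scale0r 0) fmulZl scale0r; apply: comb_span0.
  rewrite fmulDl fmulZl; apply: comb_spanD => //; apply: comb_spanZ.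
  case: g gx gs => // y g /= /eqP[->] gs.
  apply: comb_span_sub (lie_step b2 x g) => h /andP[-> /=] hg; apply: perm_trans hg _.
  by rewrite -cat_cons perm_cat2r.
elim: b => [y|b1 IH1 b2 IH2] /=.
  rewrite inE => /eqP <-; rewrite -[fvar x]/(lmon [:: x]); apply: comb_span_lmon.
  by rewrite /= eqxx perm_refl.
rewrite mem_cat => /orP[/IH1|/IH2] h; first exact: right.
rewrite Lie_anti -scaleN1r; apply: comb_spanZ.
apply: comb_span_sub (right _ b1 h) => g /andP[-> /=] hg.
by apply: perm_trans hg _; rewrite perm_catC.
Qed.

Section Allowed.

Variable n : nat.
Local Notation V := {set 'I_n}.
Implicit Types (s t g : seq V) (x y : V).

Definition min_head s : bool :=
  if s is x :: t then all (fun y => (key x < key y)%N) t else false.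

Lemma min_head_cat s t : s != [::] -> blocks (s ++ t) ->
  min_head (s ++ t) = min_head s && min_head (join s :: t).
Proof.
case: s => // x s _ bl; rewrite /= all_cat; case: (boolP (all _ s)) => //= xs.
have bs := blocks_catl bl.
suff -> : key (join (x :: s)) = key x by [].
apply/eqP; rewrite eqn_leq key_join_le ?inE ?eqxx // leqNgt key_join //.
rewrite -all_predC /=; rewrite -leqNgt leqnn /=; apply: sub_all xs => y /=.
by rewrite -leqNgt => /ltnW.
Qed.

Lemma min_head_uniq s t : min_head s -> min_head t -> perm_eq s t ->
  head set0 s = head set0 t.
Proof.
case: s t => // x s [//|y t] /= xs yt st; apply/eqP; apply: contraT => xy.
have yin : y \in s by have := perm_mem st y; rewrite !inE eqxx eq_sym (negbTE xy).
have xin : x \in t by have := perm_mem st x; rewrite !inE eqxx (negbTE xy).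
by have := ltn_trans (allP xs y yin) (allP yt x xin); rewrite ltnn.
Qed.

Lemma exists_min_head s : s != [::] -> blocks s ->
  exists2 x, x \in s & forall y, y \in s -> y != x -> (key x < key y)%N.
Proof.
move=> s0 bs; have : (key (join s) < (key (join s)).+1)%N by [].
rewrite key_join // => /hasP [x xs]; rewrite ltnS => kx.
exists x => // y ys yx; rewrite ltn_neqAle; apply/andP; split.
  by apply: contraNneq yx => e; apply/eqP/(key_inj bs ys xs).
exact: leq_trans kx (key_join_le ys bs).
Qed.

End Allowed.

(** The first letter of an allowed comb has the least key, which is not affected by
    a substitution for another letter.  So all combs occurring in a contraction
    keep the first letter of the lower vertex, and the weight used for As works
    as well. *)
Theorem Lie_koszul : [pchar k] =i pred0 -> koszul (Lie k).
Proof.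
move=> char0 n j _ jn; pose phi (x : {set 'I_n}) := #|x|.
apply: (@pbw_exact k laws (@Lie_linpart k) n (@min_head n) (@lie_coef _) phi) jn => //.
- exact: lie_coef_linear.
- move=> s t s0 [us _ _] st hs ht; have := min_head_uniq hs ht st.
  case: s us st hs {s0} => // x s us st _; case: t ht st => // y t _ + /= xy.
  by rewrite -{}xy perm_cons => st; rewrite lie_coef_lmon // eqseq_cons eqxx.
- move=> a bl; have a0 : leaves a != [::].
    by elim: a {bl} => //= b hb c _; case: (leaves b) hb.
  have [x xa xmin] := exists_min_head a0 bl.
  apply: comb_span_sub (lie_span xa) => -[//|y g] /andP[/eqP[->] gs]; rewrite gs andbT /=.
  have [ug _ _] : blocks (x :: g) by apply: perm_blocks bl; rewrite perm_sym.
  apply/allP => z zg; apply: xmin; first by rewrite -(perm_mem gs) inE zg orbT.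
  by apply: contraTneq ug => <-; rewrite /= zg.
- exact: min_head_cat.
move=> s1 s2 t g s10 t1 bl hs bt _ _ hg gp _.
suff -> : head set0 g = head set0 s1 by rewrite ltn_add2r card_head_join.
case: s1 s10 hs bl gp => // x s1 _ /= hs bl gp.
case: g hg gp => // y g /= hg gp; apply/eqP; apply: contraT => yx.
have xg : x \in g by have := perm_mem gp x; rewrite !inE eqxx eq_sym (negbTE yx).
have yin : y \in s1 ++ t ++ s2 by have := perm_mem gp y; rewrite !inE eqxx (negbTE yx).
have xy : (key x < key y)%N.
  move: hs; rewrite all_cat /= => /and3P[h1 h2 h3].
  move: yin; rewrite !mem_cat => /or3P[ys|yt|ys].
  - exact: (allP h1).
  - exact: leq_trans h2 (key_join_le yt bt).
  - exact: (allP h3).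
by have := ltn_trans xy (allP hg x xg); rewrite ltnn.
Qed.

End LieKoszul.

(** * The commutative operad *)

Section ComKoszul.

Variable k : fieldType.
Local Notation laws := (@Com_laws k).
Local Notation lmon := (lmon laws).

Lemma Com_fmulA X (x y z : freealg laws X) : fmul (fmul x y) z = fmul x (fmul y z).
Proof.
elim/free_ind: x => t; elim/free_ind: y => u; elim/free_ind: z => v.
rewrite -!fpi_mul; apply/fpiP.
by have := @teq_law k laws X _ _ (nth v [:: t; u]) (or_introl (conj erefl erefl)).
Qed.

Lemma Com_fmulC X (x y : freealg laws X) : fmul x y = fmul y x.
Proof.
elim/free_ind: x => t; elim/free_ind: y => u; rewrite -!fpi_mul; apply/fpiP.
by have := @teq_law k laws X _ _ (nth u [:: t]) (or_intror (conj erefl erefl)).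
Qed.

(** The comb is the iterated product in the commutative semigroup of the free
    algebra, completed by a unit None. *)
Lemma Com_lmon_perm (X : eqType) (s t : seq X) : perm_eq s t -> lmon s = lmon t.
Proof.
have fA : associative (@fmul k laws X) by move=> x y z; rewrite Com_fmulA.
have E r : r != [::] ->
    Some (lmon r) = \big[oAC fA (@Com_fmulC X)/None]_(x <- r) Some (fvar x).
  case: r => // x r _; elim/last_ind: r => [|r y IH]; first by rewrite big_seq1.
  by rewrite -rcons_cons -cats1 -lmon_foldl // big_cat big_seq1 -IH.
move=> st; case: (eqVneq s [::]) => [s0|s0].
  by move: st; rewrite s0 perm_sym => /perm_nilP ->.
apply: Some_inj; rewrite !E //; first exact: perm_big.
by rewrite -size_eq0 -(perm_size st) size_eq0.
Qed.

Definition com_coef (X : Type) (x : freealg laws X) : k :=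
  feval (A := k^o) *%R (fun=> 1) x.

Lemma mul_Com l r (e : nat -> k^o) : laws l r ->
  eval (A := k^o) *%R e l = eval (A := k^o) *%R e r.
Proof. by case=> [[-> ->]|[-> ->]]; rewrite /= ?mulrA // mulrC. Qed.

Let mulZl (a : k) (x y : k^o) : (a *: x) * y = a *: (x * y).
Proof. by rewrite scalerAl. Qed.
Let mulZr (a : k) (x y : k^o) : x * (a *: y) = a *: (x * y).
Proof. by rewrite scalerAr. Qed.

Lemma com_coef_linear (X : Type) a (x y : freealg laws X) :
  com_coef (a *: x + y) = a * com_coef x + com_coef y.
Proof.
exact: (feval_linear (A := k^o) (@mulrDl _) (@mulrDr _) mulZl mulZr mul_Com).
Qed.

Lemma com_coef_lmon (X : eqType) (s : seq X) : s != [::] -> com_coef (lmon s) = 1.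
Proof.
case: s => // x s _; rewrite /com_coef.
rewrite (feval_lmon (A := k^o) (@mulrDl _) (@mulrDr _) mulZl mulZr mul_Com).
by elim/last_ind: s => // s y IH; rewrite -cats1 foldl_cat /= IH mulr1.
Qed.

Section Allowed.

Variable n : nat.
Local Notation V := {set 'I_n}.
Implicit Types (s t g : seq V) (x y : V).

Definition key_gt x y : bool := (key y < key x)%N.

Definition decreasing s : bool := pairwise key_gt s.

(** The key of join s is the least key in s, that of its last member. *)
Lemma decreasing_cat s t : s != [::] -> blocks (s ++ t) ->
  decreasing (s ++ t) = decreasing s && decreasing (join s :: t).
Proof.
move=> s0 /blocks_catl bs; rewrite /decreasing pairwise_cat pairwise_cons.
rewrite andbCA; congr (_ && (_ && _)); rewrite allrelC; apply: eq_all => y.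
by rewrite /key_gt key_join_gt.
Qed.

Lemma key_gt_trans : transitive key_gt.
Proof. by move=> y x z xy yz; apply: ltn_trans yz xy. Qed.

Lemma decreasing_uniq s t : decreasing s -> decreasing t -> perm_eq s t -> s = t.
Proof.
have tot := key_gt_trans; rewrite /decreasing -!sorted_pairwise // => hs ht st.
apply: (irr_sorted_eq tot) hs ht (perm_mem st) => x; exact: ltnn.
Qed.

Lemma decreasing_sort s : blocks s -> exists2 t, perm_eq t s & decreasing t.
Proof.
move=> bs; exists (sort (fun x y => key y <= key x)%N s); first by rewrite perm_sort.
set t := sort _ s; have ts : perm_eq t s by rewrite perm_sort.
have bt : blocks t by apply: perm_blocks bs; rewrite perm_sym.
have : pairwise (fun x y => key y <= key x)%N t.
  rewrite -sorted_pairwise; first by apply: sort_sorted => x y; apply: leq_total.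
  by move=> y x z xy yz; apply: leq_trans yz xy.
have [ut _ _] := bt; move: ut; rewrite uniq_pairwise => ut pt.
have : pairwise (fun x y => (x != y) && (key y <= key x)%N) t.
  by rewrite pairwise_relI ut pt.
apply: sub_in_pairwise (allss t) => x y xt yt /andP[xy].
rewrite leq_eqVlt => /orP[/eqP e|//].
by case/eqP: xy; apply: (key_inj bt xt yt).
Qed.

Lemma head_decreasing s x : decreasing s -> x \in s -> (key x <= key (head set0 s))%N.
Proof.
case: s => // y s /=; rewrite /decreasing /= inE => /andP[ys _] /orP[/eqP -> //|xs].
exact/ltnW/(allP ys).
Qed.

End Allowed.

(** A large weight is given to a small key, so that the union of the inputs of a
    vertex weighs more than the first of them. The first key of the merged list is
    at most one of the first keys of the two lists, and key (join t) is smaller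
    than the other one. *)
Theorem Com_koszul : [pchar k] =i pred0 -> koszul (Com k).
Proof.
move=> char0 n j _ jn; pose phi (x : {set 'I_n}) := (n - key x)%N.
apply: (@pbw_exact k laws (@Com_linpart k) n (@decreasing n) (fun _ x => com_coef x) phi) jn => //.
- by move=> _; apply: com_coef_linear.
- move=> s t s0 _ st hs ht; rewrite -(decreasing_uniq hs ht st) eqxx.
  exact: com_coef_lmon.
- move=> a bl; have [t ta dt] := decreasing_sort bl.
  rewrite (monomial_leaves (@Com_fmulA _)) -(Com_lmon_perm ta).
  by apply: comb_span_lmon; rewrite dt ta.
- exact: decreasing_cat.
move=> s1 s2 t g s10 t1 bl hs bt ht bg hg gp _.
have t0 : t != [::] by case: (t) t1.
have g0 : g != [::].
  by rewrite -size_eq0 (perm_size gp) size_cat; case: (s1) s10.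
have kn (s : seq {set 'I_n}) x : blocks s -> x \in s -> (key x < n)%N.
  by move=> [_ s0 _] xs; apply: key_ltn; apply: contraNneq s0 => <-.
have k1 := kn _ _ bt (head_mem t0).
have h1in : head set0 s1 \in s1 ++ join t :: s2 by rewrite mem_cat head_mem.
have k2 := kn _ _ bl h1in.
have k3 := kn _ _ bg (head_mem g0).
have k4 : (key (join t) < key (head set0 s1))%N.
  case: (s1) s10 hs => // x r _; rewrite /decreasing /= => /andP[/allP h _].
  by apply: h; rewrite mem_cat inE eqxx orbT.
have k5 : (key (join t) < key (head set0 t))%N.
  rewrite key_join //; case: (t) t1 ht => // x [|y r] // _.
  rewrite /decreasing /= => /andP[/andP[xy _] _].
  by move: xy; rewrite /key_gt => ->; rewrite /= orbT.
have k6 : (key (head set0 g) <= key (head set0 s1))%N || (key (head set0 g) <= key (head set0 t))%N.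
  have := head_mem g0; rewrite (perm_mem gp) !mem_cat orbCA.
  move=> /orP[/(head_decreasing ht) -> |hin]; first by rewrite orbT.
  have -> : head set0 s1 = head set0 (s1 ++ join t :: s2) by case: (s1) s10.
  rewrite head_decreasing // mem_cat inE; case/orP: hin => ->; rewrite ?orbT //.
rewrite /phi; move: k1 k2 k3 k4 k5 k6; clear; lia.
Qed.

End ComKoszul.

Theorem mainTheorem9 (k : fieldType) (char0 : [pchar k] =i pred0) :
  koszul (As k) /\ koszul (Com k) /\ koszul (Lie k).
Proof.
by split; [apply: As_koszul | split; [apply: Com_koszul | apply: Lie_koszul]].
Qed.
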